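(* Let $\alpha_0>0$. For all sufficiently small mesh sizes $h>0$ there is a constant $C$, independent of $h$ and $\alpha$, such that for all $0<\alpha\le\alpha_0$ the following holds. If $(y,u,z)$ is the optimal solution of the continuous problem $(\widetilde{\mathrm P})$ and $(y_h,u_h,z_h)$ is the optimal solution of the discretized problem $(\widetilde{\mathrm{DP}}_h)$ (both problems with parameter $\alpha$, both described in the context), then $$\frac{\alpha}{2}\|u-u_h\|_{L^2(\Omega)}^2+\frac12\|y-y_h\|_{L^2(\Omega)}^2\le C\left(h^2+\alpha h^2+\alpha^{-1}h^2+h^3+\alpha^{-1}h^4+\alpha^{-2}h^4\right).$$
   Context: **Continuous problem.** Let $n\in\{2,3\}$ and let $\Omega\subset\mathbb R^n$ be a convex, open, bounded domain with $C^{1,1}$ or polygonal (polyhedral) boundary. Let $y_c,y_d\in L^2(\Omega)$, $\alpha,\beta>0$, and $-\infty<a<0<b<+\infty$. Let $A$ be the operator $(Ay)(x)=-\sum_{i,j=1}^n\partial_{x_j}(a_{ij}(x)y_{x_i})+c_0(x)y(x)$, where $a_{ij},c_0\in L^\infty(\Omega)$, $c_0\ge0$, $a_{ij}=a_{ji}$, and, for some $\theta>0$, $\sum_{i,j}a_{ij}(x)\xi_i\xi_j\ge\theta\|\xi\|^2$ for almost all $x\in\Omega$ and all $\xi\in\mathbb R^n$. For $f\in L^2(\Omega)$ let $\mathcal S f\in H^1_0(\Omega)$ be the unique weak solution $y$ of $Ay=f$ in $\Omega$, $y=0$ on $\partial\Omega$. Let $U_{ad}=\{v\in L^2(\Omega):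 a\le v\le b\text{ a.e. in }\Omega\}$. Problem $(\widetilde{\mathrm P})$ is: minimize $$\tfrac12\|y-y_d\|_{L^2(\Omega)}^2+\tfrac\alpha4\|u\|_{L^2(\Omega)}^2+\tfrac\alpha4\|z\|_{L^2(\Omega)}^2+\beta\|z\|_{L^1(\Omega)}$$ over $(y,u,z)\in H_0^1(\Omega)\times L^2(\Omega)\times L^2(\Omega)$ subject to $y=\mathcal S(u+y_c)$, $u=z$, $z\in U_{ad}$. It has a unique solution. **Meshes.** $\{\mathcal T_h\}_{h>0}$ is a family of regular, quasi-uniform triangulations. With $\rho_T$ the diameter of a cell $T$, $\sigma_T$ the diameter of the largest ball contained in $T$, and $h=\max_{T\in\mathcal T_h}\rho_T$, there are constants $\kappa,\tau>0$ such that $\rho_T/\sigma_T\le\kappa$ and $h/\rho_T\le\tau$ for all $T\in\mathcal T_h$ and all $h$. Let $\bar\Omega_h=\bigcup_{T\in\mathcal T_h}T$, and let $\Omega_h\subset\Omega$ be its interior. If $\Omega$ is a polyhedral domain, $\Omega_h=\Omega$. If $\Omega$ has a $C^{1,1}$ boundary, $\bar\Omega_h$ is convex, all boundary vertices of $\bar\Omega_h$ lie on $\partial\Omega$, and $|\Omega\setminus\Omega_h|\le c\,h^2$ with a constant $c$ independent of $h$. **Discrete spaces.** $Y_h=U_h$ is the space of functions in $C(\bar\Omega)$ that are affine on each $T\in\mathcal T_h$ and vanish on $\bar\Omega\setminus\Omega_h$. Let $\phi_1,\dots,\phi_{N_h}$ be the nodal (hat) basis of this space, so that $z_h=\sum_i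 z_i\phi_i$ with $z_i=z_h(x_i)$. Set $U_{ad,h}=U_h\cap U_{ad}=\{\sum_i z_i\phi_i: a\le z_i\le b\ \forall i\}$. For $f\in L^2(\Omega)$, $\mathcal S_hf\in Y_h$ is the unique $y_h\in Y_h$ with $$\int_{\Omega_h}\Big(\sum_{i,j}a_{ij}(y_h)_{x_i}(v_h)_{x_j}+c_0y_hv_h\Big)dx=\int_{\Omega_h}f v_h\,dx\quad\forall v_h\in Y_h .$$ The setting is assumed to be such that the standard finite element estimate holds: there is $c_1>0$ independent of $h,u,y_c$ with $\|y-y_h\|_{L^2(\Omega)}+h\|\nabla y-\nabla y_h\|_{L^2(\Omega)}\le c_1h^2(\|u\|_{L^2(\Omega)}+\|y_c\|_{L^2(\Omega)})$ for $y=\mathcal S(u+y_c)$, $y_h=\mathcal S_h(u+y_c)$; in particular $\|\mathcal S-\mathcal S_h\|_{L^2\to L^2}\le c_1h^2$ and $\|\mathcal S-\mathcal S_h\|_{L^2\to H^1}\le c_1h$. **Discretized problem.** For $z_h=\sum_iz_i\phi_i\in U_h$ define $$\|z_h\|_{L^2_h(\Omega_h)}=\Big(\sum_{i=1}^{N_h}z_i^2\int_{\Omega_h}\phi_i\,dx\Big)^{1/2},\qquad \|z_h\|_{L^1_h(\Omega_h)}=\sum_{i=1}^{N_h}|z_i|\int_{\Omega_h}\phi_i\,dx .$$ Problem $(\widetilde{\mathrm{DP}}_h)$ is: minimize $$\tfrac12\|y_h-y_d\|_{L^2(\Omega_h)}^2+\tfrac\alpha4\|u_h\|_{L^2(\Omega_h)}^2+\tfrac\alpha4\|z_h\|_{L^2_h(\Omega_h)}^2+\beta\|z_h\|_{L^1_h(\Omega_h)}$$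 over $(y_h,u_h,z_h)\in Y_h\times U_h\times U_h$ subject to $y_h=\mathcal S_h(u_h+y_c)$, $u_h=z_h$, $z_h\in U_{ad,h}$. It has a unique solution. The constant $C$ may depend on the fixed data ($\Omega$, $A$, $y_c$, $y_d$, $a$, $b$, $\beta$, $\alpha_0$, the mesh-family constants), but not on $h$ or $\alpha$. *)

(* Defs.v *)
From HB Require Import structures.
From mathcomp Require Import all_boot all_order all_algebra.
From mathcomp Require Import all_classical all_reals all_analysis.

Set Implicit Arguments.
Unset Strict Implicit.
Unset Printing Implicit Defensive.
Import Order.TTheory GRing.Theory Num.Theory.
Import numFieldNormedType.Exports.

Local Open Scope classical_set_scope.
Local Open Scope ring_scope.

(* The product sigma-algebra on row vectors; over R it is the Borel one. *)
Definition measure_row_display : measure_display -> measure_display.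
Proof. exact. Qed.

Section measurable_row.
Context {d} {T : sigmaRingType d}.
Variable n : nat.

Let coords : 'I_n -> 'rV[T]_n -> T := fun i x => x ord0 i.

Let row_set0 : g_sigma_preimage coords set0.
Proof. exact: sigma_algebra0. Qed.

Let row_setC A : g_sigma_preimage coords A -> g_sigma_preimage coords (~` A).
Proof. exact: sigma_algebraC. Qed.

Let row_bigcup (F : (set 'rV[T]_n)^nat) :
  (forall i, g_sigma_preimage coords (F i)) ->
  g_sigma_preimage coords (\bigcup_i (F i)).
Proof. exact: sigma_algebra_bigcup. Qed.

HB.instance Definition _ := @isMeasurable.Build (measure_row_display d)
  'rV[T]_n (g_sigma_preimage coords) row_set0 row_setC row_bigcup.

End measurable_row.

Lemma measurable_coord d (T : sigmaRingType d) n (i : 'I_n) :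
  measurable_fun [set: 'rV[T]_n] (fun x : 'rV[T]_n => x ord0 i).
Proof.
move=> _ Y mY; rewrite setTI; apply: sub_sigma_algebra => /=.
rewrite -bigcup_seq/=; exists i => /=; first by rewrite mem_index_enum.
by exists Y => //; rewrite setTI.
Qed.

Lemma measurable_fun_row d1 d2 (T1 : measurableType d1) (T2 : measurableType d2)
    n (f : T1 -> 'rV[T2]_n) :
  (forall i, measurable_fun [set: T1] (fun x => f x ord0 i)) ->
  measurable_fun [set: T1] f.
Proof.
move=> mf _ A mA; rewrite setTI.
suff : g_sigma_preimage (fun i x => f x ord0 i) (f @^-1` A).
  apply: smallest_sub; first exact: sigma_algebra_measurable.
  rewrite -bigcup_seq/=; apply: bigcup_sub => i _ _ [B mB <-].
  exact: mf.
rewrite (g_sigma_preimage_comp (fun i (x : 'rV[T2]_n) => x ord0 i) f).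
by exists A => //; rewrite setTI.
Qed.

Section lebesgue_row.
Context (R : realType).

Definition cons_row n (p : R * 'rV[R]_n) : 'rV[R]_n.+1 :=
  \row_i oapp (fun j => p.2 ord0 j) p.1 (unlift ord0 i).

Definition uncons_row n (x : 'rV[R]_n.+1) : R * 'rV[R]_n :=
  (x ord0 ord0, \row_i x ord0 (lift ord0 i)).

Lemma cons_row0 n (p : R * 'rV[R]_n) : cons_row p ord0 ord0 = p.1.
Proof. by rewrite mxE unlift_none. Qed.

Lemma cons_rowS n (p : R * 'rV[R]_n) i :
  cons_row p ord0 (lift ord0 i) = p.2 ord0 i.
Proof. by rewrite mxE liftK. Qed.

Lemma cons_rowK n : cancel (@cons_row n) (@uncons_row n).
Proof.
case=> a v; rewrite /uncons_row cons_row0; congr pair => /=.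
by apply/rowP => i; rewrite mxE cons_rowS.
Qed.

Lemma measurable_cons_row n :
  measurable_fun [set: R * 'rV[R]_n] (@cons_row n).
Proof.
apply: measurable_fun_row => i; case: (unliftP ord0 i) => [j|] ->.
  under eq_fun do rewrite cons_rowS.
  exact: (measurableT_comp (measurable_coord j)).
by under eq_fun do rewrite cons_row0; exact: measurable_fst.
Qed.

Lemma measurable_uncons_row n :
  measurable_fun [set: 'rV[R]_n.+1] (@uncons_row n).
Proof.
apply/measurable_fun_pairP; split; first exact: measurable_coord.
apply: measurable_fun_row => i /=.
by under eq_fun do rewrite mxE; exact: measurable_coord.
Qed.

Section step.
Variables (n : nat) (mu : {sigma_finite_measure set 'rV[R]_n -> \bar R}).

Definition lebesgue_step : set 'rV[R]_n.+1 -> \bar R :=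
  pushforward (@lebesgue_measure R \x mu)%E (@cons_row n).

Let lebesgue_step0 : lebesgue_step set0 = 0%E.
Proof. by rewrite /lebesgue_step /pushforward preimage_set0 measure0. Qed.

Let lebesgue_step_ge0 A : (0 <= lebesgue_step A)%E.
Proof. by rewrite /lebesgue_step /pushforward; exact: measure_ge0. Qed.

Let lebesgue_step_sigma_additive : semi_sigma_additive lebesgue_step.
Proof.
move=> F mF tF mUF; rewrite /lebesgue_step /pushforward preimage_bigcup.
have mpre A : measurable A -> measurable (@cons_row n @^-1` A).
  by move=> mA; rewrite -[X in measurable X]setTI; exact: measurable_cons_row.
apply: measure_semi_sigma_additive; first by move=> k; exact: mpre.
- apply/trivIsetP => /= i j _ _ ij; rewrite -preimage_setI.
  by move/trivIsetP : tF => /(_ _ _ _ _ ij) ->//; rewrite preimage_set0.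
- by rewrite -preimage_bigcup; exact: mpre.
Qed.

HB.instance Definition _ := isMeasure.Build _ _ _ lebesgue_step
  lebesgue_step0 lebesgue_step_ge0 lebesgue_step_sigma_additive.

Let lebesgue_step_sigma_finite : sigma_finite setT lebesgue_step.
Proof.
have /sigma_finiteP[F [TF ndF Ffin]] := sigma_finiteT (@lebesgue_measure R).
have /sigma_finiteP[G [TG ndG Gfin]] := sigma_finiteT mu.
exists (fun k => @uncons_row n @^-1` (F k `*` G k)).
  apply/seteqP; split => // x _.
  have [k _ Fk] : (\bigcup_k F k) (uncons_row x).1 by rewrite -TF.
  have [l _ Gl] : (\bigcup_k G k) (uncons_row x).2 by rewrite -TG.
  exists (maxn k l) => //; split => /=.
    by move: Fk; exact/subsetPset/ndF/leq_maxl.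
  by move: Gl; exact/subsetPset/ndG/leq_maxr.
move=> k; have [mF Fk] := Ffin k; have [mG Gk] := Gfin k; split.
  rewrite -[X in measurable X]setTI; apply: measurable_uncons_row => //.
  exact: measurableX.
rewrite /lebesgue_step /pushforward -comp_preimage.
rewrite (_ : _ \o _ = id) ?preimage_id; last exact/funext/cons_rowK.
by rewrite product_measure1E// lte_mul_pinfty// ge0_fin_numE.
Qed.

HB.instance Definition _ := Measure_isSigmaFinite.Build _ _ _ lebesgue_step
  lebesgue_step_sigma_finite.

End step.

(* n-dimensional Lebesgue measure, as an iterated product (see lebesgueRn_box) *)
Fixpoint lebesgueRn n : {sigma_finite_measure set 'rV[R]_n -> \bar R} :=
  match n with
  | 0 => dirac (0 : 'rV[R]_0)
  | m.+1 => lebesgue_step (lebesgueRn m)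
  end.

Lemma lebesgueRn_box n (A : 'I_n -> set R) :
  (forall i, measurable (A i)) ->
  lebesgueRn n [set x : 'rV[R]_n | forall i, A i (x ord0 i)] =
  (\prod_(i < n) @lebesgue_measure R (A i))%E.
Proof.
elim: n A => [|n IH] A mA /=.
  by rewrite big_ord0 diracE mem_set// => -[].
rewrite /lebesgue_step /pushforward.
have -> : @cons_row n @^-1` [set x | forall i, A i (x ord0 i)] =
  A ord0 `*` [set x : 'rV[R]_n | forall i, A (lift ord0 i) (x ord0 i)].
  apply/seteqP; split => -[a v] /= H.
    by split=> [|i]; [have := H ord0|have := H (lift ord0 i)];
      rewrite ?cons_row0 ?cons_rowS.
  by move=> i; case: (unliftP ord0 i) => [j|] ->; rewrite ?cons_row0 ?cons_rowS//;
    case: H.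
rewrite big_ord_recl -IH//; apply: product_measure1E; first exact: mA.
suff -> : [set x : 'rV[R]_n | forall i, A (lift ord0 i) (x ord0 i)] =
  \bigcap_(i in [set: 'I_n])
    ((fun x : 'rV[R]_n => x ord0 i) @^-1` A (lift ord0 i)).
  apply: fin_bigcap_measurable => // i _.
  by rewrite -[X in measurable X]setTI; exact: measurable_coord.
by apply/seteqP; split => x /= H i => [_|]; [exact: H|exact: (H i I)].
Qed.

End lebesgue_row.

Section euclidean.
Context {R : realType} {n : nat}.
Implicit Types (x y v : 'rV[R]_n) (A Om : set 'rV[R]_n) (f g : 'rV[R]_n -> R).

(* The library norm `|x| on 'rV[R]_n is the sup norm; it only provides the
   topology here, metric quantities use the Euclidean norm. *)
Definition dot x y : R := \sum_i x ord0 i * y ord0 i.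

Definition enorm x : R := Num.sqrt (dot x x).

Definition diam A : R := sup [set enorm (p.1 - p.2) | p in A `*` A].

Definition in_diam A : R :=
  sup [set 2 * r | r in [set r | 0 <= r /\
    exists x, [set y | enorm (y - x) <= r] `<=` A]].

Definition frontier A := closure A `\` A°.

Definition pd (i : 'I_n) f : 'rV[R]_n -> R :=
  fun x => 'D_(delta_mx ord0 i) f x.

Definition C11 g := (forall x, differentiable g x) /\
  forall i, [lipschitz pd i g x | x in [set: 'rV[R]_n]].

(* Near each boundary point, Om is the strict epigraph of a C^{1,1} function
   over the hyperplane orthogonal to a unit vector nu; g is defined on the
   whole space but only its values on that hyperplane matter. *)
Definition C11_boundary Om := forall x0, frontier Om x0 ->
  exists r nu g, [/\ 0 < r, dot nu nu = 1, C11 g &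
    forall x, enorm (x - x0) < r ->
      (Om x <-> g ((x - x0) - dot nu (x - x0) *: nu) < dot nu (x - x0))].

(* For a bounded convex open set, having a polygonal (polyhedral) boundary
   means being a finite intersection of open half-spaces. *)
Definition polyhedral Om := exists m (w : 'I_m -> 'rV[R]_n) (c : 'I_m -> R),
  Om = [set x | forall i, dot (w i) x < c i].

End euclidean.

Section sobolev.
Context {R : realType} {n : nat}.
Implicit Types (Om : set 'rV[R]_n) (f g u v w y : 'rV[R]_n -> R).

Local Notation mu := (lebesgueRn R n).

(* Elements of L^p(Om) are represented by functions on the whole space whose
   values outside Om are irrelevant. *)
Definition L2 Om f := f \_ Om \in Lfun mu 2%:E.

Definition Linfty Om f := f \_ Om \in Lfun mu +oo%E.

Definition L2norm Om f : R := fine ('N[mu]_2%:E [EFin \o (f \_ Om)]).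

Definition L1norm Om f : R := fine ('N[mu]_1%E [EFin \o (f \_ Om)]).

(* C_c^oo(Om): all iterated partial derivatives exist and are differentiable *)
Definition test_function Om f :=
  (forall (s : seq 'I_n) x, differentiable (foldr pd f s) x) /\
  exists2 K, compact K & K `<=` Om /\ forall x, ~ K x -> f x = 0.

Definition is_weak_pd Om (i : 'I_n) v g := forall phi, test_function Om phi ->
  \int[mu]_(x in Om) (v x * pd i phi x) = - \int[mu]_(x in Om) (g x * phi x).

Definition H1 Om v :=
  L2 Om v /\ forall i, exists2 g, L2 Om g & is_weak_pd Om i v g.

(* the weak partial derivative, unique up to a null set; 0 if there is none in L2 *)
Definition wpd Om (i : 'I_n) v : 'rV[R]_n -> R :=
  xget (cst 0) [set g | L2 Om g /\ is_weak_pd Om i v g].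

Definition grad_norm Om v : R :=
  Num.sqrt (\sum_i L2norm Om (wpd Om i v) ^+ 2).

Definition H1norm Om v : R :=
  Num.sqrt (L2norm Om v ^+ 2 + grad_norm Om v ^+ 2).

Definition H10 Om v := H1 Om v /\
  forall e, 0 < e -> exists2 phi, test_function Om phi &
    H1norm Om (v \- phi) < e.

Section operator.
Variables (aij : 'I_n -> 'I_n -> 'rV[R]_n -> R) (c0 : 'rV[R]_n -> R).

Definition coefficients Om := [/\
  (forall i j, Linfty Om (aij i j)) /\ Linfty Om c0,
  {ae mu, forall x, Om x -> 0 <= c0 x},
  forall i j, {ae mu, forall x, Om x -> aij i j x = aij j i x} &
  exists2 theta : R, 0 < theta & {ae mu, forall x, Om x ->
    forall xi : 'rV[R]_n, theta * enorm xi ^+ 2 <=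
      \sum_i \sum_j aij i j x * xi ord0 i * xi ord0 j}].

Definition bilinear_form Om y v : R := \int[mu]_(x in Om)
  ((\sum_i \sum_j aij i j x * wpd Om i y x * wpd Om j v x)
   + c0 x * y x * v x).

(* y = S f *)
Definition weak_solution Om f y := H10 Om y /\
  forall v, H10 Om v ->
    bilinear_form Om y v = \int[mu]_(x in Om) (f x * v x).

End operator.

Definition Uad Om (a b : R) v :=
  L2 Om v /\ {ae mu, forall x, Om x -> a <= v x <= b}.

End sobolev.

(* A cell is given by the set of indices of its vertices. *)
Record mesh (R : realType) (n : nat) := Mesh {
  nvtx : nat;
  vtx : 'I_nvtx -> 'rV[R]_n;
  cells : {set {set 'I_nvtx}} }.
Arguments vtx {R n} m i.

Section finite_elements.
Context {R : realType} {n : nat}.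
Implicit Types (Om : set 'rV[R]_n) (M : mesh R n) (f u v w y z : 'rV[R]_n -> R).

Local Notation mu := (lebesgueRn R n).

Definition simplex M (K : {set 'I_(nvtx M)}) : set 'rV[R]_n :=
  [set \sum_(i in K) t i *: vtx M i | t in
    [set t : 'I_(nvtx M) -> R |
      (forall i, 0 <= t i) /\ \sum_(i in K) t i = 1]].

Definition affinely_independent M (K : {set 'I_(nvtx M)}) :=
  forall t : 'I_(nvtx M) -> R,
    \sum_(i in K) t i = 0 -> \sum_(i in K) t i *: vtx M i = 0 ->
    forall i, i \in K -> t i = 0.

(* conforming: two cells meet exactly in the face spanned by their common
   vertices *)
Definition triangulation M := [/\
  forall K, K \in cells M -> #|K| = n.+1 /\ affinely_independent K,
  forall K L, K \in cells M -> L \in cells M ->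
    simplex K `&` simplex L = simplex (K :&: L) &
  forall i, exists2 K, K \in cells M & i \in K].

Definition mesh_size M : R :=
  \big[Num.max/0]_(K in cells M) diam (simplex K).

Definition closed_mesh_domain M : set 'rV[R]_n :=
  [set x | exists2 K, K \in cells M & simplex K x].

Definition mesh_domain M : set 'rV[R]_n := (closed_mesh_domain M)°.

Definition quasi_uniform (kappa tau : R) M := forall K, K \in cells M ->
  diam (simplex K) / in_diam (simplex K) <= kappa /\
  mesh_size M / diam (simplex K) <= tau.

Definition approximates_domain (c : R) Om M := [/\
  mesh_domain M `<=` Om,
  polyhedral Om -> mesh_domain M = Om &
  C11_boundary Om ->
    [/\ convex_set (closed_mesh_domain M : set (convex_lmodType 'rV[R]_n)),
        forall i, frontier (closed_mesh_domain M) (vtx M i) ->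
          frontier Om (vtx M i) &
        (mu (Om `\` mesh_domain M) <= (c * mesh_size M ^+ 2)%:E)%E]].

(* Y_h = U_h *)
Definition fe_space Om M v := [/\
  {within closure Om, continuous v},
  forall K, K \in cells M -> exists (w : 'rV[R]_n) (c : R),
    forall x, simplex K x -> v x = dot w x + c &
  forall x, closure Om x -> ~ mesh_domain M x -> v x = 0].

(* nodal basis function of the i-th vertex; determined on closure Om when the
   vertex lies in mesh_domain M, which are the only vertices it is used for *)
Definition hat Om M (i : 'I_(nvtx M)) : 'rV[R]_n -> R :=
  xget (cst 0) [set phi | fe_space Om M phi /\
    forall j, phi (vtx M j) = (i == j)%:R].

Definition L2h_norm Om M z : R :=
  Num.sqrt (\sum_(i | `[< mesh_domain M (vtx M i) >])
    z (vtx M i) ^+ 2 * \int[mu]_(x in mesh_domain M) hat Om i x).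

Definition L1h_norm Om M z : R :=
  \sum_(i | `[< mesh_domain M (vtx M i) >])
    `|z (vtx M i)| * \int[mu]_(x in mesh_domain M) hat Om i x.

Section operator.
Variables (aij : 'I_n -> 'I_n -> 'rV[R]_n -> R) (c0 : 'rV[R]_n -> R).

(* y = S_h f *)
Definition discrete_solution Om M f y := fe_space Om M y /\
  forall v, fe_space Om M v ->
    bilinear_form aij c0 (mesh_domain M) y v =
    \int[mu]_(x in mesh_domain M) (f x * v x).

Definition fe_error_estimate (c1 : R) Om M := forall u w y yh,
  L2 Om u -> L2 Om w ->
  weak_solution aij c0 Om (u \+ w) y ->
  discrete_solution Om M (u \+ w) yh ->
  L2norm Om (y \- yh) + mesh_size M * grad_norm Om (y \- yh) <=
    c1 * mesh_size M ^+ 2 * (L2norm Om u + L2norm Om w).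

(* A family T_h indexed by its own mesh size, h ranging over the set H of
   mesh sizes that occur. *)
Definition mesh_family (kappa tau c c1 : R) Om (H : set R) (T : R -> mesh R n) :=
  forall h, H h ->
    [/\ 0 < h, mesh_size (T h) = h & triangulation (T h)] /\
    [/\ quasi_uniform kappa tau (T h), approximates_domain c Om (T h) &
        fe_error_estimate c1 Om (T h)].

Section problems.
Variables (Om : set 'rV[R]_n) (yc yd : 'rV[R]_n -> R) (a b alpha beta : R).

Definition cost y u z : R :=
  2^-1 * L2norm Om (y \- yd) ^+ 2 + alpha / 4 * L2norm Om u ^+ 2 +
  alpha / 4 * L2norm Om z ^+ 2 + beta * L1norm Om z.

Definition feasible y u z := [/\ L2 Om u, L2 Om z,
  weak_solution aij c0 Om (u \+ yc) y,
  u = z %[ae mu in Om] & Uad Om a b z].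

Definition optimal y u z := feasible y u z /\
  forall y' u' z', feasible y' u' z' -> cost y u z <= cost y' u' z'.

Definition discrete_cost M y u z : R :=
  2^-1 * L2norm (mesh_domain M) (y \- yd) ^+ 2 +
  alpha / 4 * L2norm (mesh_domain M) u ^+ 2 +
  alpha / 4 * L2h_norm Om M z ^+ 2 + beta * L1h_norm Om M z.

Definition discrete_feasible M y u z := [/\ fe_space Om M u,
  fe_space Om M z,
  discrete_solution Om M (u \+ yc) y,
  {in closure Om, u =1 z} & Uad Om a b z].

Definition discrete_optimal M y u z := discrete_feasible M y u z /\
  forall y' u' z', discrete_feasible M y' u' z' ->
    discrete_cost M y u z <= discrete_cost M y' u' z'.

End problems.
End operator.
End finite_elements.

(* Main.v *)
Require Import Defs.
From HB Require Import structures.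
From mathcomp Require Import all_boot all_order all_algebra.
From mathcomp Require Import all_classical all_reals all_analysis.
From mathcomp Require Import measurable_realfun ess_sup_inf.
From mathcomp Require Import ring lra.

Set Implicit Arguments.
Unset Strict Implicit.
Unset Printing Implicit Defensive.
Import Order.TTheory GRing.Theory Num.Theory.
Import numFieldNormedType.Exports.

Local Open Scope classical_set_scope.
Local Open Scope ring_scope.

(** Write [yhat] = S(uh + yc) for the continuous state of the discrete control and
    [ytil] = S_h(u + yc) for the discrete state of the continuous control. Testing the
    continuous problem with uh and using its strong convexity gives

      0 <= (y - yd, yhat - y) + alpha/2 (|uh|^2 - |u|^2 - |u - uh|^2)
           + beta (|uh|_1 - |u|_1)

    ([optimal_variational_inequality]). In the discrete problem, let q = S_h(yh - yd)
    be the discrete adjoint state and let the competitor vh take at each vertex the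
    minimizer over [a, b] of v |-> q v + alpha/2 v^2 + beta |v|
    ([discrete_variational_inequality], [control_cost_minimizer]).

    These nodal minima can be compared with the values of u, which is merely
    integrable: at a point x with barycentric coordinates t_i the minimum at vertex i
    is at most the cost of the constant u(x) there, this cost is affine in q, and so
    the mean of the minima is at most q(x) u(x) + alpha/2 u(x)^2 + beta |u(x)|. The
    lumped norms are exactly such means, and they dominate the exact norms of uh by
    Jensen's inequality. The only product that is not evaluated at the vertices is the
    integral of q vh; it differs from its nodal quadrature by a covariance of vertex
    values, at most h^2 |grad q|^2 / (2 alpha) because minimizers are monotone and
    1/alpha-Lipschitz in q ([lumped_control_cost], [lumped_control_comparison]).

    By symmetry of S_h the adjoint terms become state differences, and the sum of both
    inequalities is ([combined_variational_inequality])

      alpha/2 |u - uh|^2 <= (y - yd, yhat - y) + (yh - yd, ytil - yh)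
                            + h^2 / (2 alpha) |grad q|^2.

    The finite element estimate makes yhat - yh and y - ytil of order h^2, so the two
    inner products equal -|y - yh|^2 up to O(h^2), while |grad q| is bounded by
    stability of S_h. This proves the estimate with right-hand side
    C (h^2 + h^2 / alpha) ([control_error_estimate]).

    The argument presupposes that yhat, ytil, q and vh exist. For yhat this is the
    Riesz representation theorem in the energy inner product, which rests on the
    Poincare inequality and the completeness of H10; for S_h it is a Gram system, whose
    definiteness is a Poincare inequality for finite element functions. That these
    functions have their cellwise gradients as weak derivatives, and both Poincare
    inequalities, come from one principle: difference quotients of a Lipschitz function
    with bounded support integrate to zero by translation invariance, and so does their
    limit ([Rintegral_directional_derivative]). Weak derivatives are unique by the
    fundamental lemma, for which bumps are built from exp(-1/t). Nodal interpolants are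
    continuous since the mesh is conforming, and they vanish on the boundary of the
    mesh since segments from an interior vertex reach that boundary only at their
    far end ([mesh_star]). *)

(** * Lebesgue measure on row vectors *)

Section boxes.
Context {R : realType} {n : nat}.
Local Notation V := 'rV[R]_n.
Local Notation mu := (lebesgueRn R n).

Definition obox (a b : V) : set V :=
  [set x | forall i, a ord0 i < x ord0 i < b ord0 i].

Definition cbox (a b : V) : set V :=
  [set x | forall i, a ord0 i <= x ord0 i <= b ord0 i].

Lemma measurable_product_set (I : 'I_n -> set R) :
  (forall i, measurable (I i)) ->
  measurable [set x : V | forall i, I i (x ord0 i)].
Proof.
move=> mI.
rewrite (_ : mkset _ = \bigcap_(i in [set: 'I_n])
    ((fun x : V => x ord0 i) @^-1` I i)); last first.
  by apply/seteqP; split => x /= H i => [_|]; [exact: H|exact: (H i Logic.I)].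
apply: fin_bigcap_measurable => // i _.
by rewrite -[X in measurable X]setTI; exact: measurable_coord.
Qed.

Lemma oboxE a b : obox a b =
  [set x : V | forall i, [set` `]a ord0 i, b ord0 i[%R] (x ord0 i)].
Proof.
by apply/seteqP; split => x /= H i; have := H i; rewrite in_itv.
Qed.

Lemma measurable_obox a b : measurable (obox a b).
Proof. by rewrite oboxE; exact: (measurable_product_set (I := fun i => [set` `]a ord0 i, b ord0 i[%R])). Qed.

Lemma lebesgueRn_obox a b : mu (obox a b) =
  (\prod_(i < n) (Num.max (b ord0 i - a ord0 i) 0)%:E)%E.
Proof.
rewrite oboxE (lebesgueRn_box (A := fun i => [set` `]a ord0 i, b ord0 i[%R]))//; apply: eq_bigr => i _.
rewrite lebesgue_measure_itv/= lte_fin.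
case: ltP => ab; first by rewrite max_l// subr_ge0 ltW.
by rewrite max_r// subr_le0.
Qed.

Lemma lebesgueRn_obox_lty a b : (mu (obox a b) < +oo)%E.
Proof.
by rewrite lebesgueRn_obox prodEFin ltry.
Qed.

Lemma oboxI a b a' b' : obox a b `&` obox a' b' =
  obox (\row_i Num.max (a ord0 i) (a' ord0 i))
       (\row_i Num.min (b ord0 i) (b' ord0 i)).
Proof.
apply/seteqP; split => x /=.
  move=> [H H'] i; rewrite !mxE gt_max lt_min.
  by have /andP[-> ->] := H i; have /andP[-> ->] := H' i.
move=> H; split => i; have := H i; rewrite !mxE gt_max lt_min.
  by move=> /andP[/andP[-> _] /andP[-> _]].
by move=> /andP[/andP[_ ->] /andP[_ ->]].
Qed.

Definition oboxes : set (set V) := [set obox ab.1 ab.2 | ab in [set: V * V]].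

Lemma oboxes_setI : setI_closed oboxes.
Proof.
move=> _ _ [[a b] _ <-] [[a' b'] _ <-]; rewrite oboxI/=.
by eexists (_, _).
Qed.

Definition cube (k : nat) : set V := obox (const_mx (- k%:R)) (const_mx k%:R).

Lemma cube_cover : \bigcup_k cube k = setT.
Proof.
apply/seteqP; split => // x _.
exists (Num.truncn (`|x|)).+1 => // i; rewrite !mxE -ltr_norml.
apply: le_lt_trans (truncnS_gt _).
by have := mx_normrE x; rewrite /Num.norm/= => ->;
  apply: (le_bigmax _ (fun ij => `|x ij.1 ij.2|) (ord0, i)).
Qed.

(** A half space bounded in one coordinate is the union of its intersections with
    growing cubes, so the coordinates are measurable for the boxes. *)
Lemma oboxes_generate : measurable = <<s oboxes >> :> set (set V).
Proof.
apply/seteqP; split; last first.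
  apply: smallest_sub; first exact: sigma_algebra_measurable.
  by move=> _ [[a b] _ <-]; exact: measurable_obox.
apply: smallest_sub; first exact: smallest_sigma_algebra.
rewrite -bigcup_seq; apply: bigcup_sub => i _ A [B mB <-]; rewrite setTI.
have : measurable_fun [set: g_sigma_algebraType oboxes]
    (fun x : V => x ord0 i).
  apply: (measurability _ (RGenOInfty.measurableE R)).
  move=> _ [_ [r ->] <-]; rewrite setTI.
  rewrite (_ : _ @^-1` _ = \bigcup_k (obox
     (\row_j if j == i then r else - k%:R) (const_mx k%:R))).
    apply: sigma_algebra_bigcup => k; apply: sub_sigma_algebra.
    by eexists (_, _).
  apply/seteqP; split => x /=; rewrite in_itv/= andbT; last first.
    by move=> [k _ /(_ i)]; rewrite !mxE eqxx => /andP[].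
  move=> rx; have [k _ xk] : (\bigcup_k cube k) x by rewrite cube_cover.
  exists k => // j; rewrite !mxE; have := xk j; rewrite !mxE => /andP[x1 ->].
  by case: eqP => [->|_]; rewrite ?rx ?x1.
by move=> /(_ measurableT B mB); rewrite setTI.
Qed.

(** Open sets are countable unions of rational boxes; the closed boxes are
    asked to fit too, so that they are compact subsets of the open set. *)
Definition rat_lo (p : 'rV[rat]_n * nat) : V := \row_i (ratr (p.1 ord0 i) - p.2.+1%:R^-1).
Definition rat_hi (p : 'rV[rat]_n * nat) : V := \row_i (ratr (p.1 ord0 i) + p.2.+1%:R^-1).

Lemma nbhs_rowP (x : V) (A : set V) : nbhs x A <->
  exists2 e : R, 0 < e & forall y : V, (forall i, `|x ord0 i - y ord0 i| < e) -> A y.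
Proof.
split.
  move=> /nbhs_ballP[e /= e0 H]; exists e => // y xy; apply: H.
  by split=> // i j; rewrite !ord1; exact: xy.
move=> [e e0 H]; apply/nbhs_ballP; exists e => // y xy; apply: H => i.
by have [_ /(_ ord0 i)] := xy.
Qed.

Lemma open_rational_boxes (A : set V) : open A ->
  A = \bigcup_(p in [set p | cbox (rat_lo p) (rat_hi p) `<=` A])
        obox (rat_lo p) (rat_hi p).
Proof.
move=> oA; apply/seteqP; split => x; last first.
  move=> [p pA xp]; apply: pA => i; have /andP[x1 x2] := xp i.
  by rewrite (ltW x1) (ltW x2).
move=> Ax; have := oA; rewrite openE => /(_ _ Ax)/nbhs_rowP[e e0 He].
have [k ke] : exists k, k.+1%:R^-1 < e / 2 :> R.
  exists (Num.truncn (e / 2)^-1).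
  by rewrite invf_plt ?posrE ?divr_gt0// truncnS_gt.
have /boolp.choice[q Hq] : forall i, exists q : rat,
    x ord0 i - k.+1%:R^-1 < ratr q < x ord0 i + k.+1%:R^-1.
  move=> i.
  have : x ord0 i - k.+1%:R^-1 < x ord0 i + k.+1%:R^-1 by rewrite ltrBlDr -addrA ltrDl addr_gt0.
  by move=> /rat_in_itvoo[q]; rewrite in_itv/=; exists q.
exists (\row_i q i, k).
  move=> y yq; apply: He => i.
  move: (yq i) (Hq i); rewrite !mxE/=.
  set t := k.+1%:R^-1 in ke *; set qi := ratr _ => /andP[? ?] /andP[? ?].
  rewrite ltr_norml; lra.
move=> i; rewrite !mxE/=.
move: (Hq i); set t := k.+1%:R^-1; set qi := ratr _ => /andP[? ?].
by apply/andP; split; lra.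
Qed.

Lemma open_measurable_row (A : set V) : open A -> measurable A.
Proof.
move=> oA; rewrite (open_rational_boxes oA).
rewrite bigcup_mkcond; apply: countable_bigcupT_measurable => [|p].
  exact: countableP.
case: ifP => _ //.
exact: measurable_obox.
Qed.

Lemma closed_measurable_row (A : set V) : closed A -> measurable A.
Proof.
move=> cA; rewrite -(setCK A); apply: measurableC.
by apply: open_measurable_row; exact: closed_openC.
Qed.

Lemma continuous_measurable_row (f : V -> R) :
  continuous f -> measurable_fun setT f.
Proof.
move=> /continuousP cf.
apply: (measurability _ (RGenOInfty.measurableE R)).
move=> _ [_ [r ->] <-]; rewrite setTI; apply: open_measurable_row.
by apply: cf; exact: interval_open.
Qed.

Lemma measurable_shift (v : V) : measurable_fun setT (fun x : V => x + v).
Proof.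
apply: measurable_fun_row => i.
under eq_fun do rewrite mxE.
by apply: measurable_funD => //; exact: measurable_coord.
Qed.

(** Both sides are measures that agree on boxes, a generating pi-system that
    exhausts the space by sets of finite measure. *)
Lemma lebesgueRn_shift (v : V) (A : set V) : measurable A ->
  mu ((fun x => x + v) @^-1` A) = mu A.
Proof.
move=> mA.
pose f : {mfun V >-> V} := HB.pack (fun x : V => x + v)
  (isMeasurableFun.Build _ _ _ _ _ (measurable_shift v)).
rewrite -[LHS]/(pushforward mu f A); apply/esym.
apply: (measure_unique oboxes cube) => //.
- exact: oboxes_generate.
- exact: oboxes_setI.
- by move=> k; eexists (_, _).
- exact: cube_cover.
- move=> _ [[a b] _ <-]/=; rewrite /pushforward.
  rewrite (_ : f @^-1` _ = obox (a - v) (b - v)).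
    rewrite !lebesgueRn_obox; apply: eq_bigr => i _; rewrite !mxE.
    by congr (Num.max _ _)%:E; ring.
  apply/seteqP; split => x /= H i; have := H i; rewrite !mxE/=.
    by rewrite ltrBlDr ltrBrDr.
  by rewrite ltrBlDr ltrBrDr.
- by move=> k; exact: lebesgueRn_obox_lty.
Qed.

Lemma bounded_row (A : set V) : bounded_set A ->
  exists k, forall x, A x -> cube k x.
Proof.
move=> [M [Mr HM]]; exists (Num.truncn (`|M| + 1)).+1 => x Ax i; rewrite !mxE -ltr_norml.
apply: le_lt_trans (truncnS_gt _).
apply: (@le_trans _ _ `|x|).
  by have := mx_normrE x; rewrite /Num.norm/= => ->;
    apply: (le_bigmax _ (fun ij => `|x ij.1 ij.2|) (ord0, i)).
by apply: HM Ax; rewrite (le_lt_trans (ler_norm _))// ltrDl.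
Qed.

Lemma continuous_dot (w : V) : continuous (dot w).
Proof.
suff H s : continuous (fun x : V => \sum_(i <- s) w ord0 i * x ord0 i) by exact: H.
elim: s => [|i s IH].
  under eq_fun do rewrite big_nil.
  exact: cst_continuous.
under eq_fun do rewrite big_cons.
move=> x; apply: (@continuousD _ _ _ (fun x : V => w ord0 i * x ord0 i)); last exact: IH.
apply: (@continuousM _ _ (cst (w ord0 i)) (fun x : V => x ord0 i)); first exact: cst_continuous.
exact: coord_continuous.
Qed.

Lemma dotD (w x y : V) : dot w (x + y) = dot w x + dot w y.
Proof. by rewrite /dot -big_split; apply: eq_bigr => i _; rewrite mxE mulrDr. Qed.

Lemma dotZ (w x : V) t : dot w (t *: x) = t * dot w x.
Proof. by rewrite /dot mulr_sumr; apply: eq_bigr => i _; rewrite mxE mulrCA. Qed.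

Lemma dotN (w x : V) : dot w (- x) = - dot w x.
Proof. by rewrite -scaleN1r dotZ mulN1r. Qed.

Lemma dot_delta (w : V) i : dot w (delta_mx ord0 i) = w ord0 i.
Proof.
rewrite /dot (bigD1 i)//= mxE !eqxx mulr1 big1 ?addr0// => j ji.
by rewrite mxE (negPf ji) andbF mulr0.
Qed.

(** Infinitely many disjoint translates of a bounded piece of the hyperplane
    fit into one box, so by translation invariance the piece is null. *)
Lemma hyperplane_null (w : V) (c : R) : w != 0 ->
  mu [set x | dot w x = c] = 0%E.
Proof.
move=> w0.
have [i wi] : exists i, w ord0 i != 0.
  apply/existsP; rewrite -negb_forall; apply: contra w0 => /forallP H.
  by apply/eqP/rowP => i; rewrite mxE; apply/eqP/H.
have mH : measurable [set x : V | dot w x = c].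
  apply: closed_measurable_row.
  apply: (@closed_comp _ _ (dot w) [set c]); last exact: closed_eq.
  by move=> x _; exact: continuous_dot.
suff H k : mu ([set x : V | dot w x = c] `&` cube k) = 0%E.
  rewrite -(setIT [set x : V | dot w x = c]) -cube_cover setI_bigcupr.
  have mHk k : measurable ([set x : V | dot w x = c] `&` cube k).
    by apply: measurableI => //; exact: measurable_obox.
  apply: measure_negligible; first exact: bigcupT_measurable.
  apply: negligible_bigcup => k; exists ([set x | dot w x = c] `&` cube k).
  by split; [exact: mHk|exact: H|].
set B := _ `&` _.
have mB : measurable B by apply: measurableI => //; exact: measurable_obox.
pose F (j : nat) : set V := (fun x => x + (j.+1%:R^-1 *: delta_mx ord0 i)) @^-1` B.
have mF j : measurable (F j).
  by rewrite /F -[X in measurable X]setTI; exact: measurable_shift.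
have tF : trivIset setT F.
  apply/trivIsetP => j l _ _ jl; apply/seteqP; split => // x [[xj _] [xl _]].
  move: xj xl; rewrite /= !dotD !dotZ dot_delta => <- /addrI/eqP.
  rewrite -subr_eq0 -mulrBl mulf_eq0 (negPf wi) orbF subr_eq0 => /eqP/invr_inj/eqP.
  by rewrite eqr_nat => /eqP[lj]; rewrite lj eqxx in jl.
have FB j : mu (F j) = mu B by exact: lebesgueRn_shift.
have FC : \bigcup_j F j `<=` cube k.+1.
  move=> x [j _ [_ xk]] l; have := xk l; rewrite !mxE.
  have j0 : 0 < j.+1%:R^-1 :> R by [].
  have j1 : j.+1%:R^-1 <= 1 :> R by rewrite invf_le1// ler1n.
  move: j0 j1; rewrite -(natr1 k) eqxx; set t := _^-1 => ? ?.
  by case: (l == i); rewrite ?mulr1 ?mulr0 => /andP[? ?]; apply/andP; split; lra.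
have Bfin : mu B \is a fin_num.
  rewrite ge0_fin_numE//; apply: le_lt_trans (lebesgueRn_obox_lty _ _).
  by apply: le_measure; [rewrite inE..|exact: subIsetr]; [|exact: measurable_obox].
(* the first N translates are disjoint subsets of the next cube *)
have le N : (N%:R%:E * mu B <= mu (cube k.+1))%E.
  apply: (@le_trans _ _ (mu (\big[setU/set0]_(j < N) F j))).
    rewrite (measure_bigsetU mu)//.
    rewrite (eq_bigr (fun=> mu B)); last by move=> j _; exact: FB.
    by rewrite -(fineK Bfin) sumEFin sumr_const card_ord -EFinM mulr_natl.
  apply: le_measure; rewrite ?inE; [exact: bigsetU_measurable|exact: measurable_obox|].
  apply: subset_trans FC; exact: bigsetU_bigcup.
have Cfin : mu (cube k.+1) \is a fin_num.
  by rewrite ge0_fin_numE//; exact: lebesgueRn_obox_lty.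
move: le; rewrite -(fineK Bfin) -(fineK Cfin).
set r := fine (mu B); set C := fine _ => le.
have r0 : 0 <= r by exact: fine_ge0.
congr EFin; apply/eqP; rewrite eq_le r0 andbT leNgt; apply/negP => rp.
have := le (Num.truncn (C / r)).+1.
by rewrite -EFinM lee_fin -ler_pdivlMr// leNgt truncnS_gt.
Qed.

End boxes.

(** * Square integrable functions *)

Section square_integrable.
Context {R : realType} {n : nat}.
Local Notation V := 'rV[R]_n.
Local Notation mu := (lebesgueRn R n).
Implicit Types (f g h : V -> R) (A B : set V).

Definition ip A f g : R := \int[mu]_(x in A) (f x * g x).

Lemma ip_fold A f g : \int[mu]_(x in A) (f x * g x) = ip A f g.
Proof. by []. Qed.

Lemma ip_mulAC A (a : V -> R) f g :
  ip A (fun x => a x * f x) g = ip A (fun x => a x * g x) f.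
Proof. by apply: eq_Rintegral => x _; rewrite mulrAC. Qed.

Lemma sqr_restrict A f :
  (fun x => (f \_ A) x ^+ 2) = (fun x => f x ^+ 2) \_ A.
Proof.
apply/funext => x; rewrite !patchE; case: ifP => // _.
by rewrite expr0n.
Qed.

Lemma L2P A f : measurable A ->
  L2 A f <-> measurable_fun A f /\ mu.-integrable A (EFin \o (fun x => f x ^+ 2)).
Proof.
move=> mA; split.
  move=> fA; have := Lfun2_integrable_sqr fA.
  move: fA; rewrite /L2 inE => /andP[/[!inE]/= mf _] isq; split.
    exact/(measurable_restrictT f mA).
  by apply/(integrable_mkcond _ mA); move: isq; rewrite sqr_restrict restrict_EFin.
move=> [mf isq]; rewrite /L2 inE; apply/andP.
have mfA : measurable_fun setT (f \_ A) by exact/(measurable_restrictT f mA).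
split; first by rewrite inE.
rewrite inE/= /finite_norm unlock; apply: poweR_lty.
have /integrable_lty : mu.-integrable setT (EFin \o (fun x => (f \_ A) x ^+ 2)).
  by rewrite sqr_restrict -restrict_EFin; apply/(integrable_mkcond _ mA).
move=> /(_ measurableT); apply: le_lt_trans.
apply: ge0_le_integral => //.
- by move=> x _; exact: poweR_ge0.
- apply/measurable_EFinP.
  apply/(@measurableT_comp _ _ _ _ _ _ (fun x : R => x `^ 2)%R) => //.
  exact/measurableT_comp.
- by apply/measurable_EFinP; exact: measurable_funX.
- by move=> x _ /=; rewrite lee_fin powR_mulrn// -normrX ger0_norm ?sqr_ge0.
Qed.

Lemma L2norm_ge0 A f : 0 <= L2norm A f.
Proof. exact/fine_ge0/Lnorm_ge0. Qed.

Lemma L2norm_sqr A f : L2norm A f ^+ 2 = ip A f f.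
Proof.
rewrite /L2norm /ip Rintegral_mkcond.
rewrite (_ : (fun x => f x * f x) \_ A = fun x => (f \_ A) x ^+ 2); last first.
  by rewrite sqr_restrict; congr (_ \_ A); apply/funext => x; rewrite expr2.
have := Lnorm_ge0 mu 2%:E (EFin \o f \_ A).
have : ('N[mu]_2%:E[EFin \o f \_ A] `^ 2 = \int[mu]_x ((f \_ A) x ^+ 2)%:E)%E.
  rewrite poweR_Lnorm//; apply: eq_integral => x _ /=.
  by rewrite powR_mulrn// -normrX ger0_norm ?sqr_ge0.
rewrite /Rintegral => <-.
case: ('N[mu]_2%:E[EFin \o f \_ A])%E => [r|_|//]; last by rewrite poweRyr//= expr0n.
by rewrite lee_fin => r0; rewrite /= powR_mulrn.
Qed.

Section on_measurable.
Variables (A : set V) (mA : measurable A).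

Lemma L2_measurable f : L2 A f -> measurable_fun A f.
Proof. by move=> /(L2P _ mA)[]. Qed.

Lemma L2_integrable_mul f g : L2 A f -> L2 A g ->
  mu.-integrable A (EFin \o (fun x => f x * g x)).
Proof.
move=> /(L2P _ mA)[mf sf] /(L2P _ mA)[mg sg].
apply: (le_integrable mA _ _ (integrableD mA sf sg)).
  by apply/measurable_EFinP; exact: measurable_funM.
move=> x _; rewrite /= lee_fin.
rewrite (ger0_norm (addr_ge0 (sqr_ge0 _) (sqr_ge0 _))) normrM.
rewrite -(real_normK (num_real (f x))) -(real_normK (num_real (g x))).
have := normr_ge0 (f x); have := normr_ge0 (g x); nra.
Qed.

Lemma L2_integrable_sqr f : L2 A f -> mu.-integrable A (EFin \o (fun x => f x ^+ 2)).
Proof. by move=> /(L2P _ mA)[]. Qed.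

Lemma L2Z f t : L2 A f -> L2 A (fun x => t * f x).
Proof.
move=> /(L2P _ mA)[mf sf]; apply/(L2P _ mA); split; first exact: measurable_funM.
have := integrableZl mA (t ^+ 2) sf; apply: eq_integrable => // x _ /=.
by rewrite -EFinM exprMn.
Qed.

Lemma L2D f g : L2 A f -> L2 A g -> L2 A (fun x => f x + g x).
Proof.
move=> L2f L2g; move: (L2f) (L2g) => /(L2P _ mA)[mf sf] /(L2P _ mA)[mg sg].
apply/(L2P _ mA); split; first exact: measurable_funD.
have := integrableD mA (integrableD mA sf sg) (integrableZl mA 2 (L2_integrable_mul L2f L2g)).
by apply: eq_integrable => // x _ /=; rewrite -!(EFinD,EFinM); congr EFin; ring.
Qed.

Lemma L2B f g : L2 A f -> L2 A g -> L2 A (fun x => f x - g x).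
Proof.
move=> Lf Lg; rewrite (_ : (fun _ => _) = (fun x => f x + (-1) * g x)).
  by apply: L2D => //; exact: L2Z.
by apply/funext => x; rewrite mulN1r.
Qed.

Lemma ipC f g : ip A f g = ip A g f.
Proof. by apply: eq_Rintegral => x _; rewrite mulrC. Qed.

Lemma ipDl f g h : L2 A f -> L2 A g -> L2 A h ->
  ip A (fun x => f x + g x) h = ip A f h + ip A g h.
Proof.
move=> Lf Lg Lh; rewrite /ip -RintegralD//; [|exact: L2_integrable_mul..].
by apply: eq_Rintegral => x _; rewrite mulrDl.
Qed.

Lemma ipZl f h t : L2 A f -> L2 A h ->
  ip A (fun x => t * f x) h = t * ip A f h.
Proof.
move=> Lf Lh; rewrite /ip -RintegralZl//; [|exact: L2_integrable_mul].
by apply: eq_Rintegral => x _; rewrite mulrA.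
Qed.

Lemma ipBl f g h : L2 A f -> L2 A g -> L2 A h ->
  ip A (fun x => f x - g x) h = ip A f h - ip A g h.
Proof.
move=> Lf Lg Lh; rewrite /ip -RintegralB//; [|exact: L2_integrable_mul..].
by apply: eq_Rintegral => x _; rewrite mulrBl.
Qed.

Lemma ip_ge0 f : 0 <= ip A f f.
Proof. by rewrite -L2norm_sqr sqr_ge0. Qed.

Lemma ip_lin2 f g t : L2 A f -> L2 A g ->
  ip A (fun x => f x + t * g x) (fun x => f x + t * g x) =
  ip A f f + 2 * t * ip A f g + t ^+ 2 * ip A g g.
Proof.
move=> Lf Lg; have Ltg := L2Z t Lg; have LD := L2D Lf Ltg.
rewrite ipDl// (ipC f) (ipC (fun x => t * g x)) !ipDl// (ipC f (fun x => t * g x)).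
rewrite !ipZl// (ipC g (fun x => t * g x)) ipZl// (ipC g f); ring.
Qed.

Lemma ip_CS f g : L2 A f -> L2 A g -> ip A f g ^+ 2 <= ip A f f * ip A g g.
Proof.
move=> Lf Lg.
have H t : 0 <= ip A f f + 2 * t * ip A f g + t ^+ 2 * ip A g g.
  by rewrite -ip_lin2// ip_ge0.
have f0 := ip_ge0 f; have g0 := ip_ge0 g.
have [gg|gg] := eqVneq (ip A g g) 0.
  rewrite gg mulr0; have := H (- (ip A f f + 1) / (2 * ip A f g)).
  have [->|fg] := eqVneq (ip A f g) 0; first by rewrite expr0n.
  rewrite gg mulr0 addr0 (_ : 2 * _ * _ = - (ip A f f + 1)); last by field.
  lra.
have gp : 0 < ip A g g by rewrite lt_neqAle eq_sym gg.
have := H (- ip A f g / ip A g g).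
rewrite (_ : _ + _ = (ip A f f * ip A g g - ip A f g ^+ 2) / ip A g g); last by field.
by rewrite pmulr_lge0 ?invr_gt0// subr_ge0.
Qed.

Lemma ip_normM f g : L2 A f -> L2 A g -> `|ip A f g| <= L2norm A f * L2norm A g.
Proof.
move=> Lf Lg; rewrite -(@ler_pXn2r _ 2)// ?nnegrE ?mulr_ge0 ?L2norm_ge0//.
by rewrite real_normK ?num_real// exprMn !L2norm_sqr ip_CS.
Qed.

Lemma L2normD f g : L2 A f -> L2 A g ->
  L2norm A (fun x => f x + g x) <= L2norm A f + L2norm A g.
Proof.
move=> Lf Lg; rewrite -(@ler_pXn2r _ 2)// ?nnegrE ?addr_ge0 ?L2norm_ge0//.
rewrite L2norm_sqr.
rewrite (_ : (fun x => _) = (fun x => f x + 1 * g x)); last by apply/funext => x; rewrite mul1r.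
rewrite ip_lin2// sqrrD !L2norm_sqr expr1n mul1r mulr1.
have := ler_norm (ip A f g); have := ip_normM Lf Lg; lra.
Qed.

Lemma L2normZ f t : L2 A f -> L2norm A (fun x => t * f x) = `|t| * L2norm A f.
Proof.
move=> Lf; apply/eqP; rewrite -(@eqrXn2 _ 2)// ?mulr_ge0 ?L2norm_ge0//.
rewrite exprMn !L2norm_sqr real_normK ?num_real// ipZl//; last exact: L2Z.
by rewrite ipC ipZl// mulrA expr2.
Qed.

Lemma ae_eq_ipl f g h : L2 A f -> L2 A g -> L2 A h ->
  {ae mu, forall x, A x -> f x = g x} -> ip A f h = ip A g h.
Proof.
move=> Lf Lg Lh fg; rewrite /ip /Rintegral; congr fine.
have := L2_integrable_mul Lf Lh; have := L2_integrable_mul Lg Lh.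
move=> /measurable_int m1 /measurable_int m2.
apply: ae_eq_integral => //.
by apply: filterS fg => x fgx Ax /=; rewrite fgx.
Qed.

Lemma L2_ae f g : measurable_fun A g -> L2 A f ->
  {ae mu, forall x, A x -> f x = g x} -> L2 A g.
Proof.
move=> mg Lf fg; apply/(L2P _ mA); split => //.
have /integrableP[_ +] := L2_integrable_sqr Lf.
have mf := L2_measurable Lf.
move=> H; apply/integrableP; split.
  by apply/measurable_EFinP; exact: measurable_funX.
apply: le_lt_trans H; rewrite le_eqVlt; apply/orP; left; apply/eqP.
apply: ae_eq_integral => //.
- by apply: measurableT_comp => //; apply/measurable_EFinP; exact: measurable_funX.
- by apply: measurableT_comp => //; apply/measurable_EFinP; exact: measurable_funX.
- by apply: filterS fg => x fgx Ax /=; rewrite fgx.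
Qed.

Lemma L2_bounded f M : (mu A < +oo)%E -> measurable_fun A f ->
  (forall x, A x -> `|f x| <= M) -> L2 A f.
Proof.
move=> Afin mf fM; apply/(L2P _ mA); split => //.
have iM : mu.-integrable A (EFin \o cst (M ^+ 2)).
  apply/integrableP; split; first by apply/measurable_EFinP; exact: measurable_cst.
  rewrite (eq_integral (cst (`|M ^+ 2|)%:E))// integral_cst//= lte_mul_pinfty//.
apply: le_integrable iM => //.
  by apply/measurable_EFinP; exact: measurable_funX.
move=> x Ax /=; rewrite lee_fin normrX (ger0_norm (sqr_ge0 M)).
have := fM _ Ax; have := normr_ge0 (f x); nra.
Qed.

End on_measurable.

Lemma Linfty_bounded A f : measurable A -> Linfty A f ->
  measurable_fun A f /\ exists M, {ae mu, forall x, A x -> `|f x| <= M}.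
Proof.
move=> mA; rewrite /Linfty inE => /andP[/[!inE]/= mf].
rewrite /finite_norm unlock => Hf.
split; first exact/(measurable_restrictT f mA).
have [mu0|mu0] := eqVneq (mu setT) 0%E.
  by exists 0; exists setT; split.
move: Hf; case: ifP => [_ Hf|/negP[]]; last by rewrite lt0e mu0/=.
exists (fine (ess_sup mu (abse \o (EFin \o f \_ A)))).
apply: filterS (ess_sup_ge mu (abse \o (EFin \o f \_ A))) => x /= Hx Ax.
move: Hx; rewrite patchE mem_set//; case: (ess_sup _ _) Hf => [r _|//|//].
by rewrite lee_fin.
Qed.

Lemma L2_mul_ae_bounded A (a : V -> R) f M : measurable A -> measurable_fun A a ->
  {ae mu, forall x, A x -> `|a x| <= M} -> L2 A f -> L2 A (fun x => a x * f x).
Proof.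
move=> mA ma aM Lf; have mf := L2_measurable mA Lf.
pose b x := Num.max (- `|M|) (Num.min (a x) `|M|).
have mb : measurable_fun A b.
  apply: measurable_maxr; first exact: measurable_cst.
  by apply: measurable_minr => //; exact: measurable_cst.
have bM x : `|b x| <= `|M|.
  rewrite ler_norml le_max lexx/= ge_max ge_min lexx orbT andbT.
  by rewrite (le_trans _ (normr_ge0 _))// oppr_le0.
apply: (L2_ae mA (f := fun x => b x * f x)).
- exact: measurable_funM.
- apply/(L2P _ mA); split; first exact: measurable_funM.
  have := integrableZl mA (M ^+ 2) (L2_integrable_sqr mA Lf).
  apply: le_integrable => //.
    by apply/measurable_EFinP/measurable_funX; exact: measurable_funM.
  move=> x Ax; rewrite /= lee_fin !exprMn normrM [in leRHS]normrM.
  apply: ler_wpM2r => //; rewrite -(real_normK (num_real M)) !normrX normr_id.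
  by rewrite lerXn2r ?nnegrE.
- apply: filterS aM => x Mx Ax; congr (_ * _).
  have := Mx Ax => /le_trans /(_ (ler_norm M)); rewrite ler_norml => /andP[h1 h2].
  by rewrite /b min_l// max_r.
Qed.

Lemma L2S A B f : measurable A -> measurable B -> A `<=` B -> L2 B f -> L2 A f.
Proof.
move=> mA mB AB /(L2P _ mB)[mf sf]; apply/(L2P _ mA); split.
  exact: measurable_funS mf.
exact: integrableS sf.
Qed.

Lemma geometric_increments_cvg (u : R^nat) (C : R) :
  (forall k, `|u k.+1 - u k| <= C * 2^-1 ^+ k) -> cvgn u.
Proof.
move=> H.
have Hs : cvgn (series (fun k => u k.+1 - u k)).
  apply: normed_cvg; apply: (series_le_cvg _ _ H) => [k|k|].
  - exact: normr_ge0.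
  - exact: (le_trans (normr_ge0 _) (H k)).
  - by apply: is_cvg_geometric_series; rewrite gtr0_norm ?invr_gt0// invf_lt1// ltr1n.
have -> : u = (fun k => u 0%N + series (fun k => u k.+1 - u k) k).
  apply/funext => k; rewrite /series/= telescope_sumr// addrC subrK//.
by apply: is_cvgD => //; exact: is_cvg_cst.
Qed.

Lemma limn_einf_le (u : (\bar R)^nat) (c : \bar R) (N : nat) :
  (forall k, (N <= k)%N -> (u k <= c)%E) -> (limn_einf u <= c)%E.
Proof.
move=> H; rewrite limn_einf_lim; apply: lime_le; first exact: is_cvg_einfs.
exists N => // k Nk; apply: le_trans (H k Nk).
by apply: ereal_inf_lbound; exists k => //=.
Qed.

(** Riesz-Fischer: a rapidly converging subsequence converges almost
    everywhere because the weighted series of its squared increments has a finite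
    integral; Fatou's lemma then identifies the limit in the mean. *)
Lemma L2_complete A (u : nat -> V -> R) : measurable A ->
  (forall k, L2 A (u k)) ->
  (forall e, 0 < e -> exists N, forall j k, (N <= j)%N -> (N <= k)%N ->
     ip A (fun x => u j x - u k x) (fun x => u j x - u k x) <= e) ->
  exists2 f, L2 A f & forall e, 0 < e -> exists N, forall k, (N <= k)%N ->
     ip A (fun x => u k x - f x) (fun x => u k x - f x) <= e.
Proof.
move=> mA Lu Cu.
have /boolp.choice[N0 HN0] : forall m : nat, exists N, forall j k,
  (N <= j)%N -> (N <= k)%N ->
     ip A (fun x => u j x - u k x) (fun x => u j x - u k x) <= 16^-1 ^+ m.
  by move=> m; apply: Cu; rewrite exprn_gt0// invr_gt0.
pose phi m := (m + \max_(i < m.+1) N0 i)%N.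
have phiN m : (N0 m <= phi m)%N.
  by apply: leq_trans (leq_addl _ _); apply: (leq_bigmax (ord_max : 'I_m.+1)).
have phim m : (m <= phi m)%N by exact: leq_addr.
have phiS m : (N0 m <= phi m.+1)%N.
  apply: leq_trans (leq_addl _ _).
  by rewrite big_ord_recr/= leq_max; apply/orP; left; apply: (leq_bigmax (ord_max : 'I_m.+1)).
pose v m := u (phi m).
pose d m x := v m.+1 x - v m x.
have Ld m : L2 A (d m) by exact: (L2B mA (Lu _) (Lu _)).
have dm m : ip A (d m) (d m) <= 16^-1 ^+ m by apply: HN0.
have int_ip g : L2 A g -> (\int[mu]_(x in A) (g x ^+ 2)%:E = (ip A g g)%:E)%E.
  move=> Lg; rewrite /ip /Rintegral fineK.
    by apply: eq_integral => x _; rewrite expr2.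
  by apply: integrable_fin_num => //; exact: (L2_integrable_mul mA Lg Lg).
(* the weights leave a convergent series of integrals and still force the m-th
   increment at x below 2^-m times the square root of the sum at x *)
pose s m x : \bar R := (4 ^+ m * d m x ^+ 2)%:E.
have s0 m x : (0 <= s m x)%E by rewrite lee_fin mulr_ge0 ?sqr_ge0 ?exprn_ge0.
have ms m : measurable_fun A (s m).
  apply/measurable_EFinP/measurable_funM => //; apply: measurable_funX.
  exact: (L2_measurable mA (Ld m)).
pose S x := (\sum_(m <oo) s m x)%E.
have mS : measurable_fun A S by apply: ge0_emeasurable_sum.
have iS : mu.-integrable A S.
  apply/integrableP; split => //.
  rewrite (eq_integral S); last by move=> x _; rewrite gee0_abs// nneseries_ge0.
  rewrite /S integral_nneseries//.
  apply: (@le_lt_trans _ _ (\sum_(m <oo) (4^-1 ^+ m)%:E)%E).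
    apply: lee_nneseries => [m _ _|m _]; first exact: integral_ge0.
    have -> : (\int[mu]_(x in A) s m x = (4 ^+ m * ip A (d m) (d m))%:E)%E.
      rewrite EFinM -int_ip// -ge0_integralZl//.
      - by apply/measurable_EFinP/measurable_funX; exact: (L2_measurable mA (Ld m)).
      - by move=> x _; rewrite lee_fin sqr_ge0.
    rewrite lee_fin (le_trans (ler_wpM2l _ (dm m)))// ?exprn_ge0//.
    by rewrite -exprMn; have -> : 4 / 16 = 4^-1 :> R by lra.
  apply: (@le_lt_trans _ _ (1 * (1 - 4^-1)^-1)%:E); last exact: ltry.
  apply: lime_le; first by apply: is_cvg_nneseries => m _ _; rewrite lee_fin exprn_ge0.
  apply: nearW => k; rewrite sumEFin lee_fin.
  have := @geometric_le_lim R k 1 4^-1 ler01.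
  rewrite /series/= (eq_bigr (fun i => 4^-1 ^+ i)); last by move=> i _; rewrite mul1r.
  by apply; rewrite ?invr_gt0// gtr0_norm ?invr_gt0// invf_lt1// ltr1n.
have aeS := integrable_ae mA iS.
pose E := A `&` [set x | S x \is a fin_num].
have mE : measurable E by apply: emeasurable_fin_num.
pose w m x := if x \in E then v m x else 0.
have wE m : w m = (v m) \_ E by apply/funext => x; rewrite patchE.
have cw x : cvgn (w ^~ x).
  have [xE|xE] := boolP (x \in E); last first.
    rewrite (_ : w ^~ x = cst 0); first exact: is_cvg_cst.
    by apply/funext => m; rewrite /w (negPf xE).
  have [Ax Sx] := set_mem xE.
  rewrite (_ : w ^~ x = v ^~ x); last by apply/funext => m; rewrite /w xE.
  apply: (@geometric_increments_cvg _ (Num.sqrt (fine (S x)))) => k.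
  have : (s k x <= S x)%E.
    apply: le_trans (nneseries_lim_ge k.+1 _) => [|m _ _]; last exact: s0.
    by rewrite big_nat_recr//= leeDr// sume_ge0.
  rewrite -(fineK Sx) lee_fin => sS.
  rewrite -(ler_pXn2r (n := 2))// ?nnegrE ?mulr_ge0 ?sqrtr_ge0 ?exprn_ge0 ?invr_ge0//.
  rewrite real_normK ?num_real// exprMn sqr_sqrtr; last first.
    by apply: le_trans sS; rewrite mulr_ge0 ?sqr_ge0 ?exprn_ge0.
  rewrite exprVn exprVn -exprM mulnC exprM ler_pdivlMr ?exprn_gt0//.
  by rewrite mulrC (_ : 2 ^+ 2 = 4 :> R)//; ring.
pose f x := limn (w ^~ x).
have mw m : measurable_fun A (w m).
  apply: measurable_funTS; rewrite wE; apply/(measurable_restrictT _ mE).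
  apply: measurable_funS (L2_measurable mA (Lu (phi m))) => //.
  by apply: subIset; left.
have mf : measurable_fun A f.
  by apply: (measurable_fun_cvg mw) => x _; exact: cw.
have vw m : {ae mu, forall x, A x -> v m x = w m x}.
  apply: filterS aeS => x Sx Ax; rewrite /w ifT//.
  by apply/mem_set; split => //; exact: Sx.
have Lw m : L2 A (w m) by apply: L2_ae (Lu _) (vw m).
have bound e k : (exists N, forall j, (N <= j)%N ->
    ip A (fun x => u k x - v j x) (fun x => u k x - v j x) <= e) ->
    (\int[mu]_(x in A) ((u k x - f x) ^+ 2)%:E <= e%:E)%E.
  move=> [N HN].
  have -> : (\int[mu]_(x in A) ((u k x - f x) ^+ 2)%:E =
     \int[mu]_(x in A) limn_einf (fun m => ((u k x - w m x) ^+ 2)%:E))%E.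
    apply: eq_integral => x _.
    suff H : ((u k x - w m x) ^+ 2)%:E @[m --> \oo] --> ((u k x - f x) ^+ 2)%:E.
      by have [-> _] := cvg_limn_einf_sup H.
    apply: cvg_EFin; first exact: nearW.
    under eq_fun do rewrite expr2.
    rewrite expr2; apply: cvgM; (apply: cvgB; first exact: cvg_cst); exact: cw.
  apply: (le_trans (fatou _ _ _ _)) => //.
  - move=> m; apply/measurable_EFinP/measurable_funX/measurable_funB => //.
    exact: (L2_measurable mA (Lu k)).
  - by move=> m x _; rewrite lee_fin sqr_ge0.
  apply: (limn_einf_le (N := N)) => j Nj.
  rewrite int_ip; last exact: L2B.
  rewrite lee_fin; apply: le_trans (HN j Nj).
  rewrite le_eqVlt; apply/orP; left; apply/eqP.
  have Luw : L2 A (fun x => u k x - w j x) by exact: L2B.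
  have Luv : L2 A (fun x => u k x - v j x) by exact: (L2B mA (Lu k) (Lu (phi j))).
  have ae1 : {ae mu, forall x, A x -> u k x - w j x = u k x - v j x}.
    by apply: filterS (vw j) => x H Ax; rewrite H.
  by rewrite (ae_eq_ipl mA Luw Luv Luw ae1) ipC (ae_eq_ipl mA Luw Luv Luv ae1).
have bound2 e : 0 < e -> exists N, forall k, (N <= k)%N ->
    (\int[mu]_(x in A) ((u k x - f x) ^+ 2)%:E <= e%:E)%E.
  move=> e0; have [N HN] := Cu e e0; exists N => k Nk; apply: bound.
  exists N => j Nj; apply: HN => //; exact: leq_trans (phim j).
have Lf : L2 A f.
  have [N HN] := bound2 1 ltr01.
  have : L2 A (fun x => u N x - f x).
    have mB : measurable_fun A (fun x => u N x - f x).
      by apply: measurable_funB => //; exact: (L2_measurable mA (Lu N)).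
    apply/(L2P _ mA); split => //; apply/integrableP; split.
      by apply/measurable_EFinP/measurable_funX.
    apply: le_lt_trans (ltry 1); apply: le_trans (HN N (leqnn _)).
    by rewrite le_eqVlt; apply/orP; left; apply/eqP/eq_integral => x _ /=; rewrite ger0_norm// sqr_ge0.
  move=> /(L2B mA (Lu N)).
  by rewrite (_ : (fun x => _ - (_ - _)) = f)//; apply/funext => x; ring.
exists f => // e e0; have [N HN] := bound2 e e0; exists N => k Nk.
by have := HN k Nk; rewrite int_ip ?lee_fin//; exact: L2B.
Qed.

End square_integrable.

(** * Difference quotients of Lipschitz functions *)

Section difference_quotients.
Context {R : realType} {n : nat}.
Local Notation V := 'rV[R]_n.
Local Notation mu := (lebesgueRn R n).
Local Notation e_ i := (delta_mx (ord0 : 'I_1) i : V).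
Implicit Types (f g : V -> R) (i : 'I_n).

Lemma Rintegral_shift f (v : V) : mu.-integrable setT (EFin \o f) ->
  mu.-integrable setT (EFin \o (fun x => f (x + v))) /\
  \int[mu]_x f (x + v) = \int[mu]_x f x.
Proof.
move=> intf; have /integrableP[mf finf] := intf.
have ms : measurable_fun setT (fun x : V => x + v) := measurable_shift v.
pose phi : {mfun V >-> V} := HB.pack (fun x : V => x + v)
  (isMeasurableFun.Build _ _ _ _ _ ms).
have push (h : V -> \bar R) :
    (\int[pushforward mu phi]_x h x = \int[mu]_x h x)%E.
  apply: eq_measure_integral => /= A mA _.
  exact: lebesgueRn_shift.
have ints : mu.-integrable setT (EFin \o (fun x => f (x + v))).
  apply/integrableP; split; first exact: (measurableT_comp mf ms).
  move: finf; rewrite -(push (fun x => `|(EFin \o f) x|%E)).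
  rewrite ge0_integral_pushforward//.
  exact: measurableT_comp.
split=> //; rewrite /Rintegral; congr fine.
rewrite -(push (EFin \o f)) integral_pushforward//.
Qed.

(** The increments 1/(j+1) make the limit a sequential one, as dominated
    convergence requires. *)
Definition diff_quot f i (j : nat) (x : V) : R :=
  j.+1%:R * (f (x + j.+1%:R^-1 *: e_ i) - f x).

Lemma derivable_diff_quot f i x : derivable f x (e_ i) ->
  diff_quot f i ^~ x @ \oo --> pd i f x.
Proof.
move=> /cvg_ex[l fl].
have -> : pd i f x = l by apply: cvg_lim fl.
have u0 : (fun j : nat => j.+1%:R^-1 : R) @ \oo --> 0 by exact: cvg_harmonic.
have := (cvgr_dnbhsP _ _ _).1 fl (fun j => j.+1%:R^-1) _.
move=> H; rewrite (_ : diff_quot f i ^~ x = (fun j => (j.+1%:R^-1)^-1 *: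
    ((f \o shift x) (j.+1%:R^-1 *: e_ i) - f x))).
  by apply: H; split => // j; rewrite invr_neq0// pnatr_eq0.
apply/funext => j; rewrite /diff_quot /= invrK.
by congr (_ * (f _ - _)); exact: addrC.
Qed.

Lemma diff_quotM f g i j x : diff_quot (fun y => f y * g y) i j x =
  diff_quot f i j x * g x + f x * diff_quot g i j x +
  j.+1%:R^-1 * (diff_quot f i j x * diff_quot g i j x).
Proof.
rewrite /diff_quot; set y := x + _; have j0 : j.+1%:R != 0 :> R by rewrite pnatr_eq0.
by field.
Qed.

Lemma cvg_diff_quotM f g i x (Df Dg : R) :
  diff_quot f i ^~ x @ \oo --> Df -> diff_quot g i ^~ x @ \oo --> Dg ->
  diff_quot (fun y => f y * g y) i ^~ x @ \oo --> Df * g x + f x * Dg.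
Proof.
move=> cf cg; rewrite (_ : diff_quot _ _ ^~ x = (fun j => diff_quot f i j x * g x +
    f x * diff_quot g i j x +
    j.+1%:R^-1 * (diff_quot f i j x * diff_quot g i j x))); last first.
  by apply/funext => j; exact: diff_quotM.
rewrite -(addr0 (Df * g x + _)); apply: cvgD.
  by apply: cvgD; apply: cvgM => //; exact: cvg_cst.
rewrite -(mul0r (Df * Dg)); apply: cvgM; last exact: cvgM.
exact: cvg_harmonic.
Qed.

Definition lip_dir i (L : R) f :=
  forall x t, `|f (x + t *: e_ i) - f x| <= L * `|t|.

Lemma bounded_support_integrable f k (B : R) : measurable_fun setT f ->
  (forall x, `|f x| <= B) -> (forall x, ~ cube k x -> f x = 0) ->
  mu.-integrable setT (EFin \o f).
Proof.
move=> mf fB f0; have mC : measurable (cube k : set V) by exact: measurable_obox.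
have : mu.-integrable (cube k) (EFin \o f).
  apply: (@le_integrable _ _ _ mu _ mC _ (EFin \o cst B)).
  - by apply/measurable_EFinP; exact: measurable_funS mf.
  - by move=> x _ /=; rewrite lee_fin (le_trans (fB x))// ler_norm.
  - apply/integrableP; split; first by apply/measurable_EFinP; exact: measurable_cst.
    rewrite (eq_integral (cst (`|B|)%:E))// integral_cst//= lte_mul_pinfty//.
    exact: lebesgueRn_obox_lty.
move=> /(integrable_mkcond _ mC); apply: eq_integrable => // x _.
rewrite patchE; case: ifPn => // /negP xC; rewrite /= f0// => xC'; apply: xC.
exact: mem_set.
Qed.

(** Difference quotients of an integrable function integrate to zero by
    translation invariance, and they are dominated by the Lipschitz constant on a
    bounded set. *)
Lemma Rintegral_directional_derivative f (Df : V -> R) i k (B L : R) :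
  measurable_fun setT f -> (forall x, `|f x| <= B) ->
  (forall x, ~ cube k x -> f x = 0) ->
  (forall x t, `|t| <= 1 -> `|f (x + t *: e_ i) - f x| <= L * `|t|) ->
  measurable_fun setT Df ->
  {ae mu, forall x, diff_quot f i ^~ x @ \oo --> Df x} ->
  mu.-integrable setT (EFin \o Df) /\ \int[mu]_x Df x = 0.
Proof.
move=> mf fB f0 fL mDf cDf.
have intf := bounded_support_integrable mf fB f0.
have L0 : 0 <= L.
  by have := fL 0 1; rewrite normr1 mulr1 => /(_ (lexx _)); exact: le_trans.
have ints j := (Rintegral_shift (j.+1%:R^-1 *: e_ i) intf).
have intq j : mu.-integrable setT (EFin \o diff_quot f i j).
  have := integrableZl measurableT j.+1%:R (integrableB measurableT (ints j).1 intf).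
  by apply: eq_integrable.
have q0 j : \int[mu]_x diff_quot f i j x = 0.
  rewrite RintegralZl//; last first.
    by have := integrableB measurableT (ints j).1 intf; exact: eq_integrable.
  by rewrite RintegralB//; [rewrite (ints j).2 subrr mulr0|exact: (ints j).1].
have mC : measurable (cube k.+1 : set V) by exact: measurable_obox.
pose g x : R := if x \in (cube k.+1 : set V) then L else 0.
have gE : g = (cst L) \_ (cube k.+1) by apply/funext => x; rewrite patchE.
have intg : mu.-integrable setT (EFin \o g).
  apply: (@bounded_support_integrable _ k.+1 L).
  - by rewrite gE; apply/(measurable_restrictT _ mC); exact: measurable_cst.
  - by move=> x; rewrite /g; case: ifP; rewrite ?normr0// ger0_norm.
  - by move=> x xC; rewrite /g ifF//; apply/negP => /set_mem.
(* a step of length at most 1 from outside the larger cube stays off the support *)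
have qg j x : `|diff_quot f i j x| <= g x.
  rewrite /g; case: ifPn => [_|xC].
    rewrite /diff_quot normrM; apply: (le_trans (ler_wpM2l _ (fL _ _ _))) => //.
      by rewrite ger0_norm// invf_le1// ler1n.
    by rewrite mulrCA -normrM mulfV ?normr1 ?mulr1// pnatr_eq0.
  have xC' : ~ cube k.+1 x by move=> h; move/negP: xC; apply; exact: mem_set.
  rewrite /diff_quot !f0 ?subrr ?mulr0 ?normr0//.
    move=> h; apply: xC' => l; have := h l; rewrite !mxE.
    move=> /andP[? ?]; have : (k%:R : R) <= k.+1%:R by rewrite ler_nat.
    by move=> ?; apply/andP; split; lra.
  move=> h; apply: xC' => l; have := h l; rewrite !mxE eqxx/=.
  have : j.+1%:R^-1 <= 1 :> R by rewrite invf_le1// ler1n.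
  have : 0 < j.+1%:R^-1 :> R by [].
  rewrite -(natr1 k); set t := _^-1 => ? ?.
  by case: (l == i); rewrite ?mulr1 ?mulr0 => /andP[? ?]; apply/andP; split; lra.
have [|||||i1 _ i2] := @dominated_convergence _ _ _ mu setT measurableT
  (fun j => EFin \o diff_quot f i j) (EFin \o Df) (EFin \o g).
- by move=> j; have /integrableP[] := intq j.
- exact/measurable_EFinP.
- apply: filterS cDf => x cx _; apply: cvg_EFin; first exact: nearW.
  exact: cx.
- exact: intg.
- by apply: aeW => x j _; rewrite /= lee_fin qg.
split=> //; rewrite /Rintegral.
suff -> : (\int[mu]_x (Df x)%:E = 0)%E by [].
apply: (cvg_unique _ i2) => //.
rewrite (_ : (fun j => _) = cst 0%E); first exact: cvg_cst.
apply/funext => j /=; rewrite -[LHS]fineK; last exact: (integrable_fin_num measurableT (intq j)).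
by rewrite -[fine _]/(\int[mu]_x diff_quot f i j x) q0.
Qed.

Lemma cube_coord k (x : V) i : cube k x -> `|x ord0 i| <= k%:R.
Proof. by move=> /(_ i); rewrite !mxE => /andP[h1 h2]; rewrite ler_norml !ltW. Qed.

Lemma cube_le k l (x : V) : (k <= l)%N -> cube k x -> cube l x.
Proof.
move=> kl xk i; have := xk i; rewrite !mxE => /andP[? ?].
have : (k%:R : R) <= l%:R by rewrite ler_nat.
by move=> ?; apply/andP; split; lra.
Qed.

(** Integrating the derivative of x_i f(x)^2 to zero gives
    int f^2 = - 2 int x_i f D_i f, and |x_i| <= k on the support. *)
Lemma directional_poincare f Df i k (B L : R) :
  measurable_fun setT f -> (forall x, `|f x| <= B) ->
  (forall x, ~ cube k x -> f x = 0) -> lip_dir i L f ->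
  L2 setT Df ->
  {ae mu, forall x, diff_quot f i ^~ x @ \oo --> Df x} ->
  L2norm setT f <= 2 * k%:R * L2norm setT Df.
Proof.
move=> mf fB f0 fL L2Df cDf.
have mT : measurable (setT : set V) by [].
have mDf := L2_measurable mT L2Df.
have B0 : 0 <= B by exact: le_trans (fB 0).
have L0 : 0 <= L.
  by have := fL 0 1; rewrite normr1 mulr1; exact: le_trans.
have L2f : L2 setT f.
  apply/(L2P _ mT); split => //.
  apply: (@bounded_support_integrable _ k (B ^+ 2)).
  - exact: measurable_funX.
  - by move=> x; rewrite normrX lerXn2r ?nnegrE.
  - by move=> x /f0 ->; rewrite expr0n.
pose c (x : V) := x ord0 i.
pose xf x := c x * f x.
have mc : measurable_fun setT c by exact: measurable_coord.
have mxf : measurable_fun setT xf by exact: measurable_funM.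
have xfB x : `|xf x| <= k%:R * B.
  have [xk|xk] := pselect (cube k x).
    by rewrite normrM ler_pM// cube_coord.
  by rewrite /xf f0// mulr0 normr0 mulr_ge0.
have L2xf : L2 setT xf.
  apply/(L2P _ mT); split => //.
  apply: (@bounded_support_integrable _ k ((k%:R * B) ^+ 2)).
  - exact: measurable_funX.
  - by move=> x; rewrite normrX lerXn2r ?nnegrE ?mulr_ge0.
  - by move=> x /f0 fx; rewrite /xf fx mulr0 expr0n.
(* steps of length at most 1 keep the coordinate factor bounded near the support *)
have xfL x t : `|t| <= 1 -> `|xf (x + t *: e_ i) - xf x| <= ((k%:R + 1) * L + B) * `|t|.
  move=> t1; rewrite /xf /c !mxE !eqxx/= mulr1.
  set y := x + t *: e_ i; set s := x ord0 i.
  have [xk|xk] := pselect (cube k.+1 x); last first.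
    rewrite (f0 x); last by move=> h; apply: xk; exact: cube_le h.
    rewrite (f0 y) ?mulr0 ?subrr ?normr0 ?mulr_ge0 ?addr_ge0 ?mulr_ge0//.
    move=> h; apply: xk => l; have := h l; rewrite !mxE eqxx/= -(natr1 k).
    move: t1; rewrite ler_norml => /andP[? ?].
    by case: (l == i); rewrite ?mulr1 ?mulr0 => /andP[? ?]; apply/andP; split; lra.
  have := cube_coord i xk; rewrite -/s -natr1 => sk.
  rewrite (_ : _ - _ = s * (f y - f x) + t * f y); last by ring.
  rewrite (le_trans (ler_normD _ _))// !normrM mulrDl lerD//.
    by rewrite -mulrA ler_pM//; exact: fL.
  by rewrite mulrC ler_wpM2r.
pose h x := xf x * f x.
have hB x : `|h x| <= k%:R * B * B by rewrite normrM ler_pM.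
have hL x t : `|t| <= 1 -> `|h (x + t *: e_ i) - h x| <=
    (((k%:R + 1) * L + B) * B + k%:R * B * L) * `|t|.
  move=> t1; rewrite /h; set y := x + _.
  rewrite (_ : _ - _ = (xf y - xf x) * f y + xf x * (f y - f x)); last by ring.
  rewrite (le_trans (ler_normD _ _))// [leRHS]mulrDl lerD//.
    by rewrite normrM mulrAC ler_pM//; exact: xfL.
  by rewrite normrM -(mulrA (k%:R * B)) ler_pM//; exact: fL.
have := @Rintegral_directional_derivative h (fun x => f x * f x + 2 * (xf x * Df x)) i k _ _.
move=> /(_ _ _ _ hB _ hL) [].
- exact: measurable_funM.
- by move=> x /f0 fx; rewrite /h fx mulr0.
- apply: measurable_funD; first exact: measurable_funM.
  by apply: measurable_funM => //; exact: measurable_funM.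
- apply: filterS cDf => x cx.
  rewrite (_ : _ + _ = (1 * f x + c x * Df x) * f x + xf x * Df x); last by rewrite /xf; ring.
  apply: cvg_diff_quotM => //; apply: cvg_diff_quotM => //.
  rewrite (_ : diff_quot _ _ ^~ _ = cst 1); first exact: cvg_cst.
  apply/funext => j; rewrite /diff_quot /c !mxE !eqxx/= mulr1 addrAC subrr add0r mulfV// pnatr_eq0.
move=> _; rewrite RintegralD//; last 2 first.
- exact: (L2_integrable_mul mT L2f L2f).
- have := integrableZl mT 2 (L2_integrable_mul mT L2xf L2Df).
  exact: eq_integrable.
rewrite RintegralZl//; last exact: (L2_integrable_mul mT L2xf L2Df).
rewrite -[\int[mu]_x (f x * f x)]/(ip setT f f) -[\int[mu]_x (xf x * Df x)]/(ip setT xf Df).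
move=> H.
have xf_f : L2norm setT xf <= k%:R * L2norm setT f.
  rewrite -(ler_pXn2r (n := 2))// ?nnegrE ?mulr_ge0 ?L2norm_ge0//.
  rewrite exprMn !L2norm_sqr /ip -RintegralZl//; last exact: (L2_integrable_mul mT L2f L2f).
  apply: le_Rintegral => //.
  - exact: (L2_integrable_mul mT L2xf L2xf).
  - have := integrableZl mT (k%:R ^+ 2) (L2_integrable_mul mT L2f L2f).
    exact: eq_integrable.
  - move=> x _; rewrite /xf; have [xk|xk] := pselect (cube k x); last by rewrite f0// !mulr0.
    rewrite mulrACA -!expr2 ler_wpM2r ?sqr_ge0// -[_ ^+ 2]ger0_norm ?sqr_ge0// normrX.
    by rewrite lerXn2r ?nnegrE ?cube_coord.
have := ip_normM mT L2xf L2Df; rewrite ler_norml => /andP[H1 _].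
have a0 := L2norm_ge0 setT f; have b0 := L2norm_ge0 setT Df.
have H2 := ler_wpM2r b0 xf_f.
move: H; rewrite -L2norm_sqr; move: (L2norm setT f) (L2norm setT Df) (L2norm setT xf) (ip _ _ _) a0 b0 H1 H2.
move=> F D X I F0 D0 H1 H2 H.
have [->|Fn] := eqVneq F 0; first by rewrite !mulr_ge0.
have Fp : 0 < F by rewrite lt_neqAle eq_sym Fn.
rewrite -(ler_pM2r Fp); nra.
Qed.

End difference_quotients.

(** * Test functions and integration by parts *)

Section test_functions.
Context {R : realType} {n : nat}.
Local Notation V := 'rV[R]_n.
Local Notation mu := (lebesgueRn R n).
Local Notation e_ i := (delta_mx (ord0 : 'I_1) i : V).
Implicit Types (f g phi psi : V -> R) (i : 'I_n) (Om : set V).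

Lemma test_function_pd Om phi i :
  test_function Om phi -> test_function Om (pd i phi).
Proof.
move=> [dphi [K cK [KOm K0]]]; split.
  move=> s x; have := dphi (rcons s i) x.
  by rewrite -cats1 foldr_cat.
exists K => //; split=> // x Kx.
have oKC : open (~` K) by apply: closed_openC; apply: compact_closed => //; exact: norm_hausdorff.
rewrite /pd (@near_eq_derive _ _ _ phi (cst 0)) ?derive_cst//.
by have := open_nbhs_nbhs (conj oKC Kx); apply: filterS => y /K0.
Qed.

Lemma test_function_differentiable Om phi x :
  test_function Om phi -> differentiable phi x.
Proof. by move=> [/(_ [::])]. Qed.

Lemma test_function_continuous Om phi : test_function Om phi -> continuous phi.
Proof.
by move=> tphi x; apply: differentiable_continuous; exact: test_function_differentiable tphi.
Qed.

Lemma test_function_measurable Om phi : test_function Om phi ->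
  measurable_fun setT phi.
Proof. by move=> /test_function_continuous/continuous_measurable_row. Qed.

Lemma test_function_out Om phi x : test_function Om phi -> ~ Om x -> phi x = 0.
Proof. by move=> [_ [K _ [KOm K0]]] Ox; apply: K0 => /KOm. Qed.

Lemma test_function_support Om phi : test_function Om phi ->
  exists k, forall x, ~ cube k x -> phi x = 0.
Proof.
move=> [_ [K cK [_ K0]]]; have [k Kk] := bounded_row (compact_bounded cK).
by exists k => x xk; apply: K0 => /Kk.
Qed.

Lemma test_function_bounded Om phi : test_function Om phi ->
  exists B, forall x, `|phi x| <= B.
Proof.
move=> tphi; have [_ [K cK [_ K0]]] := tphi.
have /compact_bounded[M [_ HM]] : compact (phi @` K).
  apply: continuous_compact => //; apply: continuous_subspaceT.
  exact: test_function_continuous tphi.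
exists (`|M| + 1) => x; have [Kx|/K0 ->] := pselect (K x).
  apply: (HM (`|M| + 1)); last by exists x.
  by rewrite (le_lt_trans (ler_norm _))// ltrDl.
by rewrite normr0 addr_ge0.
Qed.

(** The mean value theorem along a coordinate line. *)
Lemma test_function_lip Om phi i : test_function Om phi ->
  exists B, lip_dir i B phi.
Proof.
move=> tphi; have [B HB] := test_function_bounded (test_function_pd i tphi).
exists B.
have pos x t : 0 <= t -> `|phi (x + t *: e_ i) - phi x| <= B * t.
  move=> t0.
  have dg s : is_derive s (1 : R) (fun s => phi (x + s *: e_ i)) (pd i phi (x + s *: e_ i)).
    have /(@diff_derivable _ _ _ _ _ (e_ i)) := test_function_differentiable (x + s *: e_ i) tphi.
    have E : (fun h : R => h^-1 *: (((fun s => phi (x + s *: e_ i)) \o shift s) (h *: 1) - phi (x + s *: e_ i)))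
       = (fun h : R => h^-1 *: ((phi \o shift (x + s *: e_ i)) (h *: e_ i) - phi (x + s *: e_ i))).
      apply/funext => h /=; congr (_ *: (phi _ - _)).
      by rewrite /GRing.scale/= mulr1 -[in RHS]addrCA -scalerDl.
    move=> dphi; apply: DeriveDef; first by rewrite /derivable E.
    by rewrite /pd /derive E.
  have [|c _] := MVT_segment t0 (fun s _ => dg s).
    apply: continuous_subspaceT => s.
    by apply: differentiable_continuous; apply/derivable1_diffP; have [] := dg s.
  rewrite scale0r addr0 => ->.
  by rewrite subr0 normrM (ger0_norm t0) ler_wpM2r// HB.
move=> x t; have [t0|t0] := leP 0 t; first by rewrite (ger0_norm t0); exact: pos.
have := pos (x + t *: e_ i) (- t); rewrite scaleNr addrK oppr_ge0 => /(_ (ltW t0)).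
by rewrite distrC (ltr0_norm t0).
Qed.

Lemma differentiable_diff_quot f i x : differentiable f x ->
  diff_quot f i ^~ x @ \oo --> pd i f x.
Proof. by move=> df; apply: derivable_diff_quot; exact: diff_derivable. Qed.

Lemma test_function_diff_quot Om phi i x : test_function Om phi ->
  diff_quot phi i ^~ x @ \oo --> pd i phi x.
Proof.
move=> tphi; apply: differentiable_diff_quot.
exact: test_function_differentiable tphi.
Qed.

Lemma pd_lin f g t i x : differentiable f x -> differentiable g x ->
  pd i (fun y => f y + t * g y) x = pd i f x + t * pd i g x.
Proof.
move=> df dg.
have dh : differentiable (fun y => f y + t * g y) x.
  rewrite -[fun y => _]/(f + (t \*: g)).
  by apply: differentiableD => //; exact: differentiableZ.
have ch := differentiable_diff_quot (i := i) dh.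
apply: (cvg_unique _ ch) => //.
rewrite (_ : diff_quot _ _ ^~ _ =
    (fun j => diff_quot f i j x + t * diff_quot g i j x)); last first.
  by apply/funext => j; rewrite /diff_quot; ring.
apply: cvgD; last apply: cvgM; [|exact: cvg_cst|].
- exact: differentiable_diff_quot df.
- exact: differentiable_diff_quot dg.
Qed.

Lemma pdM f g i x : differentiable f x -> differentiable g x ->
  pd i (fun y => f y * g y) x = pd i f x * g x + f x * pd i g x.
Proof.
move=> df dg.
have dh : differentiable (fun y => f y * g y) x by exact: (differentiableM df dg).
have ch := differentiable_diff_quot (i := i) dh.
apply: (cvg_unique _ ch) => //; apply: cvg_diff_quotM.
- exact: differentiable_diff_quot df.
- exact: differentiable_diff_quot dg.
Qed.

Lemma test_function_lin Om phi psi t : test_function Om phi ->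
  test_function Om psi -> test_function Om (fun x => phi x + t * psi x).
Proof.
move=> [d1 [K1 cK1 [KO1 K01]]] [d2 [K2 cK2 [KO2 K02]]]; split; last first.
  exists (K1 `|` K2); first exact: compactU.
  split; first by rewrite subUset.
  move=> x Kx; have -> : phi x = 0 by apply: K01 => h; apply: Kx; left.
  have -> : psi x = 0 by apply: K02 => h; apply: Kx; right.
  by rewrite mulr0 addr0.
have E s : foldr pd (fun x => phi x + t * psi x) s =
    (fun x => foldr pd phi s x + t * foldr pd psi s x).
  elim: s => //= i s ->; apply/funext => x; exact: pd_lin.
move=> s x; rewrite E -[fun y => _]/(foldr pd phi s + (t \*: foldr pd psi s)).
by apply: differentiableD => //; exact: differentiableZ.
Qed.

Lemma test_function_integrable Om phi f (B : R) : test_function Om phi ->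
  measurable_fun setT f -> (forall x, `|f x| <= B) ->
  mu.-integrable setT (EFin \o (fun x => f x * phi x)).
Proof.
move=> tphi mf fB.
have [k k0] := test_function_support tphi.
have [C phiC] := test_function_bounded tphi.
apply: (@bounded_support_integrable _ _ _ k (B * C)).
- by apply: measurable_funM => //; exact: test_function_measurable tphi.
- by move=> x; rewrite normrM ler_pM.
- by move=> x /k0 ->; rewrite mulr0.
Qed.

Lemma test_function_L2 Om phi A : measurable A -> test_function Om phi -> L2 A phi.
Proof.
move=> mA tphi; apply: (@L2S _ _ A setT) => //.
have [k k0] := test_function_support tphi.
have [C phiC] := test_function_bounded tphi.
have mphi := test_function_measurable tphi.
apply/(L2P _ (@measurableT _ V)); split=> //.
apply: (@bounded_support_integrable _ _ _ k (C ^+ 2)).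
- exact: measurable_funX.
- by move=> x; rewrite normrX lerXn2r ?nnegrE// (le_trans _ (phiC 0)).
- by move=> x /k0 ->; rewrite expr0n.
Qed.

(** The product with the test function has bounded support, so its derivative
    integrates to zero. *)
Lemma lipschitz_integration_by_parts Om i f (Df : V -> R) phi (B L : R) :
  measurable_fun setT f -> (forall x, `|f x| <= B) -> lip_dir i L f ->
  measurable_fun setT Df ->
  {ae mu, forall x, diff_quot f i ^~ x @ \oo --> Df x} ->
  test_function Om phi ->
  \int[mu]_x (f x * pd i phi x) = - \int[mu]_x (Df x * phi x).
Proof.
move=> mf fB fL mDf cDf tphi.
have [k k0] := test_function_support tphi.
have [C phiC] := test_function_bounded tphi.
have [P phiP] := test_function_lip i tphi.
have mphi := test_function_measurable tphi.
have mpd := test_function_measurable (test_function_pd i tphi).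
have B0 : 0 <= B by exact: le_trans (fB 0).
have C0 : 0 <= C by exact: le_trans (phiC 0).
have i1 := test_function_integrable (test_function_pd i tphi) mf fB.
have := @Rintegral_directional_derivative _ _ (fun x => f x * phi x)
   (fun x => Df x * phi x + f x * pd i phi x) i k (B * C) (L * C + B * P).
case.
- exact: measurable_funM.
- by move=> x; rewrite normrM ler_pM.
- by move=> x /k0 ->; rewrite mulr0.
- move=> x t _; set y := x + _.
  rewrite (_ : _ - _ = (f y - f x) * phi y + f x * (phi y - phi x)); last by ring.
  rewrite (le_trans (ler_normD _ _))// [leRHS]mulrDl !normrM lerD//.
    by rewrite mulrAC ler_pM//; exact: fL.
  by rewrite -mulrA ler_pM//; exact: phiP.
- by apply: measurable_funD; exact: measurable_funM.
- apply: filterS cDf => x cx; apply: cvg_diff_quotM => //.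
  exact: test_function_diff_quot tphi.
move=> iD; have i2 : mu.-integrable setT (EFin \o (fun x => Df x * phi x)).
  have := integrableB measurableT iD i1; apply: eq_integrable => // x _ /=.
  by rewrite -EFinD; congr EFin; ring.
rewrite RintegralD//.
by move=> /eqP; rewrite addrC addr_eq0 => /eqP.
Qed.

End test_functions.

(** * Smooth bumps and the fundamental lemma *)

Section flat_functions.
Context {R : realType}.

(** The family is closed under differentiation up to linear combinations. *)
Definition flat (k : nat) (t : R) : R :=
  if 0 < t then t^-1 ^+ k * expR (- t^-1) else 0.

Lemma flat_le0 k t : t <= 0 -> flat k t = 0.
Proof. by rewrite /flat leNgt => /negPf ->. Qed.

Lemma flat_ge0 k t : 0 <= flat k t.
Proof.
rewrite /flat; case: ifP => // t0.
by rewrite mulr_ge0 ?expR_ge0// exprn_ge0// invr_ge0 ltW.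
Qed.

(** The exponential series dominates each of its terms; the bound gives
    continuity and, one order higher, differentiability at 0. *)
Lemma flat_bound k t : flat k t <= k.+1`!%:R * `|t|.
Proof.
rewrite /flat; case: ifP => [t0|_]; last by rewrite mulr_ge0.
rewrite (gtr0_norm t0) expRN.
have s0 : 0 < t^-1 by rewrite invr_gt0.
have := expR_ge1Dxn k (ltW s0); set s := t^-1 in s0 *; move=> H.
have f0 : 0 < k.+1`!%:R :> R by rewrite ltr0n fact_gt0.
have {}H : s ^+ k.+1 / k.+1`!%:R <= expR s by apply: le_trans H; rewrite lerDr.
rewrite -[t]invrK -/s ler_pdivrMr ?expR_gt0//.
apply: le_trans (_ : k.+1`!%:R / s * (s ^+ k.+1 / k.+1`!%:R) <= _); last first.
  by apply: ler_wpM2l => //; rewrite divr_ge0// ltW.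
rewrite exprS le_eqVlt; apply/orP; left; apply/eqP; field.
by rewrite !gt_eqF.
Qed.

Lemma is_derive_flat k (t : R) :
  is_derive t (1 : R) (flat k) (flat k.+2 t - k%:R * flat k.+1 t).
Proof.
have [t0|t0|->] := ltgtP t 0.
- rewrite !flat_le0 ?ltW// mulr0 subr0.
  apply: (near_eq_is_derive _ (is_derive_cst (0 : R) t 1)).
  near=> s; rewrite flat_le0//; apply/ltW; near: s; exact: lt_nbhsl.
- apply: (@near_eq_is_derive _ _ _ ((fun r => r ^+ k * expR (- r)) \o GRing.inv)).
    near=> s; rewrite /flat ifT//; near: s; exact: lt_nbhsr.
  rewrite /flat t0; set r := t^-1.
  have d1 : is_derive r 1 (fun s : R => s ^+ k) (k%:R * r ^+ k.-1).
    have := @is_deriveX R _ id k r 1 1 (is_derive_id _ _).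
    rewrite (_ : id ^+ k = (fun s : R => s ^+ k)); last by apply/funext => s; rewrite exprfctE.
    by rewrite /GRing.scale/= mulr1.
  have d2 : is_derive r 1 (fun s : R => expR (- s)) (- expR (- r)).
    have := is_derive1_comp (is_derive_expR (- r)) (is_deriveNid r (1 : R)).
    by rewrite mulrN1.
  have d3 : is_derive t 1 (GRing.inv : R -> R) (- r ^+ 2).
    have := @is_deriveV R id t 1 1 (lt0r_neq0 t0) (is_derive_id _ _).
    by rewrite /GRing.scale/= mulr1 /r exprVn.
  have d4 := is_derive1_comp (is_deriveM d1 d2) d3.
  apply: (is_derive_eq d4); rewrite /GRing.scale/=.
  case: k {d1 d4} => [|k]; rewrite ?mul0r ?expr0 /=; first by ring.
  by rewrite !exprS; ring.
- rewrite !flat_le0// mulr0 subr0.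
  suff H : (fun h : R => h^-1 *: ((flat k \o shift 0) (h *: 1) - flat k 0)) @ 0^' --> (0 : R).
    by apply: DeriveDef; [apply/cvg_ex; exists 0|exact: cvg_lim H].
  rewrite (_ : (fun _ => _) = flat k.+1); last first.
    apply/funext => h /=; rewrite (@flat_le0 k 0)// subr0 addr0 /GRing.scale/= mulr1.
    rewrite /flat; case: ifP => _; last by rewrite mulr0.
    by rewrite exprS mulrA.
  have c0 : 0 < k.+2`!%:R :> R by rewrite ltr0n fact_gt0.
  apply/cvgr0Pnorm_le => e e0; near=> h.
  rewrite ger0_norm ?flat_ge0// (le_trans (flat_bound _ _))//.
  rewrite mulrC -ler_pdivlMr//.
  near: h; apply: dnbhs0_le; exact: divr_gt0.
Unshelve. all: by end_near. Qed.

End flat_functions.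

Section smooth_class.
Context {R : realType} {n : nat}.
Local Notation V := 'rV[R]_n.
Local Notation mu := (lebesgueRn R n).
Local Notation e_ i := (delta_mx (ord0 : 'I_1) i : V).

(** Functions generated by coordinatewise [flat] functions; closure under partial
    derivatives reduces infinite differentiability to differentiability. *)
Inductive flat_algebra : (V -> R) -> Prop :=
| flat_gen k l s c : flat_algebra (fun x => flat k (s * x ord0 l + c))
| flat_cst c : flat_algebra (fun=> c)
| flat_add f g : flat_algebra f -> flat_algebra g ->
    flat_algebra (fun x => f x + g x)
| flat_mul f g : flat_algebra f -> flat_algebra g ->
    flat_algebra (fun x => f x * g x).

Lemma flat_gen_differentiable k l s c (x : V) :
  differentiable (fun x : V => flat k (s * x ord0 l + c)) x.
Proof.
apply: (@differentiable_comp _ _ _ _ (fun x : V => s * x ord0 l + c) (flat k)).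
  apply: (@differentiableD _ _ _ (fun x : V => s * x ord0 l) (cst c)); last exact: differentiable_cst.
  apply: (@differentiableM _ _ (cst s) (fun x : V => x ord0 l)); first exact: differentiable_cst.
  exact: differentiable_coord.
apply/derivable1_diffP; have := is_derive_flat k (s * x ord0 l + c).
by case.
Qed.

Lemma pd_flat_gen k l s c i :
  pd i (fun x : V => flat k (s * x ord0 l + c)) =
  (fun x => (if l == i then s else 0) * (flat k.+2 (s * x ord0 l + c) +
     (- k%:R) * flat k.+1 (s * x ord0 l + c))).
Proof.
apply/funext => x.
have := differentiable_diff_quot (i := i) (flat_gen_differentiable k l s c x).
move=> H; apply: (cvg_unique _ H) => //.
set y := s * x ord0 l + c.
have [li|li] := eqVneq l i; last first.
  rewrite mul0r (_ : diff_quot _ _ ^~ _ = cst 0); first exact: cvg_cst.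
  by apply/funext => j; rewrite /diff_quot !mxE (negPf li) andbF mulr0 addr0 subrr mulr0.
have [->|s0] := eqVneq s 0.
  rewrite mul0r (_ : diff_quot _ _ ^~ _ = cst 0); first exact: cvg_cst.
  by apply/funext => j; rewrite /diff_quot !mul0r subrr mulr0.
have [/cvg_ex[d Hd] Dd] := is_derive_flat k y.
have {Dd} dE : d = flat k.+2 y + (- k%:R) * flat k.+1 y.
  by rewrite mulNr -Dd; apply/esym/cvg_lim => //.
rewrite -dE.
have u0 : (fun j : nat => s * j.+1%:R^-1 : R) @ \oo --> 0.
  rewrite -(mulr0 s); apply: cvgM; [exact: cvg_cst|exact: cvg_harmonic].
have H2 := (cvgr_dnbhsP _ _ _).1 Hd (fun j => s * j.+1%:R^-1).
rewrite (_ : diff_quot _ _ ^~ _ = (fun j => s * ((s * j.+1%:R^-1)^-1 *: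
    ((flat k \o shift y) ((s * j.+1%:R^-1) *: 1) - flat k y)))); last first.
  apply/funext => j; rewrite /diff_quot/= !mxE -li !eqxx /GRing.scale/=.
  rewrite !mulr1 (_ : s * (x ord0 l + j.+1%:R^-1) + c = s / j.+1%:R + y); last by rewrite /y; ring.
  by rewrite mulrA invfM invrK mulrA mulfV// mul1r.
apply: cvgM; first exact: cvg_cst.
by apply: H2; split => // j; rewrite mulf_neq0// invr_neq0// pnatr_eq0.
Qed.

Lemma flat_algebra_differentiable f x : flat_algebra f -> differentiable f x.
Proof.
elim=> [k l s c|c|{}f g Af df Ag dg|{}f g Af df Ag dg].
- exact: flat_gen_differentiable.
- exact: differentiable_cst.
- exact: (differentiableD df dg).
- exact: (differentiableM df dg).
Qed.

Lemma flat_algebra_pd f i : flat_algebra f -> flat_algebra (pd i f).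
Proof.
elim=> [k l s c|c|{}f g Af Apf Ag Apg|{}f g Af Apf Ag Apg].
- rewrite pd_flat_gen; apply: flat_mul; first exact: flat_cst.
  apply: flat_add; first exact: flat_gen.
  by apply: flat_mul; [exact: flat_cst|exact: flat_gen].
- rewrite (_ : pd i _ = cst 0); first exact: flat_cst.
  by apply/funext => x; rewrite /pd derive_cst.
- rewrite (_ : pd i _ = (fun x => pd i f x + pd i g x)); first exact: flat_add.
  apply/funext => x.
  have := pd_lin 1 i (flat_algebra_differentiable x Af) (flat_algebra_differentiable x Ag).
  rewrite mul1r => <-; congr (pd i _ x); apply/funext => y.
  by rewrite mul1r.
- rewrite (_ : pd i _ = (fun x => pd i f x * g x + f x * pd i g x)).
    by apply: flat_add; exact: flat_mul.
  by apply/funext => x; rewrite pdM//; exact: flat_algebra_differentiable.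
Qed.

(** As m grows, the factors tend to the indicators of the half lines bounding the
    box. *)
Definition bump (a b : V) (m : R) (x : V) : R :=
  \prod_(i < n) (flat 0 (m * x ord0 i + - (m * a ord0 i)) *
                 flat 0 (- m * x ord0 i + m * b ord0 i)).

Lemma bump_flat_algebra a b m : flat_algebra (bump a b m).
Proof.
rewrite /bump; elim: (index_enum _) => [|i s IH].
  by under eq_fun do rewrite big_nil; exact: flat_cst.
under eq_fun do rewrite big_cons.
by apply: flat_mul => //; apply: flat_mul; exact: flat_gen.
Qed.

Lemma cbox_compact (a b : V) : compact (cbox a b).
Proof.
rewrite (_ : cbox a b = [set x | forall i, `[a ord0 i, b ord0 i]%classic (x ord0 i)]).
  by apply: (rV_compact (A := fun i => `[a ord0 i, b ord0 i]%classic)) => i; exact: segment_compact.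
by apply/seteqP; split => x H i; have := H i; rewrite /= in_itv.
Qed.

Lemma bump_test_function Om a b m : 0 <= m -> cbox a b `<=` Om ->
  test_function Om (bump a b m).
Proof.
move=> m0 abOm; split.
  move=> s x; apply: flat_algebra_differentiable.
  elim: s => [|i s IH] /=; first exact: bump_flat_algebra.
  exact: flat_algebra_pd.
exists (cbox a b); [exact: cbox_compact|split=> //] => x xab.
have [i Hi] : exists i, ~ (a ord0 i <= x ord0 i <= b ord0 i).
  by apply: contrapT => h; apply: xab => i; apply: contrapT => h'; apply: h; exists i.
rewrite /bump (bigD1 i)//=.
suff -> : flat 0 (m * x ord0 i + - (m * a ord0 i)) *
          flat 0 (- m * x ord0 i + m * b ord0 i) = 0 by rewrite mul0r.
apply/eqP; rewrite mulf_eq0; apply/orP.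
have [ax|xa] := leP (a ord0 i) (x ord0 i).
  right; rewrite flat_le0// mulNr addrC -mulrBr mulr_ge0_le0// subr_le0.
  by rewrite leNgt; apply/negP => xb; apply: Hi; rewrite ax ltW.
by left; rewrite flat_le0// -mulrBr mulr_ge0_le0// subr_le0 ltW.
Qed.

Lemma flat0_le1 (t : R) : flat 0 t <= 1.
Proof.
rewrite /flat; case: ifP => // t0; rewrite expr0 mul1r -expR0 ler_expR.
by rewrite oppr_le0 invr_ge0 ltW.
Qed.

Lemma bump_bound a b m x : 0 <= bump a b m x <= 1.
Proof.
rewrite /bump; apply/andP; split.
  by apply: prodr_ge0 => i _; rewrite mulr_ge0// flat_ge0.
apply: prodr_ile1 => i _; rewrite mulr_ge0 ?flat_ge0//=.
by rewrite mulr_ile1// ?flat_ge0// flat0_le1.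
Qed.

Lemma cvg_flat0 (t : R) :
  (fun j : nat => flat 0 (j.+1%:R * t)) @ \oo --> (if 0 < t then 1 else 0 : R).
Proof.
case: ifPn => t0; last first.
  rewrite (_ : (fun _ => _) = cst 0); first exact: cvg_cst.
  by apply/funext => j; rewrite flat_le0// mulr_ge0_le0// leNgt.
rewrite (_ : (fun _ => _) = (fun j : nat => expR (- (t^-1 * j.+1%:R^-1)))); last first.
  by apply/funext => j; rewrite /flat mulr_gt0// expr0 mul1r invfM mulrC.
suff H : (fun j : nat => expR (- (t^-1 * j.+1%:R^-1))) @ \oo --> expR (- (t^-1 * 0)).
  by move: H; rewrite mulr0 oppr0 expR0.
apply: continuous_cvg; first exact: continuous_expR.
by apply: cvgN; apply: cvgM; [exact: cvg_cst|exact: cvg_harmonic].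
Qed.

Lemma cvg_bump a b x :
  (fun j : nat => bump a b j.+1%:R x) @ \oo --> (if x \in obox a b then 1 else 0 : R).
Proof.
rewrite (_ : (if _ then _ else _) =
  \prod_(i < n) ((if 0 < x ord0 i - a ord0 i then 1 else 0) *
                 (if 0 < b ord0 i - x ord0 i then 1 else 0))); last first.
  case: ifPn => [/set_mem xab|/negP xab].
    rewrite big1// => i _; have := xab i; rewrite !subr_gt0.
    by move=> /andP[-> ->]; rewrite mulr1.
  have [i Hi] : exists i, ~ (a ord0 i < x ord0 i < b ord0 i).
    by apply: contrapT => h; apply: xab; apply: mem_set => i; apply: contrapT => h'; apply: h; exists i.
  rewrite (bigD1 i)//= !subr_gt0; move/negP: Hi; rewrite negb_and.
  by move=> /orP[/negPf ->|/negPf ->]; rewrite ?mulr0 !mul0r.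
rewrite /bump; apply: cvg_big => [|i _]; first exact: mul_continuous.
apply: cvgM.
  have := @cvg_flat0 (x ord0 i - a ord0 i).
  by under eq_fun do rewrite mulrBr.
have := @cvg_flat0 (b ord0 i - x ord0 i).
by under eq_fun do rewrite mulrBr addrC -mulNr.
Qed.

Lemma bump_out a b m x : 0 <= m -> ~ obox a b x -> bump a b m x = 0.
Proof.
move=> m0 xab.
have [i Hi] : exists i, ~ (a ord0 i < x ord0 i < b ord0 i).
  by apply: contrapT => h; apply: xab => i; apply: contrapT => h'; apply: h; exists i.
rewrite /bump (bigD1 i)//=.
suff -> : flat 0 (m * x ord0 i + - (m * a ord0 i)) *
          flat 0 (- m * x ord0 i + m * b ord0 i) = 0 by rewrite mul0r.
apply/eqP; rewrite mulf_eq0; apply/orP.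
have [ax|xa] := ltP (a ord0 i) (x ord0 i).
  right; rewrite flat_le0// mulNr addrC -mulrBr mulr_ge0_le0// subr_le0.
  by rewrite leNgt; apply/negP => xb; apply: Hi; rewrite ax.
by left; rewrite flat_le0// -mulrBr mulr_ge0_le0// subr_le0.
Qed.

Lemma L2_integrable (A : set V) g : measurable A -> (mu A < +oo)%E -> L2 A g ->
  mu.-integrable A (EFin \o g).
Proof.
move=> mA Afin Lg.
have L1 : L2 A (cst 1).
  by apply: (@L2_bounded _ _ A mA _ 1) => // x _; rewrite normr1.
have := L2_integrable_mul mA Lg L1; apply: eq_integrable => // x _.
by rewrite /= mulr1.
Qed.

(** Bumps converge boundedly to the indicators of boxes, boxes generate the
    Borel sets, and an integrable function with vanishing integrals is null. *)
Lemma fundamental_lemma Om g : open Om -> L2 Om g ->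
  (forall phi, test_function Om phi -> \int[mu]_(x in Om) (g x * phi x) = 0) ->
  {ae mu, forall x, Om x -> g x = 0}.
Proof.
move=> oOm Lg g0; have mOm := open_measurable_row oOm.
have mb (a b : V) : measurable (obox a b : set V) := measurable_obox a b.
have ocbox (a b : V) : obox a b `<=` cbox a b.
  by move=> x xab i; have /andP[/ltW -> /ltW ->] := xab i.
have intg (a b : V) : cbox a b `<=` Om -> mu.-integrable (obox a b) (EFin \o g).
  move=> abO; apply: L2_integrable => //; first exact: lebesgueRn_obox_lty.
  by apply: (L2S (mb a b) mOm _ Lg); exact: (subset_trans (ocbox a b) abO).
(* integrals over boxes well inside Om vanish: limit of bumps *)
have step1 (a b : V) : cbox a b `<=` Om -> (\int[mu]_(x in obox a b) (g x)%:E = 0)%E.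
  move=> abO; have ig := intg _ _ abO; have /integrableP[mg _] := ig.
  have mbump j : measurable_fun setT (bump a b j.+1%:R).
    by apply: (@test_function_measurable _ _ Om); exact: bump_test_function.
  have gb j : (\int[mu]_(x in obox a b) (g x * bump a b j.+1%:R x)%:E = 0)%E.
    have iO : mu.-integrable Om (EFin \o (fun x => g x * bump a b j.+1%:R x)).
      apply: L2_integrable_mul => //; apply: (test_function_L2 (Om := Om)) => //.
      exact: bump_test_function.
    have := congr1 EFin (g0 _ (bump_test_function (ler0n R j.+1) abO)).
    rewrite /Rintegral fineK; last exact: integrable_fin_num.
    move=> gO0; apply: etrans gO0.
    rewrite [LHS]integral_mkcond [RHS]integral_mkcond; apply: eq_integral => x _.
    rewrite !patchE; have [xab|xab] := pselect (obox a b x).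
      by rewrite !mem_set//; apply: abO; exact: ocbox.
    rewrite bump_out// mulr0 memNset//.
    by case: ifP.
  have [|||||_ _] := @dominated_convergence _ _ _ mu (obox a b) (mb a b)
    (fun j => EFin \o (fun x => g x * bump a b j.+1%:R x)) (EFin \o g) (fun x => `|(EFin \o g) x|%E).
  - move=> j; apply/measurable_EFinP/measurable_funM; first exact/measurable_EFinP.
    exact: measurable_funTS.
  - by [].
  - apply: aeW => x xab; apply: cvg_EFin; first exact: nearW.
    rewrite /comp/= -[in X in _ --> X](mulr1 (g x)); apply: cvgM; first exact: cvg_cst.
    by have := @cvg_bump a b x; rewrite mem_set.
  - exact: integrable_abse.
  - apply: aeW => x j _; rewrite /= lee_fin normrM.
    have /andP[h0 h1] := bump_bound a b j.+1%:R x.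
    by rewrite (ger0_norm h0) ler_piMr.
  move=> H; apply: (cvg_unique _ H) => //.
  rewrite (_ : (fun j => _) = cst 0%E); first exact: cvg_cst.
  by apply/funext => j; exact: gb.
(* subsets of such a box: the sets with vanishing integral form a Dynkin class *)
have step2 (a b : V) : cbox a b `<=` Om -> {ae mu, forall x, obox a b x -> g x = 0}.
  move=> abO; have ig := intg _ _ abO.
  have H S : <<s oboxes >> S -> (\int[mu]_(x in S `&` obox a b) (g x)%:E = 0)%E.
    move: S; apply: (dynkin_induction oboxes_generate oboxes_setI).
    - by rewrite setTI step1.
    - move=> _ [[a' b'] _ <-]; rewrite setIC oboxI/= step1//.
      apply: subset_trans abO => x xab i; have := xab i; rewrite !mxE.
      by rewrite ge_max le_min => /andP[/andP[-> _] /andP[-> _]].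
    - move=> S mS IS.
      have := step1 _ _ abO.
      rewrite -{1}(setTI (obox a b)) -(setUv S) setIUl integral_setU_EFin//.
      + by rewrite IS add0e.
      + exact: measurableI.
      + by apply: measurableI => //; exact: measurableC.
      + rewrite -setIUl setUv setTI.
        exact: (L2_measurable (mb a b) (L2S (mb a b) mOm (subset_trans (ocbox a b) abO) Lg)).
      + by apply/disj_set2P; rewrite setIACA setICr set0I.
    - move=> F mF tF IF; rewrite setI_bigcupl integral_bigcup//.
      + by rewrite eseries0// => k _ _; exact: IF.
      + by apply: trivIset_setIr.
      + by move=> k; exact: measurableI.
      + apply: integrableS ig; [exact: mb| |by move=> x [k _ []]].
        by apply: bigcupT_measurable => k; exact: measurableI.
  have HE E : E `<=` obox a b -> measurable E ->
      (\int[mu]_(x in E) (EFin \o g) x = \int[mu]_(x in E) cst 0 x)%E.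
    by move=> Eab mE; rewrite integral0 -(H E) ?setIidl//; rewrite -oboxes_generate.
  have := integral_ae_eq (mb a b) ig (measurable_cst _) HE.
  by apply: filterS => x gx xab; have [] := gx xab.
(* countably many such boxes cover Om *)
pose N (p : 'rV[rat]_n * nat) : set V := if `[< cbox (rat_lo p) (rat_hi p) `<=` Om >]
  then [set x | obox (rat_lo p) (rat_hi p) x /\ g x <> 0] else set0.
pose F k : set V := if unpickle k is Some p then N p else set0.
have nF : mu.-negligible (\bigcup_k F k).
  apply: negligible_bigcup => k; rewrite /F; case: unpickle => [p|]; last exact: negligible_set0.
  rewrite /N; case: asboolP => [/step2 H|_]; last exact: negligible_set0.
  by apply: negligibleS H => x [h1 h2] /= H; apply: h2; exact: H.
apply: negligibleS nF => x /= /not_implyP[Ox gx].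
move: Ox; rewrite (open_rational_boxes oOm) => -[p /= pO xp].
exists (pickle p) => //; rewrite /F pickleK /N ifT//.
exact/asboolP.
Qed.

End smooth_class.

(** * Weak derivatives and Sobolev spaces *)

(* Variables in place of inner products and norms keep arithmetic tactics from
   unfolding these. *)
Ltac gen_norms := repeat (match goal with
  | |- context [ip ?A ?f ?g] => generalize (ip A f g)
  | |- context [L2norm ?A ?f] => generalize (L2norm A f)
  end; intro).

Section weak_derivatives.
Opaque ip L2norm.
Context {R : realType} {n : nat}.
Local Notation V := 'rV[R]_n.
Local Notation mu := (lebesgueRn R n).
Variables (Om : set V) (oOm : open Om).
Implicit Types (f g v w phi : V -> R) (i : 'I_n).

Let mOm : measurable Om := open_measurable_row oOm.

Lemma weak_pd_unique i v g h : L2 Om g -> L2 Om h ->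
  is_weak_pd Om i v g -> is_weak_pd Om i v h ->
  {ae mu, forall x, Om x -> g x = h x}.
Proof.
move=> Lg Lh wg wh.
suff : {ae mu, forall x, Om x -> g x - h x = 0}.
  by apply: filterS => x H Ox; apply/eqP; rewrite -subr_eq0; apply/eqP/H.
apply: (fundamental_lemma oOm); first exact: L2B.
move=> phi tphi; have Lphi := test_function_L2 mOm tphi.
rewrite [LHS](ip_fold Om (fun x => g x - h x) phi) ipBl//.
have /= Eg := wg _ tphi; have /= := wh _ tphi; rewrite Eg !ip_fold => /oppr_inj ->.
by rewrite subrr.
Qed.

Lemma H1_L2 v : H1 Om v -> L2 Om v. Proof. by case. Qed.

Lemma wpd_spec i v : H1 Om v -> L2 Om (wpd Om i v) /\ is_weak_pd Om i v (wpd Om i v).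
Proof.
move=> [_ /(_ i)[g Lg wg]].
exact: (@xgetPex _ (cst 0) [set g | L2 Om g /\ is_weak_pd Om i v g] (ex_intro _ g (conj Lg wg))).
Qed.

Lemma wpd_L2 i v : H1 Om v -> L2 Om (wpd Om i v).
Proof. by move=> /(wpd_spec i)[]. Qed.

Lemma wpd_ae i v g : H1 Om v -> L2 Om g -> is_weak_pd Om i v g ->
  {ae mu, forall x, Om x -> wpd Om i v x = g x}.
Proof. by move=> /(wpd_spec i)[L w] Lg; exact: weak_pd_unique. Qed.

Lemma is_weak_pd_lin i v w g h t : L2 Om v -> L2 Om w -> L2 Om g -> L2 Om h ->
  is_weak_pd Om i v g -> is_weak_pd Om i w h ->
  is_weak_pd Om i (fun x => v x + t * w x) (fun x => g x + t * h x).
Proof.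
move=> Lv Lw Lg Lh wg wh phi tphi.
have Lphi := test_function_L2 mOm tphi.
have Lpd := test_function_L2 mOm (test_function_pd i tphi).
rewrite [LHS](ip_fold Om (fun x => v x + t * w x) (pd i phi)).
rewrite [X in - X](ip_fold Om (fun x => g x + t * h x) phi).
have Ltw := L2Z mOm t Lw; have Lth := L2Z mOm t Lh.
have /= Ev := wg _ tphi; have /= Ew := wh _ tphi; rewrite !ip_fold in Ev Ew.
by rewrite !ipDl// !ipZl// Ev Ew; ring.
Qed.

Lemma H1_lin v w t : H1 Om v -> H1 Om w -> H1 Om (fun x => v x + t * w x).
Proof.
move=> Hv Hw; split; first by apply: L2D (H1_L2 Hv) _ => //; exact: L2Z (H1_L2 Hw).
move=> i; have [Lv wv] := wpd_spec i Hv; have [Lw ww] := wpd_spec i Hw.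
exists (fun x => wpd Om i v x + t * wpd Om i w x).
  by apply: L2D => //; exact: L2Z.
by apply: is_weak_pd_lin => //; exact: H1_L2.
Qed.

Lemma wpd_lin i v w t : H1 Om v -> H1 Om w ->
  {ae mu, forall x, Om x -> wpd Om i (fun x => v x + t * w x) x =
     wpd Om i v x + t * wpd Om i w x}.
Proof.
move=> Hv Hw; have [Lv wv] := wpd_spec i Hv; have [Lw ww] := wpd_spec i Hw.
apply: wpd_ae; first exact: H1_lin.
  by apply: L2D => //; exact: L2Z.
by apply: is_weak_pd_lin => //; exact: H1_L2.
Qed.

Lemma ip_wpd_lin i v w t f : H1 Om v -> H1 Om w -> L2 Om f ->
  ip Om f (wpd Om i (fun x => v x + t * w x)) =
  ip Om f (wpd Om i v) + t * ip Om f (wpd Om i w).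
Proof.
move=> Hv Hw Lf; have Lv := wpd_L2 i Hv; have Lw := wpd_L2 i Hw.
have Ltw := L2Z mOm t Lw.
rewrite ipC (ae_eq_ipl mOm _ _ Lf (wpd_lin i t Hv Hw)).
- by rewrite ipDl// ipZl// !(ipC _ f).
- exact/wpd_L2/H1_lin.
- exact: L2D.
Qed.

Lemma test_function_Rintegral f phi : test_function Om phi ->
  \int[mu]_(x in Om) (f x * phi x) = \int[mu]_x (f x * phi x).
Proof.
move=> tphi; rewrite Rintegral_mkcond; apply: eq_Rintegral => x _.
rewrite patchE; case: ifPn => // /negP Ox.
by rewrite (test_function_out tphi) ?mulr0// => h; apply: Ox; exact: mem_set.
Qed.

Lemma test_function_weak_pd i phi : test_function Om phi ->
  is_weak_pd Om i phi (pd i phi).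
Proof.
move=> tphi psi tpsi.
have [B HB] := test_function_bounded tphi; have [L HL] := test_function_lip i tphi.
rewrite !test_function_Rintegral//; last exact: test_function_pd.
have mpd := test_function_measurable (test_function_pd i tphi).
have cpd : {ae mu, forall x, diff_quot phi i ^~ x @ \oo --> pd i phi x}.
  by apply: aeW => x; exact: test_function_diff_quot tphi.
exact: (lipschitz_integration_by_parts (test_function_measurable tphi) HB HL mpd cpd tpsi).
Qed.

Lemma test_function_H1 phi : test_function Om phi -> H1 Om phi.
Proof.
move=> tphi; split; first exact: (test_function_L2 mOm tphi).
move=> i; exists (pd i phi); last exact: test_function_weak_pd.
exact: (test_function_L2 mOm (test_function_pd i tphi)).
Qed.

Opaque wpd.
(** The square of [H1norm], an inner product norm whose expansion needs no square
    roots. *)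
Definition h1sq v : R := ip Om v v + \sum_i ip Om (wpd Om i v) (wpd Om i v).

Lemma h1sqE v : h1sq v = ip Om v v + \sum_i ip Om (wpd Om i v) (wpd Om i v).
Proof. by []. Qed.

Lemma h1sq_ge0 v : 0 <= h1sq v.
Proof. by rewrite addr_ge0 ?ip_ge0// sumr_ge0// => i _; exact: ip_ge0. Qed.

Lemma H1norm_sqr v : H1norm Om v ^+ 2 = h1sq v.
Proof.
have S0 : 0 <= \sum_i ip Om (wpd Om i v) (wpd Om i v).
  by rewrite sumr_ge0// => i _; exact: ip_ge0.
have E : grad_norm Om v ^+ 2 = \sum_i ip Om (wpd Om i v) (wpd Om i v).
  rewrite /grad_norm sqr_sqrtr; last by apply: sumr_ge0 => i _; rewrite sqr_ge0.
  by apply: eq_bigr => i _; rewrite L2norm_sqr.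
by rewrite /H1norm sqr_sqrtr ?addr_ge0 ?sqr_ge0// E L2norm_sqr.
Qed.

Lemma ip_wpd_wpd_lin i v w t : H1 Om v -> H1 Om w ->
  let D := wpd Om i (fun x => v x + t * w x) in
  ip Om D D = ip Om (wpd Om i v) (wpd Om i v) +
    2 * t * ip Om (wpd Om i v) (wpd Om i w) + t ^+ 2 * ip Om (wpd Om i w) (wpd Om i w).
Proof.
move=> Hv Hw D; have Lv := wpd_L2 i Hv; have Lw := wpd_L2 i Hw.
have LD : L2 Om D by apply: wpd_L2; exact: H1_lin.
have E f : L2 Om f -> ip Om D f = ip Om f (wpd Om i v) + t * ip Om f (wpd Om i w).
  by move=> Lf; rewrite ipC; exact: ip_wpd_lin.
by rewrite (E _ LD) (E _ Lv) (E _ Lw) (ipC _ (wpd Om i w) (wpd Om i v)); gen_norms; ring.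
Qed.

Lemma ip_lin2_le f g t : L2 Om f -> L2 Om g ->
  2 * t * ip Om f g <= ip Om f f + t ^+ 2 * ip Om g g.
Proof.
move=> Lf Lg; have := ip_ge0 Om (fun x => f x + - t * g x).
by rewrite ip_lin2// sqrrN; gen_norms; lra.
Qed.

Lemma h1sq_lin v w t : H1 Om v -> H1 Om w ->
  h1sq (fun x => v x + t * w x) <= 2 * h1sq v + 2 * t ^+ 2 * h1sq w.
Proof.
move=> Hv Hw; rewrite /h1sq !mulrDr addrACA !mulr_sumr -big_split/=; apply: lerD.
  have := ip_lin2_le t (H1_L2 Hv) (H1_L2 Hw).
  by rewrite ip_lin2//; [gen_norms; lra|exact: H1_L2..].
apply: ler_sum => i _; rewrite ip_wpd_wpd_lin//.
have := ip_lin2_le t (wpd_L2 i Hv) (wpd_L2 i Hw); gen_norms; lra.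
Qed.

Lemma ip_le_h1sq v : ip Om v v <= h1sq v.
Proof. by rewrite lerDl sumr_ge0// => i _; exact: ip_ge0. Qed.

Lemma ip_wpd_le_h1sq i v : ip Om (wpd Om i v) (wpd Om i v) <= h1sq v.
Proof.
rewrite /h1sq (bigD1 i)//= addrCA lerDl addr_ge0 ?ip_ge0// sumr_ge0// => j _.
exact: ip_ge0.
Qed.

Lemma L2norm_le_sqr f e : 0 < e -> ip Om f f <= e ^+ 2 -> L2norm Om f <= e.
Proof.
move=> e0; rewrite -L2norm_sqr ler_pXn2r// nnegrE ?L2norm_ge0//; exact: ltW.
Qed.

Opaque h1sq.

Lemma H10_H1 v : H10 Om v -> H1 Om v. Proof. by case. Qed.

Lemma H10P v : H10 Om v <-> H1 Om v /\ forall e, 0 < e ->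
  exists2 phi, test_function Om phi & h1sq (fun x => v x + - 1 * phi x) < e.
Proof.
have E phi : (v \- phi) = (fun x => v x + - 1 * phi x).
  by apply/funext => x; rewrite mulN1r.
have N0 u : 0 <= H1norm Om u by exact: sqrtr_ge0.
split => -[Hv H]; split=> // e e0.
  have [|phi tphi] := H (Num.sqrt e); first by rewrite sqrtr_gt0.
  rewrite E -(ltr_pXn2r (n := 2))// ?nnegrE ?sqrtr_ge0//.
  by rewrite H1norm_sqr sqr_sqrtr ?ltW//; exists phi.
have [|phi tphi] := H (e ^+ 2); first by rewrite exprn_gt0.
rewrite -H1norm_sqr -E => H'; exists phi => //.
by move: H'; rewrite ltr_pXn2r// ?nnegrE// ltW.
Qed.

Lemma test_function_H10 phi : test_function Om phi -> H10 Om phi.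
Proof.
move=> tphi; apply/H10P; split; first exact: test_function_H1.
move=> e e0; exists phi => //.
have Hphi := test_function_H1 tphi.
suff -> : h1sq (fun x => phi x + -1 * phi x) = 0 by [].
rewrite h1sqE ip_lin2 ?(H1_L2 Hphi)// big1 ?addr0; first by gen_norms; ring.
by move=> i _; rewrite ip_wpd_wpd_lin//; gen_norms; ring.
Qed.

(** Limits in the H1 norm of functions that test functions approximate are
    approximated as well. *)
Lemma H10_closure v : H1 Om v ->
  (forall e, 0 < e -> exists2 w, H10 Om w & h1sq (fun x => v x + - 1 * w x) < e) ->
  H10 Om v.
Proof.
move=> Hv H; apply/H10P; split=> // e e0.
have e4 : 0 < e / 4 by lra.
have [w /H10P[Hw Aw] vw] := H _ e4.
have [phi tphi wphi] := Aw _ e4; exists phi => //.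
have Hphi := test_function_H1 tphi.
have := h1sq_lin 1 (H1_lin (-1) Hv Hw) (H1_lin (-1) Hw Hphi).
rewrite (_ : (fun x => v x + -1 * w x + _) = (fun x => v x + -1 * phi x)); last first.
  by apply/funext => x; ring.
move: vw wphi; move: (h1sq _) (h1sq _) (h1sq _) => P Q S; lra.
Qed.

Lemma H10_lin v w t : H10 Om v -> H10 Om w -> H10 Om (fun x => v x + t * w x).
Proof.
move=> /H10P[Hv Av] /H10P[Hw Aw]; apply/H10P; split; first exact: H1_lin.
move=> e e0.
have t1 : 0 < 1 + t ^+ 2 by rewrite ltr_pwDl// sqr_ge0.
have e4 : 0 < e / 4 / (1 + t ^+ 2) by rewrite !divr_gt0.
have [phi tphi vphi] := Av _ e4; have [psi tpsi wpsi] := Aw _ e4.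
exists (fun x => phi x + t * psi x); first exact: test_function_lin.
have Hphi := test_function_H1 tphi; have Hpsi := test_function_H1 tpsi.
have := h1sq_lin t (H1_lin (-1) Hv Hphi) (H1_lin (-1) Hw Hpsi).
rewrite (_ : (fun x => v x + -1 * phi x + _) =
  (fun x => v x + t * w x + -1 * (phi x + t * psi x))); last first.
  by apply/funext => x; ring.
move=> /le_lt_trans; apply.
move: vphi wpsi; set P := h1sq _; set Q := h1sq _ => vP wQ.
have E : e = e / 4 / (1 + t ^+ 2) * (4 * (1 + t ^+ 2)) by field; rewrite gt_eqF.
rewrite E; move: (e / 4 / _) vP wQ e4 => d vP wQ d0.
have := sqr_ge0 t; nra.
Qed.

(** Limits of weak derivatives in the mean are weak derivatives of the limit,
    because test functions are square integrable. *)
Lemma H10_complete (u : nat -> V -> R) : (forall k, H10 Om (u k)) ->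
  (forall e, 0 < e -> exists N, forall j k, (N <= j)%N -> (N <= k)%N ->
     h1sq (fun x => u j x + - 1 * u k x) <= e) ->
  exists2 v, H10 Om v & forall e, 0 < e -> exists N, forall k, (N <= k)%N ->
     h1sq (fun x => u k x + - 1 * v x) <= e.
Proof.
move=> Hu Cu; have H1u k := H10_H1 (Hu k).
have sub f g : (fun x => f x - g x) = (fun x : V => f x + - 1 * g x) :> (V -> R).
  by apply/funext => x; rewrite mulN1r.
have [v Lv cv] : exists2 v, L2 Om v & forall e, 0 < e -> exists N, forall k, (N <= k)%N ->
     ip Om (fun x => u k x - v x) (fun x => u k x - v x) <= e.
  apply: L2_complete => // [k|e e0]; first exact: H1_L2.
  have [N HN] := Cu e e0; exists N => j k Nj Nk; rewrite sub.
  exact: le_trans (ip_le_h1sq _) (HN j k Nj Nk).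
have /boolp.choice[g Hg] : forall i, exists g, L2 Om g /\ forall e, 0 < e -> exists N, forall k, (N <= k)%N ->
     ip Om (fun x => wpd Om i (u k) x - g x) (fun x => wpd Om i (u k) x - g x) <= e.
  move=> i.
  have [|e e0|g Lg cg] := L2_complete (u := fun k => wpd Om i (u k)) mOm.
  - by move=> k; exact: wpd_L2.
  - have [N HN] := Cu e e0; exists N => j k Nj Nk; rewrite sub.
    apply: le_trans (HN j k Nj Nk); apply: le_trans (ip_wpd_le_h1sq i _).
    by rewrite ip_wpd_wpd_lin// ip_lin2//; exact: wpd_L2.
  - by exists g.
have wv i : is_weak_pd Om i v (g i).
  have [Lg cg] := Hg i.
  move=> phi tphi; have Lphi := test_function_L2 mOm tphi.
  have Lpd := test_function_L2 mOm (test_function_pd i tphi).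
  rewrite -[LHS]/(ip Om v (pd i phi)) -[X in - X]/(ip Om (g i) phi).
  apply/eqP; rewrite -subr_eq0 opprK -normr_le0; apply/ler_addgt0Pr => e e0.
  rewrite add0r.
  set a := L2norm Om (pd i phi) + L2norm Om phi + 1.
  have a0 : 0 < a by rewrite /a ltr_wpDl// addr_ge0 ?L2norm_ge0.
  have ea : 0 < (e / a) ^+ 2 by rewrite exprn_gt0// divr_gt0.
  have [N1 HN1] := cv _ ea; have [N2 HN2] := cg _ ea.
  pose k := maxn N1 N2.
  have {}HN1 := HN1 k (leq_maxl _ _); have {}HN2 := HN2 k (leq_maxr _ _).
  have [Lw ww] := wpd_spec i (H1u k).
  have /= E := ww _ tphi.
  rewrite -[\int[mu]_(x in Om) (u k x * pd i phi x)]/(ip Om (u k) (pd i phi)) in E.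
  rewrite -[\int[mu]_(x in Om) (wpd Om i (u k) x * phi x)]/(ip Om (wpd Om i (u k)) phi) in E.
  have Luk := H1_L2 (H1u k).
  have n1 := ip_normM mOm (L2B mOm Luk Lv) Lpd.
  have n2 := ip_normM mOm (L2B mOm Lw Lg) Lphi.
  rewrite ipBl// in n1; rewrite ipBl// in n2.
  have s1 : L2norm Om (fun x => u k x - v x) <= e / a.
    by apply: L2norm_le_sqr => //; exact: divr_gt0.
  have s2 : L2norm Om (fun x => wpd Om i (u k) x - g i x) <= e / a.
    by apply: L2norm_le_sqr => //; exact: divr_gt0.
  have t1 := ler_wpM2r (L2norm_ge0 Om (pd i phi)) s1.
  have t2 := ler_wpM2r (L2norm_ge0 Om phi) s2.
  rewrite (_ : _ + _ = - ((ip Om (u k) (pd i phi) - ip Om v (pd i phi)) +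
     (ip Om (wpd Om i (u k)) phi - ip Om (g i) phi))); last by rewrite E; ring.
  rewrite normrN (le_trans (ler_normD _ _))//.
  have -> : e = e / a * a by rewrite divfK// gt_eqF.
  rewrite {2}/a !mulrDr mulr1; have := divr_gt0 e0 a0; move: n1 n2 t1 t2.
  by move: (e / a) `|ip _ _ _ - ip _ v _| `|ip _ _ _ - ip _ (g i) _| => c X Y; gen_norms; lra.
have Hv : H1 Om v by split=> // i; have [Lg _] := Hg i; exists (g i).
have cvg e : 0 < e -> exists N, forall k, (N <= k)%N -> h1sq (fun x => u k x + - 1 * v x) <= e.
  move=> e0.
  have en : 0 < e / (n.+1%:R) by rewrite divr_gt0.
  have /boolp.choice[N HN] : forall i, exists N, forall k, (N <= k)%N ->
     ip Om (fun x => wpd Om i (u k) x - g i x) (fun x => wpd Om i (u k) x - g i x) <= e / n.+1%:R.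
    by move=> i; have [_ /(_ _ en)] := Hg i.
  have [N0 HN0] := cv _ en.
  exists (maxn N0 (\max_i N i)) => k; rewrite geq_max => /andP[k0 kN].
  have -> : e = e / n.+1%:R + \sum_(i < n) e / n.+1%:R.
    rewrite sumr_const card_ord -[X in _ + X]mulr_natr -[X in X + _]mulr1 -mulrDr nat1r.
    by rewrite divfK// pnatr_eq0.
  apply: lerD; first by rewrite -sub; exact: HN0.
  apply: ler_sum => i _; have [Lg cg] := Hg i.
  have Lw := wpd_L2 i (H1u k).
  have ae1 : {ae mu, forall x, Om x -> wpd Om i (fun x => u k x + -1 * v x) x =
      wpd Om i (u k) x - g i x}.
    apply: wpd_ae; [exact: H1_lin|exact: L2B|].
    by rewrite sub; apply: is_weak_pd_lin => //; [exact: H1_L2|have [] := wpd_spec i (H1u k)].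
  have LD : L2 Om (wpd Om i (fun x => u k x + -1 * v x)) by apply: wpd_L2; exact: H1_lin.
  have LB := L2B mOm Lw Lg.
  rewrite (ae_eq_ipl mOm LD LB LD ae1) ipC (ae_eq_ipl mOm LD LB LB ae1).
  by apply: HN; apply: leq_trans kN; exact: (leq_bigmax i).
exists v => //; apply: H10_closure => // e e0.
have e2 : 0 < e / 2 by rewrite divr_gt0.
have [N HN] := cvg _ e2; exists (u N) => //.
apply: (@le_lt_trans _ _ (e / 2)); last lra.
apply: le_trans (HN N (leqnn N)); rewrite le_eqVlt; apply/orP; left; apply/eqP.
have H1uN := H1u N.
have LN := H1_L2 H1uN; have Lv' := H1_L2 Hv.
rewrite !h1sqE.
have -> : ip Om (fun x => v x + -1 * u N x) (fun x => v x + -1 * u N x) =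
          ip Om (fun x => u N x + -1 * v x) (fun x => u N x + -1 * v x).
  by rewrite (ip_lin2 mOm (-1) Lv' LN) (ip_lin2 mOm (-1) LN Lv') (ipC _ v (u N)); gen_norms; ring.
apply: (f_equal (fun s => ip Om (fun x => u N x + -1 * v x) (fun x => u N x + -1 * v x) + s)).
apply: eq_bigr => i _; have /= -> := ip_wpd_wpd_lin i (-1) Hv H1uN.
have /= -> := ip_wpd_wpd_lin i (-1) H1uN Hv.
by rewrite (ipC _ (wpd Om i v)); gen_norms; ring.
Qed.

Lemma test_function_ip phi psi : test_function Om psi -> ip setT phi psi = ip Om phi psi.
Proof. by move=> tpsi; rewrite -!ip_fold test_function_Rintegral. Qed.

(** The inequality holds for test functions, and both sides are continuous in the
    H1 norm. *)
Lemma H10_poincare i k v : Om `<=` cube k -> H10 Om v ->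
  L2norm Om v <= 2 * k%:R * L2norm Om (wpd Om i v).
Proof.
move=> Ok /H10P[Hv Av].
have P phi : test_function Om phi -> L2norm Om phi <= 2 * k%:R * L2norm Om (wpd Om i phi).
  move=> tphi; have tpd := test_function_pd i tphi.
  have [B HB] := test_function_bounded tphi; have [L HL] := test_function_lip i tphi.
  have E psi : test_function Om psi -> L2norm setT psi = L2norm Om psi.
    move=> tpsi; apply/eqP; rewrite -(@eqrXn2 _ 2)// ?L2norm_ge0//.
    by rewrite !L2norm_sqr test_function_ip.
  have := directional_poincare (test_function_measurable tphi) HB (k := k) _ HL
    (test_function_L2 measurableT tpd).
  rewrite !E// => H.
  have -> : L2norm Om (wpd Om i phi) = L2norm Om (pd i phi).
    have Lpd := test_function_L2 mOm tpd.
    have Hphi := test_function_H1 tphi; have Lw := wpd_L2 i Hphi.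
    have ae1 := wpd_ae Hphi Lpd (test_function_weak_pd i tphi).
    apply/eqP; rewrite -(@eqrXn2 _ 2)// ?L2norm_ge0// !L2norm_sqr.
    by rewrite (ae_eq_ipl mOm Lw Lpd Lw ae1) ipC (ae_eq_ipl mOm Lw Lpd Lpd ae1).
  apply: H.
  - by move=> x xk; apply: (test_function_out tphi) => /Ok.
  - by apply: aeW => x; exact: test_function_diff_quot tphi.
apply/ler_addgt0Pr => e e0.
pose a : R := 1 + 2 * k%:R.
have a0 : 0 < a by rewrite ltr_pwDl// mulr_ge0.
have ea : 0 < (e / a) ^+ 2 by rewrite exprn_gt0// divr_gt0.
have [phi tphi] := Av _ ea.
have Hphi := test_function_H1 tphi.
set d := fun x => _; move=> vphi.
have Hd : H1 Om d by exact: H1_lin.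
have ea0 : 0 < e / a by exact: divr_gt0.
have d1 : L2norm Om d <= e / a.
  by apply: L2norm_le_sqr => //; apply: le_trans (ltW vphi); exact: ip_le_h1sq.
have d2 : L2norm Om (wpd Om i d) <= e / a.
  by apply: L2norm_le_sqr => //; apply: le_trans (ltW vphi); exact: ip_wpd_le_h1sq.
have Ev : v = (fun x => phi x + d x) by apply/funext => x; rewrite /d; ring.
have h1 : L2norm Om v <= L2norm Om phi + L2norm Om d.
  by rewrite {1}Ev; apply: L2normD => //; exact: H1_L2.
have Lv := wpd_L2 i Hv; have Ld := wpd_L2 i Hd; have Lp := wpd_L2 i Hphi.
have h2 : L2norm Om (wpd Om i phi) <= L2norm Om (wpd Om i v) + L2norm Om (wpd Om i d).
  have <- : L2norm Om (fun x => wpd Om i v x + -1 * wpd Om i d x) = L2norm Om (wpd Om i phi).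
    apply/eqP; rewrite -(@eqrXn2 _ 2)// ?L2norm_ge0// !L2norm_sqr ip_lin2//.
    have := ip_wpd_wpd_lin i (-1) Hv Hd; rewrite (_ : (fun x => v x + -1 * d x) = phi).
      by move=> /= <-.
    by apply/funext => x; rewrite /d; ring.
  apply: (le_trans (L2normD mOm Lv (L2Z mOm _ Ld))).
  by rewrite L2normZ// normrN1 mul1r.
have h3 := P _ tphi.
have k0 : 0 <= 2 * k%:R :> R by rewrite mulr_ge0.
have h4 := ler_wpM2l k0 h2; have h5 := ler_wpM2l k0 d2.
rewrite mulrDr in h4.
have -> : e = e / a * a by rewrite divfK// gt_eqF.
rewrite {2}/a; move: h1 h3 h4 h5 d1; gen_norms; lra.
Qed.

End weak_derivatives.

(** * Elliptic boundary value problems *)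

Section riesz.
Context {R : realType} {X : lmodType R}.

Lemma nonneg_quadratic_discriminant (a b c : R) : 0 <= a -> 0 <= c ->
  (forall t, 0 <= a + 2 * t * b + t ^+ 2 * c) -> b ^+ 2 <= a * c.
Proof.
move=> a0; rewrite le_eqVlt => /predU1P[<-|c0] H; last first.
  have := H (- b / c); rewrite (_ : _ + _ = (a * c - b ^+ 2) / c); last by field; rewrite gt_eqF.
  by rewrite pmulr_lge0 ?invr_gt0// subr_ge0.
have [->|b0] := eqVneq b 0; first by rewrite expr0n/= mulr0.
have := H (- (a + 1) / (2 * b)); rewrite mulr0 addr0 (_ : 2 * _ * _ = - (a + 1)); last by field.
by move=> h; exfalso; lra.
Qed.

Variables (D : set X) (B : X -> X -> R) (l : X -> R).
Hypothesis D0 : D 0.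
Hypothesis DD : forall x y t, D x -> D y -> D (x + t *: y).
Hypothesis Bsym : forall x y, D x -> D y -> B x y = B y x.
Hypothesis Blin : forall x y z t, D x -> D y -> D z ->
  B x (y + t *: z) = B x y + t * B x z.
Hypothesis Bge0 : forall x, D x -> 0 <= B x x.
Hypothesis llin : forall y z t, D y -> D z -> l (y + t *: z) = l y + t * l z.
Variable K : R.
Hypothesis lB : forall x, D x -> l x ^+ 2 <= K * B x x.
Hypothesis complete : forall u : nat -> X, (forall k, D (u k)) ->
  (forall e, 0 < e -> exists N, forall j k, (N <= j)%N -> (N <= k)%N ->
     B (u j - u k) (u j - u k) <= e) ->
  exists2 v, D v & forall e, 0 < e -> exists N, forall k, (N <= k)%N ->
     B (u k - v) (u k - v) <= e.

Let Bquad x y t : D x -> D y ->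
  B (x + t *: y) (x + t *: y) = B x x + 2 * t * B x y + t ^+ 2 * B y y.
Proof.
move=> Dx Dy; have Dxy := DD t Dx Dy.
rewrite Blin// (Bsym Dxy Dx) (Bsym Dxy Dy) !Blin// (Bsym Dy Dx); ring.
Qed.

Let BCS x y : D x -> D y -> B x y ^+ 2 <= B x x * B y y.
Proof.
move=> Dx Dy; apply: nonneg_quadratic_discriminant; [exact: Bge0|exact: Bge0|] => t.
by rewrite -Bquad//; apply: Bge0; exact: DD.
Qed.

Let J x := B x x - 2 * l x.

Let Jquad x y t : D x -> D y ->
  J (x + t *: y) = J x + 2 * t * (B x y - l y) + t ^+ 2 * B y y.
Proof. by move=> Dx Dy; rewrite /J Bquad// llin//; ring. Qed.

Let K0 : 0 <= `|K|. Proof. exact: normr_ge0. Qed.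

Let Jbound x : D x -> - `|K| <= J x.
Proof.
move=> Dx; have h := lB Dx; have b0 := Bge0 Dx; rewrite /J.
have h2 : l x ^+ 2 <= `|K| * B x x.
  by apply: le_trans h _; rewrite ler_wpM2r// ler_norm.
rewrite leNgt; apply/negP => H.
have H2 : B x x + `|K| < 2 * l x by lra.
move: K0 b0 h2 H2; move: `|K| (B x x) (l x) => k b r k0 b0 h2 H2.
have h3 : (b + k) * (b + k) < (2 * r) * (2 * r) by apply: ltr_pM => //; exact: addr_ge0.
have := sqr_ge0 (b - k); nra.
Qed.

(** The direct method: the energy B(x,x) - 2 l(x) is bounded below, the
    parallelogram identity makes minimizing sequences Cauchy, and the Euler equation
    passes to the limit. *)
Lemma riesz_representation : exists2 y, D y & forall v, D v -> B y v = l v.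
Proof.
pose S := [set J x | x in D].
have S0 : S !=set0 by exists (J 0); exists 0.
have lS : has_lbound S by exists (- `|K|) => _ [x Dx <-]; exact: Jbound.
have Sinf : has_inf S by split.
pose m := inf S.
have mJ x : D x -> m <= J x.
  by move=> Dx; apply: ge_inf => //; exists x.
have /boolp.choice[u Hu] : forall k : nat, exists x, D x /\ J x < m + k.+1%:R^-1.
  move=> k; have k0 : 0 < k.+1%:R^-1 :> R by [].
  by have [_ [x Dx <-] xm] := inf_adherent k0 Sinf; exists x.
have Du k : D (u k) by have [] := Hu k.
have DB x y : D x -> D y -> D (x - y) by move=> Dx Dy; rewrite -scaleN1r; exact: DD.
(* the midpoint of u j and u k has energy at least m *)
have ucauchy j k : B (u j - u k) (u j - u k) <= 2 * (j.+1%:R^-1 + k.+1%:R^-1).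
  have Dd := DB _ _ (Du j) (Du k).
  have := mJ _ (DD (2^-1) (Du k) Dd).
  have Ej : u j = u k + 1 *: (u j - u k) by rewrite scale1r addrC subrK.
  have [_ hk] := Hu k; have [_] := Hu j.
  rewrite {1}Ej !Jquad// => hj hm; move: hj hm hk.
  move: (J (u k)) (B (u k) _ - l _) (B (u j - u k) _) (j.+1%:R^-1) (k.+1%:R^-1) => a b c ej ek.
  by lra.
have harm e : 0 < e -> exists N : nat, forall k, (N <= k)%N -> k.+1%:R^-1 <= e :> R.
  move=> e0; exists (Num.truncn e^-1) => k Nk.
  rewrite invf_ple ?posrE// ltW// (lt_le_trans (truncnS_gt _))// ler_nat ltnS.
  by [].
have [|v Dv cv] := complete Du.
  move=> e e0; have e4 : 0 < e / 4 by rewrite divr_gt0.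
  have [N HN] := harm _ e4; exists N => j k Nj Nk.
  apply: le_trans (ucauchy j k) _; have := HN _ Nj; have := HN _ Nk.
  by move: (j.+1%:R^-1) (k.+1%:R^-1) => a b; lra.
exists v => // w Dw.
have Bw := Bge0 Dw.
have euler k : (B (u k) w - l w) ^+ 2 <= k.+1%:R^-1 * B w w.
  apply: nonneg_quadratic_discriminant => // t.
  have := mJ _ (DD t (Du k) Dw); rewrite Jquad//; have [_] := Hu k.
  by move: (J _) (B _ w - _) (B w w) (k.+1%:R^-1) => a b c d; lra.
apply/eqP; rewrite -subr_eq0 -sqrf_eq0 eq_le sqr_ge0 andbT.
apply/ler_addgt0Pr => e e0; rewrite add0r.
pose d := e / (4 * (B w w + 1)).
have b1 : 0 < B w w + 1 by rewrite ltr_wpDl.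
have d0 : 0 < d by rewrite divr_gt0// mulr_gt0.
have [N1 HN1] := harm _ d0; have [N2 HN2] := cv _ d0.
pose k := maxn N1 N2.
have h1 := HN1 k (leq_maxl _ _); have h2 := HN2 k (leq_maxr _ _).
have Duv := DB _ _ (Du k) Dv.
have h3 := BCS Duv Dw; have h4 := euler k.
have E1 : B (u k - v) w = B (u k) w - B v w.
  rewrite -scaleN1r (Bsym (DD (-1) (Du k) Dv) Dw) Blin// mulN1r.
  by rewrite (Bsym Dw (Du k)) (Bsym Dw Dv).
rewrite E1 in h3.
have h5 : k.+1%:R^-1 * B w w <= d * B w w by rewrite ler_wpM2r.
have h6 : B (u k - v) (u k - v) * B w w <= d * B w w by rewrite ler_wpM2r.
have -> : e = d * (4 * (B w w + 1)) by rewrite divfK// gt_eqF// mulr_gt0.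
move: h3 h4 h5 h6 d0 Bw; move: (l w) (B (u k) w) (B v w) (B w w) (B (u k - v) (u k - v) * B w w) (k.+1%:R^-1 * B w w).
move=> z y x b a2 a1 h3 h4 h5 h6 d0 b0.
have := sqr_ge0 ((y - z) + (y - x)); nra.
Qed.

End riesz.

Section integral_inequalities.
Context {R : realType} {n : nat}.
Local Notation V := 'rV[R]_n.
Local Notation mu := (lebesgueRn R n).
Implicit Types (f g : V -> R) (A : set V).

Lemma ae_Rintegral_ge0 A f : measurable A -> mu.-integrable A (EFin \o f) ->
  {ae mu, forall x, A x -> 0 <= f x} -> 0 <= \int[mu]_(x in A) f x.
Proof.
move=> mA intf f0.
have <- : \int[mu]_(x in A) `|f x| = \int[mu]_(x in A) f x.
  rewrite /Rintegral; congr fine; have mf := measurable_int mu intf.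
  apply: ae_eq_integral => //.
    by apply/measurable_EFinP; apply: measurableT_comp => //; exact/measurable_EFinP.
  by apply: filterS f0 => x fx Ax /=; rewrite ger0_norm// fx.
exact: Rintegral_ge0.
Qed.

Lemma ae_Rintegral_le A f g : measurable A -> mu.-integrable A (EFin \o f) ->
  mu.-integrable A (EFin \o g) ->
  {ae mu, forall x, A x -> f x <= g x} ->
  \int[mu]_(x in A) f x <= \int[mu]_(x in A) g x.
Proof.
move=> mA intf intg fg; rewrite -subr_ge0 -RintegralB//.
apply: ae_Rintegral_ge0 => //.
  by have := integrableB mA intg intf; exact: eq_integrable.
by apply: filterS fg => x H Ax; rewrite subr_ge0 H.
Qed.

Lemma integrable_Rsum A (I : Type) (r : seq I) (F : I -> V -> R) : measurable A ->
  (forall i, mu.-integrable A (EFin \o F i)) ->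
  mu.-integrable A (EFin \o (fun x => \sum_(i <- r) F i x)).
Proof.
move=> mA intF; elim: r => [|i r IH].
  have := integrable0 mu A; apply: eq_integrable => // x _ /=.
  by rewrite big_nil.
have := integrableD mA (intF i) IH; apply: eq_integrable => // x _ /=.
by rewrite big_cons.
Qed.

Lemma Rintegral_sum A (I : Type) (r : seq I) (F : I -> V -> R) : measurable A ->
  (forall i, mu.-integrable A (EFin \o F i)) ->
  \int[mu]_(x in A) (\sum_(i <- r) F i x) = \sum_(i <- r) \int[mu]_(x in A) F i x.
Proof.
move=> mA intF; elim: r => [|i r IH].
  rewrite big_nil (@eq_Rintegral _ _ _ _ A (cst 0)) => [|x _]; last by rewrite big_nil.
  by rewrite Rintegral_cst// mul0r.
rewrite big_cons -IH -RintegralD//; last exact: integrable_Rsum.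
by apply: eq_Rintegral => x _; rewrite big_cons.
Qed.

End integral_inequalities.

Section energy.
Opaque ip L2norm wpd h1sq.
Context {R : realType} {n : nat}.
Local Notation V := 'rV[R]_n.
Local Notation mu := (lebesgueRn R n).
Variables (aij : 'I_n -> 'I_n -> V -> R) (c0 : V -> R).
Implicit Types (f g v w y : V -> R) (A Om : set V).

(** The coefficient hypotheses with explicit constants, so that they pass to
    subdomains with the same constants. *)
Definition elliptic_on (M theta : R) A := [/\
  (forall i j, measurable_fun A (aij i j)) /\ measurable_fun A c0,
  (forall i j, {ae mu, forall x, A x -> `|aij i j x| <= M}) /\
    {ae mu, forall x, A x -> `|c0 x| <= M},
  {ae mu, forall x, A x -> 0 <= c0 x},
  forall i j, {ae mu, forall x, A x -> aij i j x = aij j i x} &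
  {ae mu, forall x, A x -> forall xi : V, theta * enorm xi ^+ 2 <=
      \sum_i \sum_j aij i j x * xi ord0 i * xi ord0 j}].

Lemma coefficients_elliptic_on Om : measurable Om -> coefficients aij c0 Om ->
  exists M theta : R, [/\ 0 <= M, 0 < theta &
    forall A, measurable A -> A `<=` Om -> elliptic_on M theta A].
Proof.
move=> mOm [[La Lc] c00 sym [theta theta0 ell]].
have [mc [Mc cM]] := Linfty_bounded mOm Lc.
have /boolp.choice[Ma HMa] : forall i, exists Mi : 'I_n -> R,
    forall j, {ae mu, forall x, Om x -> `|aij i j x| <= Mi j}.
  move=> i; have /boolp.choice[Mi Hi] : forall j, exists M,
    {ae mu, forall x, Om x -> `|aij i j x| <= M}.
    by move=> j; have [_] := Linfty_bounded mOm (La i j).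
  by exists Mi.
pose M := `|Mc| + \sum_i \sum_j `|Ma i j|.
have S0 : 0 <= \sum_i \sum_j `|Ma i j| by apply: sumr_ge0 => i _; exact: sumr_ge0.
have M0 : 0 <= M by rewrite addr_ge0.
have sub A (P : V -> Prop) : A `<=` Om -> {ae mu, forall x, Om x -> P x} ->
    {ae mu, forall x, A x -> P x}.
  by move=> AO; apply: filterS => x H /AO.
exists M, theta; split=> // A mA AO; split.
- split=> [i j|]; last exact: measurable_funS mc.
  by have [m _] := Linfty_bounded mOm (La i j); exact: measurable_funS m.
- split=> [i j|].
    apply: sub AO _; apply: filterS (HMa i j) => x H Ox.
    apply: (le_trans (H Ox)); apply: (le_trans (ler_norm _)).
    apply: (@le_trans _ _ (\sum_i \sum_j `|Ma i j|)); last by rewrite lerDr.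
    rewrite (bigD1 i)//= (bigD1 j)//= -addrA lerDl addr_ge0 ?sumr_ge0// => k _.
    exact: sumr_ge0.
  apply: sub AO _; apply: filterS cM => x H Ox.
  by apply: (le_trans (H Ox)); apply: (le_trans (ler_norm _)); rewrite lerDl.
- exact: sub AO c00.
- by move=> i j; exact: sub AO (sym i j).
- exact: sub AO ell.
Qed.

Section on_open.
Variables (A : set V) (oA : open A) (M theta : R).
Hypothesis ellA : elliptic_on M theta A.
Hypothesis M0 : 0 <= M.

Let mA : measurable A := open_measurable_row oA.

Local Notation Bf := (bilinear_form aij c0 A).

Let L2a i j f : L2 A f -> L2 A (fun x => aij i j x * f x).
Proof.
move=> Lf; have [[ma _] [ba _] _ _ _] := ellA.
exact: (L2_mul_ae_bounded mA (ma i j) (ba i j) Lf).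
Qed.

Let L2c f : L2 A f -> L2 A (fun x => c0 x * f x).
Proof.
move=> Lf; have [[_ mc] [_ bc] _ _ _] := ellA.
exact: (L2_mul_ae_bounded mA mc bc Lf).
Qed.

Let integrable_grad y v : H1 A y -> H1 A v -> forall i,
  mu.-integrable A (EFin \o (fun x => \sum_j aij i j x * wpd A i y x * wpd A j v x)).
Proof.
move=> Hy Hv i; apply: integrable_Rsum => // j.
by apply: (L2_integrable_mul mA (L2a _ _ _)); exact: wpd_L2.
Qed.

Let integrable_zero y v : H1 A y -> H1 A v ->
  mu.-integrable A (EFin \o (fun x => c0 x * y x * v x)).
Proof. by move=> /H1_L2 Ly /H1_L2 Lv; exact: (L2_integrable_mul mA (L2c Ly) Lv). Qed.

Lemma bilinear_formE y v : H1 A y -> H1 A v -> Bf y v =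
  \sum_i \sum_j ip A (fun x => aij i j x * wpd A i y x) (wpd A j v) +
  ip A (fun x => c0 x * y x) v.
Proof.
move=> Hy Hv; rewrite /bilinear_form RintegralD//.
- congr (_ + _); rewrite Rintegral_sum//; last exact: integrable_grad.
  apply: eq_bigr => i _; rewrite Rintegral_sum// => j.
  by apply: (L2_integrable_mul mA (L2a _ _ _)); exact: wpd_L2.
- by apply: integrable_Rsum => // i; exact: integrable_grad.
- exact: integrable_zero.
Qed.

Lemma bilinear_form_linr y v w t : H1 A y -> H1 A v -> H1 A w ->
  Bf y (fun x => v x + t * w x) = Bf y v + t * Bf y w.
Proof.
move=> Hy Hv Hw; have Hvw := H1_lin oA t Hv Hw.
rewrite !bilinear_formE// mulrDr addrACA; congr (_ + _).
  rewrite mulr_sumr -big_split/=; apply: eq_bigr => i _.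
  rewrite mulr_sumr -big_split/=; apply: eq_bigr => j _.
  by rewrite ip_wpd_lin//; apply: L2a; exact: wpd_L2.
have Ly := H1_L2 Hy; have Lv := H1_L2 Hv; have Lw := H1_L2 Hw.
have Lcy := L2c Ly; have Ltw := L2Z mA t Lw.
by rewrite ipC ipDl// ipZl// !(ipC _ (fun x => c0 x * y x)).
Qed.

Lemma bilinear_form_sym y v : H1 A y -> H1 A v -> Bf y v = Bf v y.
Proof.
move=> Hy Hv; rewrite (bilinear_formE Hy Hv) (bilinear_formE Hv Hy).
apply: (f_equal2 (fun a b : R => a + b)); last first.
  exact: ip_mulAC.
rewrite [RHS]exchange_big.
apply: eq_bigr => i _.
apply: eq_bigr => j _.
have [_ _ _ sym _] := ellA.
have L1 := wpd_L2 i Hy; have L2' := wpd_L2 j Hv.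
have ae1 : {ae mu, forall x, A x -> aij i j x * wpd A i y x = aij j i x * wpd A i y x}.
  by apply: filterS (sym i j) => x H Ax; rewrite H.
apply: (etrans (ae_eq_ipl mA (L2a i j L1) (L2a j i L1) L2' ae1)).
exact: ip_mulAC.
Qed.

Lemma bilinear_form_coercive v : H1 A v ->
  theta * \sum_i ip A (wpd A i v) (wpd A i v) <= Bf v v.
Proof.
move=> Hv; have [_ _ c00 _ ell] := ellA.
have int1 i : mu.-integrable A (EFin \o (fun x => wpd A i v x * wpd A i v x)).
  by have := wpd_L2 i Hv => L; exact: L2_integrable_mul.
have int2 := integrable_Rsum (index_enum _) mA int1.
have -> : theta * \sum_i ip A (wpd A i v) (wpd A i v) =
    \int[mu]_(x in A) (theta * \sum_i (wpd A i v x * wpd A i v x)).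
  by rewrite RintegralZl// Rintegral_sum.
apply: ae_Rintegral_le => //.
- by have := integrableZl mA theta int2; exact: eq_integrable.
- have := integrableD mA (integrable_Rsum (index_enum _) mA (integrable_grad Hv Hv))
    (integrable_zero Hv Hv); exact: eq_integrable.
apply: filterS2 c00 ell => x cx ex Ax.
have := ex Ax (\row_i wpd A i v x).
rewrite /enorm sqr_sqrtr; last by apply: sumr_ge0 => i _; rewrite -expr2 sqr_ge0.
rewrite /dot (eq_bigr (fun i => wpd A i v x * wpd A i v x)); last by move=> i _; rewrite mxE.
move=> /le_trans; apply.
rewrite (eq_bigr (fun i => \sum_j aij i j x * wpd A i v x * wpd A j v x)).
  by rewrite lerDl -mulrA mulr_ge0 ?cx// -expr2 sqr_ge0.
by move=> i _; apply: eq_bigr => j _; rewrite !mxE.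
Qed.

Let ip_mul_le (a f g : V -> R) : measurable_fun A a ->
  {ae mu, forall x, A x -> `|a x| <= M} -> L2 A f -> L2 A g ->
  ip A (fun x => a x * f x) g <= M * (ip A f f + ip A g g).
Proof.
move=> ma aM Lf Lg; have La := L2_mul_ae_bounded mA ma aM Lf.
have i1 := L2_integrable_mul mA Lf Lf; have i2 := L2_integrable_mul mA Lg Lg.
rewrite -!ip_fold -RintegralD// -RintegralZl//; last by have := integrableD mA i1 i2; exact: eq_integrable.
apply: ae_Rintegral_le => //.
- exact: L2_integrable_mul.
- by have := integrableZl mA M (integrableD mA i1 i2); exact: eq_integrable.
apply: filterS aM => x H Ax; have := H Ax; rewrite ler_norml => /andP[h1 h2].
have := sqr_ge0 (f x - g x); have := sqr_ge0 (f x + g x).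
move: (a x) (f x) (g x) h1 h2 => p q r h1 h2 s1 s2.
nra.
Qed.

(** Convergence in H1 implies convergence in energy, which the Riesz argument
    consumes. *)
Lemma bilinear_form_bounded v : H1 A v ->
  Bf v v <= 2 * (n * n).+1%:R * M * h1sq A v.
Proof.
move=> Hv; rewrite bilinear_formE//; have [[ma mc] [ba bc] _ _ _] := ellA.
have E : 2 * M * h1sq A v = M * (h1sq A v + h1sq A v) by move: (h1sq A v) => h; ring.
have h1 i j : ip A (fun x => aij i j x * wpd A i v x) (wpd A j v) <= 2 * M * h1sq A v.
  apply: (le_trans (ip_mul_le (ma i j) (ba i j) (wpd_L2 i Hv) (wpd_L2 j Hv))).
  by rewrite E ler_wpM2l// lerD// ip_wpd_le_h1sq.
have h2 : ip A (fun x => c0 x * v x) v <= 2 * M * h1sq A v.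
  apply: (le_trans (ip_mul_le mc bc (H1_L2 Hv) (H1_L2 Hv))).
  by rewrite E ler_wpM2l// lerD// ip_le_h1sq.
have -> : 2 * (n * n).+1%:R * M * h1sq A v =
    \sum_(i < n) \sum_(j < n) 2 * M * h1sq A v + 2 * M * h1sq A v.
  rewrite !sumr_const !card_ord -(natr1 (n * n)) natrM; move: (h1sq A v) => h.
  by rewrite -[X in _ = X + _]mulr_natr -[X in _ = X * _ + _]mulr_natr; ring.
by apply: lerD => //; apply: ler_sum => i _; apply: ler_sum => j _.
Qed.

Lemma bilinear_form_solution_lin f g y w v t : L2 A f -> L2 A g ->
  H1 A y -> H1 A w -> H1 A v -> Bf y v = ip A f v -> Bf w v = ip A g v ->
  Bf (fun x => y x + t * w x) v = ip A (fun x => f x + t * g x) v.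
Proof.
move=> Lf Lg Hy Hw Hv Ey Ew; have Hyw := H1_lin oA t Hy Hw.
rewrite (bilinear_form_sym Hyw Hv) (bilinear_form_linr t Hv Hy Hw).
rewrite (bilinear_form_sym Hv Hy) (bilinear_form_sym Hv Hw) Ey Ew.
have Lv := H1_L2 Hv.
by rewrite (ipDl mA Lf (L2Z mA t Lg) Lv) (ipZl mA t Lg Lv).
Qed.

(** Serves every subdomain of the cube of half-width k, hence all meshes at once. *)
Definition poincare_cst (k : nat) : R := (1 + (2 * k%:R) ^+ 2) / theta.

Lemma poincare_cst_ge0 k : 0 < theta -> 0 <= poincare_cst k.
Proof. by move=> theta0; rewrite divr_ge0 ?ltW// addr_ge0// sqr_ge0. Qed.

(** Coercivity controls all derivatives, and one of them controls the function
    itself by the Poincare inequality. *)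
Lemma energy_bound (i : 'I_n) k v : 0 < theta -> H1 A v ->
  L2norm A v <= 2 * k%:R * L2norm A (wpd A i v) ->
  h1sq A v <= poincare_cst k * Bf v v.
Proof.
move=> theta0 Hv h2; have h1 := bilinear_form_coercive Hv.
have h3 : ip A v v <= (2 * k%:R) ^+ 2 * \sum_j ip A (wpd A j v) (wpd A j v).
  apply: (@le_trans _ _ ((2 * k%:R) ^+ 2 * ip A (wpd A i v) (wpd A i v))).
    by rewrite -!L2norm_sqr -exprMn lerXn2r ?nnegrE ?mulr_ge0 ?L2norm_ge0.
  rewrite ler_wpM2l ?sqr_ge0// (bigD1 i)//= lerDl sumr_ge0// => j _.
  exact: ip_ge0.
rewrite h1sqE /poincare_cst mulrAC ler_pdivlMr//.
move: h1 h3; move: (bilinear_form _ _ _ _ _) (\sum_j _) (ip A v v) ((2 * k%:R) ^+ 2) (sqr_ge0 (2 * k%:R : R)).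
move=> b s p c c0' h1 h3.
have := ler_wpM2r (ltW theta0) h3; have := ler_wpM2l c0' h1; nra.
Qed.

(** Cauchy-Schwarz on the right-hand side, then division by the norm of y. *)
Lemma a_priori_bound f y (C : R) : 0 <= C -> L2 A f -> L2 A y ->
  h1sq A y <= C * ip A f y ->
  L2norm A y <= C * L2norm A f /\ h1sq A y <= (C * L2norm A f) ^+ 2.
Proof.
move=> C0 Lf Ly h1.
have h3 := le_trans h1 (ler_wpM2l C0 (le_trans (ler_norm _) (ip_normM mA Lf Ly))).
have h4 : L2norm A y <= C * L2norm A f.
  have [->|ny] := eqVneq (L2norm A y) 0; first by rewrite mulr_ge0 ?L2norm_ge0.
  have np : 0 < L2norm A y by rewrite lt_neqAle eq_sym ny L2norm_ge0.
  rewrite -(ler_pM2r np) -expr2 L2norm_sqr -mulrA.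
  exact: le_trans (ip_le_h1sq A y) h3.
split=> //; apply: (le_trans h3); rewrite mulrA expr2 ler_wpM2l//.
by rewrite mulr_ge0 ?L2norm_ge0.
Qed.

End on_open.

Section boundary_value_problem.
Variables (Om : set V) (oOm : open Om) (M theta : R) (i0 : 'I_n) (k : nat).
Hypothesis ellOm : elliptic_on M theta Om.
Hypothesis M0 : 0 <= M.
Hypothesis theta0 : 0 < theta.
Hypothesis Omk : Om `<=` cube k.

Let mOm : measurable Om := open_measurable_row oOm.

Local Notation P := (poincare_cst theta k).

Lemma H10_energy v : H10 Om v -> h1sq Om v <= P * bilinear_form aij c0 Om v v.
Proof.
move=> Hv; apply: (energy_bound oOm ellOm (i := i0)) => //; first exact: H10_H1.
exact: H10_poincare.
Qed.

Lemma test_function_zero : test_function Om (fun=> 0 : R).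
Proof.
have E s : foldr pd (fun=> 0 : R) s = (fun=> 0).
  elim: s => //= i s ->; apply/funext => x.
  exact: (derive_cst (0 : R)).
split; first by move=> s x; rewrite E; exact: differentiable_cst.
by exists set0; [exact: compact0|split => // x].
Qed.

Lemma weak_solution_exists f : L2 Om f -> exists y, weak_solution aij c0 Om f y.
Proof.
move=> Lf.
have H10_0 : H10 Om (fun=> 0) by apply: test_function_H10 => //; exact: test_function_zero.
have P0 := poincare_cst_ge0 k theta0.
have E1 (v w : V -> R) : (v - w)%R = (fun x => v x + -1 * w x).
  by apply/funext => x; rewrite mulN1r.
have [|||||||| y Hy Ey] := @riesz_representation R (V -> R) (H10 Om)
   (bilinear_form aij c0 Om) (fun v => ip Om f v) _ _ _ _ _ _ (ip Om f f * P).
- exact: H10_0.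
- by move=> v w t; exact: H10_lin.
- by move=> v w /H10_H1 Hv /H10_H1 Hw; exact: (bilinear_form_sym oOm ellOm).
- by move=> y v w t /H10_H1 Hy /H10_H1 Hv /H10_H1 Hw; exact: (bilinear_form_linr oOm ellOm).
- move=> v Hv; apply: le_trans (bilinear_form_coercive oOm ellOm (H10_H1 Hv)).
  by rewrite mulr_ge0 ?(ltW theta0)// sumr_ge0// => i _; exact: ip_ge0.
- move=> v w t /H10_H1/H1_L2 Lv /H10_H1/H1_L2 Lw.
  rewrite (ipC _ f (v + t *: w)) [LHS](ipDl mOm Lv (L2Z mOm t Lw) Lf).
  by rewrite (ipZl mOm t Lw Lf) !(ipC _ f).
- move=> v Hv; apply: (le_trans (ip_CS mOm Lf (H1_L2 (H10_H1 Hv)))).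
  rewrite -mulrA ler_wpM2l ?ip_ge0//.
  exact: le_trans (ip_le_h1sq Om v) (H10_energy Hv).
- move=> u Hu Cu.
  have [|v Hv cv] := H10_complete oOm Hu.
    move=> e e0; have e1 : 0 < e / (P + 1).
      by rewrite divr_gt0// ltr_wpDl.
    have [N HN] := Cu _ e1; exists N => j l Nj Nl.
    have := HN _ _ Nj Nl; rewrite E1 => h.
    have Hd := H10_lin oOm (-1) (Hu j) (Hu l).
    apply: (le_trans (H10_energy Hd)).
    apply: (@le_trans _ _ (P * (e / (P + 1)))).
      by rewrite ler_wpM2l.
    rewrite mulrCA -[leRHS]mulr1 ler_wpM2l ?(ltW e0)// ler_pdivrMr ?mul1r ?lerDl//.
    by rewrite ltr_wpDl.
  exists v => // e e0.
  pose c := 2 * (n * n).+1%:R * M.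
  have c0' : 0 <= c by rewrite !mulr_ge0.
  have e1 : 0 < e / (c + 1) by rewrite divr_gt0// ltr_wpDl.
  have [N HN] := cv _ e1; exists N => l Nl; rewrite E1.
  have Hd := H10_lin oOm (-1) (Hu l) Hv.
  apply: (le_trans (bilinear_form_bounded oOm ellOm M0 (H10_H1 Hd))).
  apply: (@le_trans _ _ (c * (e / (c + 1)))); first by rewrite ler_wpM2l ?HN.
  rewrite mulrCA -[leRHS]mulr1 ler_wpM2l ?(ltW e0)// ler_pdivrMr ?mul1r ?lerDl//.
  by rewrite ltr_wpDl.
by exists y; split.
Qed.

Lemma weak_solution_L2 f y : weak_solution aij c0 Om f y -> L2 Om y.
Proof. by move=> [/H10_H1/H1_L2]. Qed.

Lemma weak_solution_lin f g y w t : L2 Om f -> L2 Om g ->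
  weak_solution aij c0 Om f y -> weak_solution aij c0 Om g w ->
  weak_solution aij c0 Om (fun x => f x + t * g x) (fun x => y x + t * w x).
Proof.
move=> Lf Lg [Hy Ey] [Hw Ew]; split; first exact: H10_lin.
move=> v Hv; have [H1y H1w H1v] := And3 (H10_H1 Hy) (H10_H1 Hw) (H10_H1 Hv).
by apply: (bilinear_form_solution_lin oOm ellOm) => //; [exact: Ey|exact: Ew].
Qed.

Lemma weak_solution_bound f y : L2 Om f -> weak_solution aij c0 Om f y ->
  L2norm Om y <= P * L2norm Om f.
Proof.
move=> Lf [Hy Ey]; have Ly := H1_L2 (H10_H1 Hy).
have [] // := a_priori_bound oOm (poincare_cst_ge0 k theta0) Lf Ly.
by have := H10_energy Hy; rewrite (Ey _ Hy).
Qed.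

End boundary_value_problem.
End energy.

(** * Piecewise affine functions and barycentric coordinates *)

Section piecewise_lipschitz.
Context {R : realType}.

(** Follow the set containing the left end up to its last point. From there the other
    sets cover the rest; being closed, their union contains that point too, and there
    is one set less. *)
Lemma closed_cover_lipschitz (I : finType) (C : I -> set R) (g : R -> R) (L : R)
    (A : {set I}) (s t : R) :
  (forall j, closed (C j)) ->
  (forall j p q, j \in A -> C j p -> C j q -> p <= q -> `|g q - g p| <= L * (q - p)) ->
  s <= t -> (forall r, s <= r <= t -> exists2 j, j \in A & C j r) ->
  `|g t - g s| <= L * (t - s).
Proof.
move=> cC; have [m] := ubnP #|A|; elim: m => // m IH in A s *.
rewrite ltnS => Am lip st cov.
have [j jA Cs] := cov s ltac:(by rewrite lexx st).
pose S := [set r | s <= r <= t /\ C j r].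
have Ss : S s by split; rewrite ?lexx.
have uS : has_ubound S by exists t => r [/andP[]].
have cS : closed S.
  rewrite (_ : S = [set` `[s, t]%R] `&` C j); last by apply/seteqP; split => r /=; rewrite in_itv.
  by apply: closedI; [exact: interval_closed|exact: cC].
have [sr Cr] : S (sup S).
  by apply: cS; apply: closure_sup => //; exists s.
have [s1 r1] := andP sr.
move: r1; rewrite le_eqVlt => /predU1P[E|rt].
  by apply: (lip j) => //; rewrite -E.
have h1 : `|g (sup S) - g s| <= L * (sup S - s) by exact: (lip j).
have cov' r : sup S < r <= t -> exists2 k, k \in A :\ j & C k r.
  move=> /andP[r0 rt']; have [k kA Ck] := cov r ltac:(by rewrite rt' (le_trans s1)// ltW).
  exists k => //; rewrite !inE kA andbT; apply/eqP => kj.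
  have := r0; rewrite ltNge => /negP; apply; apply: ub_le_sup => //.
  by split; [rewrite rt' andbT (le_trans s1)// ltW|rewrite -kj].
have cU : closed (\bigcup_(k in [set` A :\ j]) C k).
  by apply: closed_bigcup => //; exact: finite_finset.
have Ur : (\bigcup_(k in [set` A :\ j]) C k) (sup S).
  apply: cU => B /nbhs_ballP[e /= e0 Be].
  pose r := Num.min t (sup S + e / 2).
  have e2 : 0 < e / 2 by rewrite divr_gt0.
  have r1 : sup S < r by rewrite lt_min rt ltrDl.
  have [k kA Ck] := cov' r ltac:(by rewrite r1 ge_min lexx).
  exists r; split; first by exists k.
  apply: Be; rewrite /ball/= distrC ger0_norm ?subr_ge0 ?ltW//.
  rewrite ltrBlDl (@le_lt_trans _ _ (sup S + e / 2))//; first by rewrite ge_min lexx orbT.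
  by rewrite ltrD2l ltr_pdivrMr// ltr_pMr// ltrDl.
have h2 : `|g t - g (sup S)| <= L * (t - sup S).
  apply: (IH (A :\ j)) => //.
  - by rewrite (cardsD1 j A) jA in Am.
  - by move=> k p q; rewrite !inE => /andP[_]; exact: lip.
  - exact: ltW.
  move=> r; rewrite le_eqVlt => /andP[/predU1P[<-|r0] rt'].
    by have [k kA Ck] := Ur; exists k.
  by apply: cov'; rewrite r0.
rewrite (_ : g t - g s = (g t - g (sup S)) + (g (sup S) - g s)); last by ring.
apply: (le_trans (ler_normD _ _)); apply: (le_trans (lerD h2 h1)).
by rewrite -mulrDr (_ : t - sup S + _ = t - s)//; ring.
Qed.

End piecewise_lipschitz.

Section affine.
Context {R : realType} {n : nat}.
Local Notation V := 'rV[R]_n.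
Implicit Types (w x y : V).

Lemma dotC x y : dot x y = dot y x.
Proof. by apply: eq_bigr => i _; rewrite mulrC. Qed.

Lemma dot_suml (I : Type) (r : seq I) (P : pred I) (c : I -> R) (w : I -> V) x :
  dot (\sum_(i <- r | P i) c i *: w i) x = \sum_(i <- r | P i) c i * dot (w i) x.
Proof.
elim/big_rec2 : _ => [|i a z _ <-].
  by rewrite /dot big1// => i _; rewrite mxE mul0r.
by rewrite dotC dotD dotZ !(dotC x).
Qed.

Lemma dot_sumr (I : Type) (r : seq I) (P : pred I) (c : I -> R) (v : I -> V) w :
  dot w (\sum_(i <- r | P i) c i *: v i) = \sum_(i <- r | P i) c i * dot w (v i).
Proof. by rewrite dotC dot_suml; apply: eq_bigr => i _; rewrite dotC. Qed.

Lemma dot_norm_le w x : `|dot w x| <= \sum_i `|w ord0 i| * `|x ord0 i|.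
Proof.
by apply: (le_trans (ler_norm_sum _ _ _)); apply: ler_sum => i _; rewrite normrM.
Qed.

Lemma continuous_affine w c : continuous (fun x => dot w x + c).
Proof. by move=> x; apply: (@continuousD _ _ _ (dot w) (cst c)); [exact: continuous_dot|exact: cst_continuous]. Qed.

Lemma continuous_line x (d : V) : continuous (fun t : R => x + t *: d).
Proof.
move=> t; apply: cvgD; first exact: cvg_cst.
by apply: cvgZl; exact: cvg_id.
Qed.

(** Along the segment from x to y the pieces are closed and on each of them the
    slope is that of an affine form, bounded by the sum of all slopes. *)
Lemma piecewise_affine_lipschitz (I : finType) (C : I -> set V) (w : I -> V)
    (c : I -> R) (f : V -> R) :
  (forall j, closed (C j)) -> (forall x, exists j, C j x) ->
  (forall j x, C j x -> f x = dot (w j) x + c j) ->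
  forall x y, `|f y - f x| <=
    \sum_i (\sum_j `|w j ord0 i|) * `|y ord0 i - x ord0 i|.
Proof.
move=> cC cov aff x y; set L := (X in _ <= X).
have /(_ _ _) := @closed_cover_lipschitz R I
  (fun j => (fun t : R => x + t *: (y - x)) @^-1` C j) (fun t => f (x + t *: (y - x)))
  L [set: I] 0 1.
rewrite scale1r scale0r addr0 subrKC subr0 mulr1; apply.
- by move=> j; apply: closed_comp (cC j) => t _; exact: continuous_line.
- move=> j p q _ Cp Cq pq /=; rewrite (aff _ _ Cp) (aff _ _ Cq) !dotD !dotZ.
  rewrite (_ : _ - _ = (q - p) * dot (w j) (y - x)); last by rewrite dotD dotN; ring.
  rewrite normrM ger0_norm ?subr_ge0// mulrC ler_wpM2r ?subr_ge0//.
  apply: (le_trans (dot_norm_le _ _)); apply: ler_sum => i _.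
  rewrite !mxE ler_wpM2r// (bigD1 j)//= lerDl; exact: sumr_ge0.
- by rewrite ler01.
by move=> r _; have [j Cj] := cov (x + r *: (y - x)); exists j; rewrite ?inE.
Qed.

End affine.

Lemma negligible_finite_union d (T : measurableType d) (R : realType)
    (m : {measure set T -> \bar R}) (I : finType) (F : I -> set T) :
  (forall i, m.-negligible (F i)) -> m.-negligible (\bigcup_i F i).
Proof.
move=> nF.
apply: (@negligibleS _ _ _ _ (\bigcup_k (if unpickle k is Some i then F i else set0))).
  by move=> x [i _ Fx]; exists (pickle i) => //; rewrite pickleK.
apply: negligible_bigcup => k; case: unpickle => [i|]; first exact: nF.
exact: negligible_set0.
Qed.

Section barycentric_coordinates.
Context {R : realType} {n : nat} (M : mesh R n).
Local Notation V := 'rV[R]_n.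
Local Notation I := 'I_(nvtx M).
Implicit Types (K L : {set I}) (x : V) (i j : I).

Definition barycentric_forms K (wc : (I -> V) * (I -> R)) :=
  (forall i j, i \in K -> j \in K -> dot (wc.1 i) (vtx M j) + wc.2 i = (i == j)%:R) /\
  forall x, \sum_(i in K) (dot (wc.1 i) x + wc.2 i) = 1 /\
    \sum_(i in K) (dot (wc.1 i) x + wc.2 i) *: vtx M i = x.

(** Affine independence of the n+1 vertices makes the square matrix with rows
    (v_i, 1) invertible; the columns of its inverse are the coefficients. *)
Lemma barycentric_forms_exist K : #|K| = n.+1 -> affinely_independent K ->
  exists wc, barycentric_forms K wc.
Proof.
move=> cK aK.
pose A : 'M[R]_(#|K|, n + 1) :=
  \matrix_(i < #|K|) row_mx (vtx M (enum_val i)) (const_mx 1 : 'rV_1).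
have Aval (t : 'rV[R]_#|K|) : t *m A =
    row_mx (\sum_i t ord0 i *: vtx M (enum_val i)) (const_mx (\sum_i t ord0 i)).
  rewrite mulmx_sum_row.
  rewrite (eq_bigr (fun i : 'I_#|K| => row_mx (t ord0 i *: vtx M (enum_val i)) (const_mx (t ord0 i)))); last first.
    move=> i _; rewrite rowK scale_row_mx; congr row_mx.
    by apply/matrixP => a b; rewrite !mxE mulr1.
  elim: (index_enum _) => [|i s IH].
    by rewrite !big_nil (_ : const_mx 0 = 0) ?row_mx0//.
  rewrite !big_cons IH add_row_mx; congr row_mx.
  by apply/matrixP => a b; rewrite !mxE.
have nK : (0 < #|K|)%N by rewrite cK.
have [k0 k0K] : exists k, k \in K by apply/set0Pn; rewrite -card_gt0.
pose rk := enum_rank_in k0K.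
have sumK (W : nmodType) (F : I -> W) :
    \sum_(j in K) F j = \sum_(i < #|K|) F (enum_val i) by rewrite big_enum_val.
have fA : row_free A.
  apply/inj_row_free => t; rewrite Aval -[RHS]row_mx0 => /eq_row_mx[h1 h2].
  have h3 : \sum_i t ord0 i = 0 by move/matrixP : h2 => /(_ ord0 ord0); rewrite !mxE.
  have E (i : 'I_#|K|) : t ord0 (rk (enum_val i)) = t ord0 i by rewrite /rk enum_valK_in.
  apply/rowP => i; rewrite mxE -E.
  apply: (aK (fun j => t ord0 (rk j))); last exact: enum_valP.
    by rewrite sumK -[RHS]h3; apply: eq_bigr => k _; rewrite E.
  by rewrite sumK -[RHS]h1; apply: eq_bigr => k _; rewrite E.
have /row_freeP[B AB] := fA.
have [B' BA'] : exists B', B' *m A = 1%:M.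
  by apply/row_fullP; rewrite /row_full (eqP fA) cK addn1.
have BA : B *m A = 1%:M.
  by rewrite -[B]mul1mx -BA' -(mulmxA B') AB mulmx1.
pose ext x : 'rV[R]_(n + 1) := row_mx x (const_mx 1 : 'rV_1).
exists (fun i => \row_k B (lshift 1 k) (rk i), fun i => B (rshift n ord0) (rk i)).
have E x i : dot (\row_k B (lshift 1 k) (rk i)) x + B (rshift n ord0) (rk i) =
    (ext x *m B) ord0 (rk i).
  rewrite mxE big_split_ord/= big_ord1 !row_mxEr mxE mul1r; congr (_ + _).
  by apply: eq_bigr => k _; rewrite row_mxEl mxE mulrC.
split=> [i j iK jK|x] /=.
  rewrite E (_ : ext _ = row (rk j) A); last by rewrite rowK /rk enum_rankK_in.
  rewrite -row_mul AB !mxE; congr (_%:R); congr nat_of_bool.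
  apply/eqP/eqP => [|->//] /enum_rank_in_inj.
  by move=> /(_ jK iK).
have := Aval (ext x *m B); rewrite -mulmxA BA mulmx1 => /eq_row_mx[h1 h2]; split.
  move/matrixP : h2 => /(_ ord0 ord0); rewrite !mxE => ->.
  by rewrite sumK; apply: eq_bigr => i _; rewrite E /rk enum_valK_in.
rewrite [RHS]h1 sumK; apply: eq_bigr => i _.
by rewrite E /rk enum_valK_in.
Qed.

Definition affine_forms K : (I -> V) * (I -> R) :=
  xget (fun=> 0, fun=> 0) (barycentric_forms K).

Definition lam K i x : R := dot ((affine_forms K).1 i) x + (affine_forms K).2 i.

Lemma continuous_lam K i : continuous (lam K i).
Proof. exact: continuous_affine. Qed.

Section cell.
Variable K : {set I}.
Hypotheses (cK : #|K| = n.+1) (aK : affinely_independent K).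

Let affine_formsP : barycentric_forms K (affine_forms K).
Proof. by have [wc H] := barycentric_forms_exist cK aK; exact: (xgetPex _ (ex_intro _ _ H)). Qed.

Lemma lam_vtx i j : i \in K -> j \in K -> lam K i (vtx M j) = (i == j)%:R.
Proof. by have [H _] := affine_formsP; exact: H. Qed.

Lemma lam_sum x : \sum_(i in K) lam K i x = 1.
Proof. by have [_ /(_ x)[]] := affine_formsP. Qed.

Lemma lam_repr x : \sum_(i in K) lam K i x *: vtx M i = x.
Proof. by have [_ /(_ x)[]] := affine_formsP. Qed.

(** Affine functions commute with affine combinations. *)
Lemma lam_combination (t : I -> R) i : i \in K -> \sum_(j in K) t j = 1 ->
  lam K i (\sum_(j in K) t j *: vtx M j) = t i.
Proof.
move=> iK t1; rewrite /lam dot_sumr -[X in _ + X]mul1r -t1 mulr_suml -big_split/=.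
rewrite (eq_bigr (fun j => t j * (i == j)%:R)) => [|j jK]; last by rewrite -lam_vtx//; rewrite -mulrDr.
by rewrite (bigD1 i)//= eqxx mulr1 big1 ?addr0// => j /andP[_ ji]; rewrite eq_sym (negPf ji) mulr0.
Qed.

Lemma simplexP x : simplex K x <-> forall i, i \in K -> 0 <= lam K i x.
Proof.
split=> [[t [t0 t1] <-] i iK|H]; first by rewrite lam_combination.
exists (fun i => if i \in K then lam K i x else 0).
  split=> [i|]; first by case: ifP => // /H.
  by rewrite -[RHS](lam_sum x); apply: eq_bigr => i ->.
by rewrite -[RHS](lam_repr x); apply: eq_bigr => i ->.
Qed.

Lemma closed_simplex : closed (simplex K).
Proof.
rewrite (_ : simplex K = \bigcap_(i in [set` K]) (lam K i @^-1` [set r | 0 <= r])).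
  apply: closed_bigI => i _; apply: closed_comp (@closed_ge _ 0).
  by move=> x _; exact: continuous_lam.
by apply/seteqP; split => x; rewrite simplexP.
Qed.

Definition open_cell : set V := [set x | forall i, i \in K -> 0 < lam K i x].

Lemma open_open_cell : open open_cell.
Proof.
rewrite -[open_cell]setCK; apply: closed_openC.
rewrite (_ : ~` open_cell = \bigcup_(i in [set` K]) (lam K i @^-1` [set r | r <= 0])).
  apply: closed_bigcup => [|i _]; first exact: finite_finset.
  by apply: closed_comp (@closed_le _ 0) => x _; exact: continuous_lam.
apply/seteqP; split => x /=.
  move=> /existsNP[i /not_implyP[iK /negP]]; rewrite -leNgt => h.
  by exists i.
by move=> [i iK h] /(_ i iK); rewrite ltNge h.
Qed.

Lemma open_cell_simplex : open_cell `<=` simplex K.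
Proof. by move=> x H; apply/simplexP => i iK; exact/ltW/H. Qed.

Lemma affine_form_neq0 i : (0 < n)%N -> i \in K -> (affine_forms K).1 i != 0.
Proof.
move=> n0 iK; have [j] : exists j, j \in K :\ i.
  apply/set0Pn; rewrite -card_gt0.
  have := cardsD1 i K; rewrite cK (iK : (i \in K) = true) add1n => -[<-].
  exact: n0.
rewrite !inE => /andP[ji jK]; apply/eqP => w0.
have := lam_vtx iK iK; have := lam_vtx iK jK.
rewrite /lam w0 /dot !big1 ?add0r => [->||]; try by move=> k _; rewrite mxE mul0r.
by rewrite eqxx eq_sym (negPf ji) => /esym/eqP; rewrite oner_eq0.
Qed.

(** The boundary lies in finitely many hyperplanes, the zero sets of the
    barycentric coordinates. *)
Lemma simplex_boundary_null : (0 < n)%N ->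
  (lebesgueRn R n).-negligible (simplex K `\` open_cell).
Proof.
move=> n0.
have h : (lebesgueRn R n).-negligible
    (\bigcup_(i in [set: I]) [set x | i \in K /\ lam K i x = 0]); last first.
  apply: negligibleS h => x [/simplexP xK /existsNP[i /not_implyP[iK /negP]]].
  by rewrite -leNgt => h; exists i => //=; split => //; apply/eqP; rewrite eq_le h xK.
apply: negligible_finite_union => i; have [iK|iK] := boolP (i \in K); last first.
  by apply: negligibleS (negligible_set0 _) => x [].
rewrite (_ : [set x | _] = [set x | dot ((affine_forms K).1 i) x = - (affine_forms K).2 i]).
  apply/negligibleP; last by apply: hyperplane_null; exact: affine_form_neq0.
  apply: closed_measurable_row; apply: closed_comp (@closed_eq _ _); move=> x _; exact: continuous_dot.
apply/seteqP; split => x /=; rewrite /lam.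
  by move=> [_ /eqP]; rewrite addr_eq0 => /eqP.
by move=> ->; rewrite addNr; split.
Qed.

(** Sliding towards the barycentre makes all coordinates positive. *)
Lemma simplex_closure_open_cell : simplex K `<=` closure open_cell.
Proof.
move=> x /simplexP xK.
pose m := \sum_(i in K) n.+1%:R^-1 *: vtx M i.
have s1 : \sum_(i in K) (n.+1%:R^-1 : R) = 1.
  by rewrite sumr_const cK -[_ *+ _]mulr_natr mulVf// pnatr_eq0.
have lm i : i \in K -> lam K i m = n.+1%:R^-1 by move=> iK; rewrite lam_combination.
move=> B; have cl := @continuous_line R n x (m - x) 0.
rewrite -{1}[x]addr0 -(scale0r (m - x)) => /cl /nbhs_ballP[e /= e0 Be].
pose s := Num.min 1 (e / 2).
have e2 : 0 < e / 2 by rewrite divr_gt0.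
have s0 : 0 < s by rewrite lt_min ltr01.
have sle : s <= 1 by rewrite ge_min lexx.
exists (x + s *: (m - x)); split.
  move=> i iK; rewrite /lam dotD dotZ dotD dotN.
  have := lm i iK; have := xK i iK; rewrite /lam.
  move: (dot _ x) (dot _ m) ((affine_forms K).2 i) => p q r h1 h2.
  have h3 : 0 < n.+1%:R^-1 :> R by [].
  move: (n.+1%:R^-1) h2 h3 => d h2 h3; nra.
apply: Be; rewrite /ball/= sub0r normrN gtr0_norm//.
by rewrite gt_min ltr_pdivrMr// ltr_pMr// ltr1n orbT.
Qed.

End cell.
End barycentric_coordinates.

(** * Conforming meshes *)

Section mesh_domain.
Context {R : realType} {n : nat}.
Local Notation V := 'rV[R]_n.
Local Notation mu := (lebesgueRn R n).
Variables (Om : set V) (M : mesh R n).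
Hypothesis n0 : (0 < n)%N.
Hypothesis tri : triangulation M.
Local Notation I := 'I_(nvtx M).
Local Notation N := (closed_mesh_domain M).
Local Notation D := (mesh_domain M).
Implicit Types (K L : {set I}) (x : V) (i j : I) (c : I -> R) (f v : V -> R).

Let cK K : K \in cells M -> #|K| = n.+1.
Proof. by have [H _ _] := tri => /H[]. Qed.

Let aK K : K \in cells M -> affinely_independent K.
Proof. by have [H _ _] := tri => /H[]. Qed.

Lemma simplex_mesh K x : K \in cells M -> simplex K x -> N x.
Proof. by exists K. Qed.

Lemma open_mesh_domain : open D.
Proof. exact: open_interior. Qed.

Lemma mesh_domain_closed_mesh x : D x -> N x.
Proof. exact: interior_subset. Qed.

Lemma closed_mesh : closed N.
Proof.
rewrite (_ : N = \bigcup_(K in [set` cells M]) simplex K); last first.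
  by apply/seteqP; split => x [K KM xK]; exists K.
apply: closed_bigcup => [|K KM]; first exact: finite_finset.
by apply: closed_simplex; [exact: cK|exact: aK].
Qed.

Lemma open_cell_mesh_domain K x : K \in cells M -> open_cell K x -> D x.
Proof.
move=> KM; have := @open_subsetE _ (open_cell K) N (@open_open_cell _ _ _ K).
move=> H; move: x; apply/(_ : _ `<=` _); rewrite -H => x /open_cell_simplex xK.
by exists K => //; apply: xK; [exact: cK|exact: aK].
Qed.

Lemma closed_mesh_closure x : N x -> closure D x.
Proof.
move=> [K KM xK]; have := simplex_closure_open_cell (cK KM) (aK KM) xK.
by apply: closure_subset => y; exact: open_cell_mesh_domain.
Qed.

Lemma simplex_vtx K i : i \in K -> simplex K (vtx M i).
Proof.
move=> iK; exists (fun j => (i == j)%:R).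
  split=> [j|]; first exact: ler0n.
  by rewrite (bigD1 i)//= eqxx big1 ?addr0// => j /andP[_ ji]; rewrite eq_sym (negPf ji).
rewrite (bigD1 i)//= eqxx scale1r big1 ?addr0// => j /andP[_ ji].
by rewrite eq_sym (negPf ji) scale0r.
Qed.

Lemma vtx_closed_mesh i : N (vtx M i).
Proof. by have [_ _ /(_ i)[K KM iK]] := tri; exists K => //; exact: simplex_vtx. Qed.

(** A common point lies in the face spanned by the common vertices, and its
    coordinates with respect to either cell are unique. *)
Lemma lam_conforming K L x i : K \in cells M -> L \in cells M ->
  simplex K x -> simplex L x -> i \in K ->
  lam K i x = if i \in L then lam L i x else 0.
Proof.
move=> KM LM xK xL iK; have [_ conf _] := tri.
have [t [t0 t1] tx] : simplex (K :&: L) x by rewrite -conf.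
pose s (j : I) := if j \in K :&: L then t j else 0.
have sout (j : I) : j \notin K :&: L -> s j = 0 by rewrite /s; case: ifP.
have sumA (W : nmodType) (F : I -> W) (A : {set I}) : K :&: L \subset A ->
    (forall j, j \notin K :&: L -> F j = 0) ->
    \sum_(j in A) F j = \sum_(j in K :&: L) F j.
  move=> KLA F0; rewrite (big_setID (K :&: L))/= (finset.setIidPr KLA) [X in _ + X]big1 ?addr0//.
  by move=> j; rewrite finset.in_setD => /andP[/F0].
have h (A : {set I}) : A \in cells M -> K :&: L \subset A -> forall j, j \in A -> lam A j x = s j.
  move=> AM KLA j jA; rewrite -(lam_combination (cK AM) (aK AM) jA (t := s)).
    congr (lam _ _ _); rewrite -tx (sumA _ _ A)//; last by move=> k /sout ->; rewrite scale0r.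
    by apply: eq_bigr => k; rewrite /s => ->.
  by rewrite sumA// -t1; apply: eq_bigr => k; rewrite /s => ->.
rewrite (h _ KM (subsetIl _ _) _ iK); case: ifPn => iL.
  by rewrite (h _ LM (subsetIr _ _) _ iL).
by rewrite /s inE (negPf iL) andbF.
Qed.

Lemma open_cell_disjoint K L x : K \in cells M -> L \in cells M ->
  open_cell K x -> open_cell L x -> K = L.
Proof.
move=> KM LM xK xL.
have sub (A B : {set I}) : A \in cells M -> B \in cells M -> open_cell A x -> open_cell B x -> A \subset B.
  move=> AM BM xA xB; apply/fintype.subsetP => i iA; apply/negPn/negP => iB.
  have := xA i iA; rewrite (lam_conforming AM BM _ _ iA) ?(negPf iB) ?ltxx//.
    by apply: open_cell_simplex => //; [exact: cK|exact: aK].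
  by apply: open_cell_simplex => //; [exact: cK|exact: aK].
by apply/eqP; rewrite finset.eqEsubset !sub.
Qed.

(** The choice of the cell is immaterial by [lam_conforming]; points off the mesh
    get the value 0. *)
Definition bary i x : R :=
  if [pick K in cells M | `[< simplex K x >]] is Some K then
    if i \in K then lam K i x else 0 else 0.

Lemma baryE K i x : K \in cells M -> simplex K x ->
  bary i x = if i \in K then lam K i x else 0.
Proof.
move=> KM xK; rewrite /bary; case: pickP => [L /andP[LM /asboolP xL]|/(_ K)]; last first.
  by rewrite KM/= => /asboolPn.
case: ifPn => iL; last case: ifPn => iK //.
  by rewrite (lam_conforming LM KM).
by rewrite (lam_conforming KM LM)// (negPf iL).
Qed.

Lemma bary_sumE K x (F : I -> R) : K \in cells M -> simplex K x ->
  \sum_i bary i x * F i = \sum_(i in K) lam K i x * F i.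
Proof.
move=> KM xK; rewrite [RHS]big_mkcond/=; apply: eq_bigr => i _.
by rewrite (baryE _ KM xK); case: ifP => // _; rewrite mul0r.
Qed.

Lemma bary_ge0 i x : 0 <= bary i x.
Proof.
rewrite /bary; case: pickP => // K /andP[KM /asboolP xK]; case: ifP => // iK.
by have /(_ i iK) := (simplexP (cK KM) (aK KM) x).1 xK.
Qed.

Lemma bary_sum x : N x -> \sum_i bary i x = 1.
Proof.
move=> [K KM xK]; rewrite -(lam_sum (cK KM) (aK KM) x).
have := bary_sumE (fun=> 1) KM xK.
rewrite (eq_bigr (bary^~ x)) => [->|i _]; last by rewrite mulr1.
by apply: eq_bigr => i _; rewrite mulr1.
Qed.

Lemma bary_vtx i j : bary i (vtx M j) = (i == j)%:R.
Proof.
have [_ _ /(_ j)[K KM jK]] := tri; rewrite (baryE _ KM (simplex_vtx jK)).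
by case: ifPn => iK; [rewrite lam_vtx//; [exact: cK|exact: aK]|case: eqVneq iK => // ->; rewrite jK].
Qed.

Definition cell_grad K c : V := \sum_(i in K) c i *: (affine_forms K).1 i.
Definition cell_const K c : R := \sum_(i in K) c i * (affine_forms K).2 i.

Lemma cell_affineE K c x : K \in cells M -> simplex K x ->
  \sum_i bary i x * c i = dot (cell_grad K c) x + cell_const K c.
Proof.
move=> KM xK; rewrite (bary_sumE _ KM xK) dot_suml -big_split/=.
by apply: eq_bigr => i _; rewrite /lam mulrC mulrDr.
Qed.

Section domain.
Hypothesis DOm : D `<=` Om.
Hypothesis oOm : open Om.
Hypothesis cOm : forall x y (t : R), Om x -> Om y -> 0 <= t <= 1 -> Om (t *: x + (1 - t) *: y).
Hypothesis cvxN : D = Om \/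
  forall x y (t : R), N x -> N y -> 0 <= t <= 1 -> N (t *: x + (1 - t) *: y).

Lemma closed_mesh_closure_domain x : N x -> closure Om x.
Proof. by move=> /closed_mesh_closure; exact: closure_subset. Qed.

Lemma nbhs_affine_image (z p : V) (s : R) (A : set V) : s != 0 ->
  nbhs z A -> nbhs (s *: z + p) [set y | A (s^-1 *: (y - p))].
Proof.
move=> s0 zA.
have cf : continuous (fun y : V => s^-1 *: (y - p)).
  move=> y; apply: (@continuousZl_tmp _ _ _ (fun y : V => y - p)).
  by apply: continuousB => //; exact: cst_continuous.
have := cf (s *: z + p) A; apply.
by rewrite addrK scalerA mulVf// scale1r.
Qed.

(** If the closed mesh is convex, a ball around v contracts to a ball around the given
    point. If the mesh fills Om, x is approximated from within the open convex set Om
    and v is moved accordingly. *)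
Lemma mesh_star (v x : V) (s : R) : D v -> N x -> 0 < s -> s <= 1 ->
  D (s *: v + (1 - s) *: x).
Proof.
move=> Dv Nx s0 s1; have sn0 : s != 0 by rewrite gt_eqF.
have [DE|cN] := cvxN; last first.
  have := @nbhs_affine_image v ((1 - s) *: x) s N sn0 Dv.
  rewrite /mesh_domain /interior/=; apply: filterS => y /= Ny.
  have := cN _ _ s Ny Nx; rewrite scalerA mulfV// scale1r subrK.
  by apply; rewrite (ltW s0).
rewrite DE; have [->|s1'] := eqVneq s 1.
  by rewrite subrr scale0r addr0 scale1r -DE.
have t0 : 1 - s != 0 by rewrite subr_eq0 eq_sym.
have tp : 0 < 1 - s by rewrite lt_neqAle eq_sym t0 subr_ge0.
set z := _ + _.
have Ov : Om v by rewrite -DE.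
have := closed_mesh_closure_domain Nx.
have h : nbhs x [set x' | Om (s^-1 *: (z - (1 - s) *: x'))].
  have cf : continuous (fun x' : V => s^-1 *: (z - (1 - s) *: x')).
    move=> y; apply: (@continuousZl_tmp _ _ _ (fun y : V => z - (1 - s) *: y)).
    apply: continuousB; first exact: cst_continuous.
    by apply: (@continuousZl_tmp _ _ _ id).
  have := cf x Om; apply; rewrite /z addrK scalerA mulVf// scale1r.
  exact: open_nbhs_nbhs.
move=> /(_ _ h)[x' [Ox' /= Ow]].
have := cOm Ow Ox' (t := s); rewrite scalerA mulfV// scale1r subrK.
by apply; rewrite (ltW s0).
Qed.

(** A point with a positive coordinate at an interior vertex is a proper convex
    combination of that vertex and a point of the opposite face. *)
Lemma bary_boundary i x : N x -> ~ D x -> D (vtx M i) -> bary i x = 0.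
Proof.
move=> Nx nDx Dv; have [K KM xK] := Nx; rewrite (baryE _ KM xK).
case: ifPn => // iK; apply/eqP/negPn/negP => s0; apply: nDx.
have xK' := (simplexP (cK KM) (aK KM) x).1 xK.
have sp : 0 < lam K i x by rewrite lt_neqAle eq_sym s0 xK'.
have s1 : lam K i x <= 1.
  rewrite -(lam_sum (cK KM) (aK KM) x) (bigD1 i)//= lerDl sumr_ge0// => j /andP[jK _].
  exact: xK'.
move: (sp) (s1); set s := lam K i x => sp' s1'.
have [E|ns1] := eqVneq s 1.
  suff -> : x = vtx M i by [].
  rewrite -[LHS](lam_repr (cK KM) (aK KM)) (bigD1 i)//= -/s E scale1r big1 ?addr0//.
  move=> j /andP[jK ji]; suff -> : lam K j x = 0 by rewrite scale0r.
  apply/eqP; rewrite eq_le xK'// andbT.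
  have := lam_sum (cK KM) (aK KM) x; rewrite (bigD1 i)//= -/s E (bigD1 j) ?jK//=.
  have h : 0 <= \sum_(k < nvtx M | (k \in K) && (k != i) && (k != j)) lam K k x.
    by apply: sumr_ge0 => k /andP[/andP[kK _] _]; exact: xK'.
  move: h; move: (\sum_(_ < _ | _) _) => q; lra.
have t0 : 1 - s != 0 by rewrite subr_eq0 eq_sym.
have tp : 0 < 1 - s by rewrite lt_neqAle eq_sym t0 subr_ge0.
(* the point where the ray from the vertex through x meets the opposite face *)
pose x' := vtx M i + (1 - s)^-1 *: (x - vtx M i).
have Nx' : N x'.
  exists K => //; apply/(simplexP (cK KM) (aK KM)) => j jK.
  have E : lam K j x' = (j == i)%:R + (1 - s)^-1 * (lam K j x - (j == i)%:R).
    rewrite -(lam_vtx (cK KM) (aK KM) jK iK) /lam /x' dotD dotZ dotD dotN; ring.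
  rewrite E; have [->|ji] := eqVneq j i; last by rewrite add0r subr0 mulr_ge0 ?xK'// invr_ge0 ltW.
  by rewrite -/s -(opprB 1 s) (mulrN _ (1 - s)) mulVf// subrr.
have -> : x = s *: vtx M i + (1 - s) *: x'.
  rewrite /x' scalerDr scalerA mulfV// scale1r addrA -scalerDl subrKC scale1r.
  by rewrite subrKC.
exact: mesh_star.
Qed.

End domain.
End mesh_domain.

(** * Finite element functions as Sobolev functions *)

Section restriction.
Context {R : realType} {n : nat}.
Local Notation V := 'rV[R]_n.
Local Notation mu := (lebesgueRn R n).
Implicit Types (A : set V) (f g v y : V -> R).

Lemma is_weak_pd_eq_on A i v v' g : (forall x, A x -> v x = v' x) ->
  is_weak_pd A i v g -> is_weak_pd A i v' g.
Proof.
move=> vv' H phi tphi; rewrite -H//; apply: eq_Rintegral => x /set_mem Ax.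
by rewrite vv'.
Qed.

(** The values of v off A do not enter the class from which [wpd] chooses. *)
Lemma wpd_eq_on A i v v' : (forall x, A x -> v x = v' x) -> wpd A i v = wpd A i v'.
Proof.
move=> vv'; rewrite /wpd; congr (xget _ _); apply/seteqP; split=> g [Lg Hg]; split=> //.
  exact: is_weak_pd_eq_on vv' Hg.
by apply: is_weak_pd_eq_on Hg => x Ax; rewrite vv'.
Qed.

Lemma L2_eq_on A f g : (forall x, A x -> f x = g x) -> L2 A f -> L2 A g.
Proof.
move=> fg; rewrite /L2 (_ : g \_ A = f \_ A)//.
by apply/funext => x; rewrite !patchE; case: ifPn => // /set_mem /fg.
Qed.

Lemma L2norm_eq_on A f g : (forall x, A x -> f x = g x) -> L2norm A f = L2norm A g.
Proof.
move=> fg; rewrite /L2norm (_ : f \_ A = g \_ A)//.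
by apply/funext => x; rewrite !patchE; case: ifPn => // /set_mem /fg.
Qed.

Lemma ip_eq_on A f f' g g' : (forall x, A x -> f x = f' x) ->
  (forall x, A x -> g x = g' x) -> ip A f g = ip A f' g'.
Proof.
by move=> ff' gg'; apply: eq_Rintegral => x /set_mem Ax; rewrite ff'// gg'.
Qed.

Lemma H1_eq_on A v v' : (forall x, A x -> v x = v' x) -> H1 A v -> H1 A v'.
Proof.
move=> vv' [Lv Hv]; split; first exact: L2_eq_on Lv.
by move=> i; have [g Lg Hg] := Hv i; exists g => //; exact: is_weak_pd_eq_on Hg.
Qed.

Lemma bilinear_form_eq_on (aij : 'I_n -> 'I_n -> V -> R) (c0 : V -> R) A y y' v v' :
  (forall x, A x -> y x = y' x) -> (forall x, A x -> v x = v' x) ->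
  bilinear_form aij c0 A y v = bilinear_form aij c0 A y' v'.
Proof.
move=> yy' vv'; apply: eq_Rintegral => x /set_mem Ax; rewrite yy'// vv'//.
congr (_ + _); apply: eq_bigr => i _; apply: eq_bigr => j _.
by rewrite (wpd_eq_on i yy') (wpd_eq_on j vv').
Qed.

Lemma Rintegral_out A B f : measurable A -> measurable B -> A `<=` B ->
  (forall x, B x -> ~ A x -> f x = 0) ->
  \int[mu]_(x in B) f x = \int[mu]_(x in A) f x.
Proof.
move=> mA mB AB f0; rewrite Rintegral_mkcond [RHS]Rintegral_mkcond.
apply: eq_Rintegral => x _; rewrite !patchE.
case: ifPn => [xB|]; case: ifPn => //.
  by move=> /negP xA; apply: f0 => [|Ax]; [exact: set_mem|apply: xA; exact: mem_set].
by move=> /set_mem/AB Bx /negP; case; exact: mem_set.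
Qed.

Lemma affine_diff_quot f (w : V) (c : R) i (x : V) (U : set V) : nbhs x U ->
  (forall z : V, U z -> f z = dot w z + c) ->
  diff_quot f i ^~ x @ \oo --> w ord0 i.
Proof.
move=> xU fU.
have cl := @continuous_line R n x (delta_mx ord0 i) 0.
have : \forall j \near \oo, U (x + (j.+1%:R^-1 : R) *: delta_mx ord0 i).
  apply: (@cvg_harmonic R [set t : R | U (x + t *: delta_mx ord0 i)]).
  by apply: cl; rewrite scale0r addr0.
move=> H; apply: cvg_trans (@cvg_cst _ (w ord0 i) _ \oo _).
apply: near_eq_cvg; near=> j.
have Uj : U (x + (j.+1%:R^-1 : R) *: delta_mx ord0 i) by near: j; exact: H.
rewrite /diff_quot (fU _ Uj) (fU _ (nbhs_singleton xU)) dotD dotZ dot_delta.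
rewrite (_ : _ - _ = j.+1%:R^-1 * w ord0 i); last by ring.
by rewrite mulrA mulfV ?mul1r.
Unshelve. all: by end_near.
Qed.

End restriction.

(** The facts about a mesh and its domain that the analysis rests on. A polyhedral
    domain is filled by the mesh, for a C11 boundary the closed mesh is convex;
    [em_star] is the alternative. *)
Record embedded_mesh (R : realType) (n : nat) (Om : set 'rV[R]_n) (M : mesh R n)
    (k : nat) : Prop := EmbeddedMesh {
  em_dim : (0 < n)%N;
  em_open : open Om;
  em_convex : forall (x y : 'rV[R]_n) (t : R), Om x -> Om y -> 0 <= t <= 1 ->
    Om (t *: x + (1 - t) *: y);
  em_cube : Om `<=` cube k;
  em_tri : triangulation M;
  em_sub : mesh_domain M `<=` Om;
  em_star : mesh_domain M = Om \/ forall (x y : 'rV[R]_n) (t : R),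
    closed_mesh_domain M x -> closed_mesh_domain M y -> 0 <= t <= 1 ->
    closed_mesh_domain M (t *: x + (1 - t) *: y) }.

Section finite_element_functions.
Context {R : realType} {n : nat}.
Local Notation V := 'rV[R]_n.
Local Notation mu := (lebesgueRn R n).
Variables (Om : set V) (M : mesh R n) (k : nat).
Hypothesis em : embedded_mesh Om M k.
Local Notation I := 'I_(nvtx M).
Local Notation N := (closed_mesh_domain M).
Local Notation D := (mesh_domain M).
Implicit Types (K L : {set I}) (x : V) (j : I) (c : I -> R) (f v : V -> R).

Let tri := em_tri em.
Let oD : open D := @open_mesh_domain R n M.
Let mD : measurable D := open_measurable_row oD.

(** Extending by zero off the mesh domain makes interpolants Lipschitz on the whole
    space, so that difference quotients apply to them. *)
Definition nodal_extension f c := (forall x, ~ D x -> f x = 0) /\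
  forall x, N x -> f x = \sum_i bary i x * c i.

Lemma nodal_extension_vtx f c j : nodal_extension f c -> f (vtx M j) = c j.
Proof.
move=> [_ H]; rewrite H; last exact: vtx_closed_mesh.
rewrite (bigD1 j)//= bary_vtx// eqxx mul1r big1 ?addr0// => i ij.
by rewrite bary_vtx// (negPf ij) mul0r.
Qed.

Definition interp c : V -> R := (fun x => \sum_i bary i x * c i) \_ D.

Lemma interpP c : (forall i, ~ D (vtx M i) -> c i = 0) -> nodal_extension (interp c) c.
Proof.
move=> c0; split=> x.
  by move=> nDx; rewrite /interp patchE ifN//; apply/negP => /set_mem.
move=> Nx; rewrite /interp patchE; case: ifPn => // /negP nDx.
rewrite big1// => i _; have [Dv|nDv] := pselect (D (vtx M i)); last by rewrite c0// mulr0.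
rewrite (bary_boundary tri (em_sub em) (em_open em) (em_convex em) (em_star em))// ?mul0r//.
by move=> Dx; apply: nDx; exact: mem_set.
Qed.

Definition cell_slope c i : R := \sum_(K in cells M) `|cell_grad K c ord0 i|.

(** The cells and the complement of the mesh domain are closed, cover the space,
    and carry affine functions. *)
Lemma nodal_extension_lipschitz f c x y : nodal_extension f c ->
  `|f y - f x| <= \sum_i cell_slope c i * `|y ord0 i - x ord0 i|.
Proof.
move=> [f0 fN].
(* the empty set is not a cell, so its index stands for the complement *)
pose C K : set V := if K \in cells M then simplex K else ~` D.
pose w K : V := if K \in cells M then cell_grad K c else 0.
pose b K : R := if K \in cells M then cell_const K c else 0.
have [cells_ok _ _] := tri.
have s0 : finset.set0 \notin cells M.
  by apply/negP => /cells_ok[]; rewrite cards0.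
have -> : \sum_i cell_slope c i * `|y ord0 i - x ord0 i| =
    \sum_i (\sum_K `|w K ord0 i|) * `|y ord0 i - x ord0 i|.
  apply: eq_bigr => i _; congr (_ * _); rewrite /cell_slope big_mkcond/=.
  by apply: eq_bigr => K _; rewrite /w; case: ifP => //; rewrite mxE normr0.
apply: (@piecewise_affine_lipschitz R n {set I} C w b f).
- move=> K; rewrite /C; case: ifPn => KM; last exact: open_closedC.
  by have [cK aK] := cells_ok _ KM; exact: closed_simplex.
- move=> z; have [/mesh_domain_closed_mesh[K KM zK]|nDz] := pselect (D z).
    by exists K; rewrite /C KM.
  by exists finset.set0; rewrite /C (negPf s0).
- move=> K z; rewrite /C /w /b; case: ifPn => KM zK.
    by rewrite fN ?(cell_affineE tri _ KM zK)//; exact: simplex_mesh zK.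
  by rewrite f0// addr0 /dot big1// => i _; rewrite mxE mul0r.
Qed.

Section extension.
Variables (f : V -> R) (c : I -> R) (fc : nodal_extension f c).

Let f_lip x y : `|f y - f x| <= \sum_i cell_slope c i * `|y ord0 i - x ord0 i|.
Proof. exact: nodal_extension_lipschitz. Qed.

Lemma cell_slope_ge0 c' i : 0 <= cell_slope c' i.
Proof. exact: sumr_ge0. Qed.

Lemma nodal_extension_continuous : continuous f.
Proof.
move=> x A /nbhs_ballP[e /= e0 Ae].
pose S := \sum_i cell_slope c i + 1.
have S0 : 0 < S by rewrite ltr_wpDl// sumr_ge0// => i _; exact: cell_slope_ge0.
apply/nbhs_rowP; exists (e / S); first exact: divr_gt0.
move=> y xy; apply: Ae; apply: (le_lt_trans (f_lip y x)).
apply: (@le_lt_trans _ _ (\sum_i cell_slope c i * (e / S))).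
  by apply: ler_sum => i _; rewrite ler_wpM2l ?cell_slope_ge0// ltW.
rewrite -mulr_suml mulrCA -[ltRHS]mulr1 ltr_pM2l//.
by rewrite ltr_pdivrMr// mul1r /S ltrDl.
Qed.

Lemma nodal_extension_measurable : measurable_fun setT f.
Proof. by apply: continuous_measurable_row; exact: nodal_extension_continuous. Qed.

Lemma nodal_extension_bound x : `|f x| <= \sum_i `|c i|.
Proof.
have [f0 fN] := fc; have [Dx|/f0 ->] := pselect (D x); last by rewrite normr0 sumr_ge0.
have Nx := mesh_domain_closed_mesh Dx.
rewrite (fN _ Nx); apply: (le_trans (ler_norm_sum _ _ _)); apply: ler_sum => i _.
rewrite normrM ger0_norm ?bary_ge0// ler_piMl// -(bary_sum tri Nx).
by rewrite (bigD1 i)//= lerDl sumr_ge0// => j _; exact: bary_ge0.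
Qed.

Lemma nodal_extension_out x : ~ cube k x -> f x = 0.
Proof. by have [f0 _] := fc => kx; apply: f0 => /(em_sub em)/(em_cube em). Qed.

Lemma nodal_extension_lip_dir i : lip_dir i (cell_slope c i) f.
Proof.
move=> x t; apply: (le_trans (f_lip x _)).
rewrite (bigD1 i)//= big1 => [|j ji].
  by rewrite addr0 !mxE !eqxx mulr1 addrAC subrr add0r.
by rewrite !mxE eqxx (negPf ji)/= mulr0 addr0 subrr normr0 mulr0.
Qed.

Definition pw_grad c' i x : R :=
  \sum_(K in cells M) cell_grad K c' ord0 i * \1_(open_cell K) x.

Lemma pw_gradE c' i K x : K \in cells M -> open_cell K x ->
  pw_grad c' i x = cell_grad K c' ord0 i.
Proof.
move=> KM xK; rewrite /pw_grad (bigD1 K)//= indicE mem_set// mulr1 big1 ?addr0//.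
move=> L /andP[LM LK]; rewrite indicE memNset ?mulr0// => xL.
by move: LK; rewrite (open_cell_disjoint tri LM KM xL xK) eqxx.
Qed.

Lemma pw_grad_out c' i x : ~ D x -> pw_grad c' i x = 0.
Proof.
move=> nDx; rewrite /pw_grad big1// => K KM; rewrite indicE memNset ?mulr0// => xK.
by apply: nDx; exact: open_cell_mesh_domain xK.
Qed.

Lemma ae_open_cell : {ae mu, forall x, N x -> exists2 K, K \in cells M & open_cell K x}.
Proof.
have [cells_ok _ _] := tri.
have : mu.-negligible (\bigcup_(K in [set: {set I}]) [set x | K \in cells M /\ (simplex K `\` open_cell K) x]).
  apply: negligible_finite_union => K; have [KM|nKM] := boolP (K \in cells M); last first.
    by apply: negligibleS (negligible_set0 _) => x [].
  apply: (@negligibleS _ _ _ _ (simplex K `\` open_cell K)); first by move=> x [].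
  have [cK aK] := cells_ok _ KM.
  by apply: simplex_boundary_null => //; exact: em_dim em.
apply: negligibleS => x /= /not_implyP[[K KM xK] nx]; exists K => //; split => //.
by split=> // ox; apply: nx; exists K.
Qed.

(** Off the mesh and inside cells the function is affine nearby; the remaining
    points are on cell boundaries and form a null set. *)
Lemma nodal_extension_diff_quot i :
  {ae mu, forall x, diff_quot f i ^~ x @ \oo --> pw_grad c i x}.
Proof.
have [f0 fN] := fc; have [cells_ok _ _] := tri.
apply: filterS ae_open_cell => x H; have [Nx|nNx] := pselect (N x).
  have [K KM xK] := H Nx; have [cK aK] := cells_ok _ KM.
  rewrite (pw_gradE _ _ KM xK).
  apply: (@affine_diff_quot _ _ _ (cell_grad K c) (cell_const K c) _ _ (open_cell K)).
    by apply: open_nbhs_nbhs; split => //; exact: open_open_cell.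
  move=> y /(open_cell_simplex cK aK) yK.
  by rewrite fN ?(cell_affineE tri _ KM yK)//; exact: simplex_mesh yK.
have -> : pw_grad c i x = (0 : V) ord0 i.
  by rewrite mxE pw_grad_out// => /mesh_domain_closed_mesh.
apply: (@affine_diff_quot _ _ _ 0 0 _ _ (~` N)).
  apply: open_nbhs_nbhs; split => //.
  by apply: closed_openC; exact: closed_mesh.
move=> y nNy; rewrite f0 => [|/mesh_domain_closed_mesh//].
by rewrite addr0 /dot big1// => j _; rewrite mxE mul0r.
Qed.

Lemma pw_grad_measurable c' i : measurable_fun setT (pw_grad c' i).
Proof.
suff H (s : seq {set I}) (P : pred {set I}) : measurable_fun setT
    (fun x : V => \sum_(K <- s | P K) cell_grad K c' ord0 i * \1_(open_cell K) x) by exact: H.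
elim: s => [|K s IH]; first by under eq_fun do rewrite big_nil; exact: measurable_cst.
under eq_fun do rewrite big_cons.
case: (P K); last exact: IH.
apply: measurable_funD => //; apply: measurable_funM; first exact: measurable_cst.
by apply: measurable_indic; apply: open_measurable_row; exact: open_open_cell.
Qed.

Lemma pw_grad_bound c' i x : `|pw_grad c' i x| <= cell_slope c' i.
Proof.
apply: (le_trans (ler_norm_sum _ _ _)); apply: ler_sum => K KM.
rewrite normrM indicE ler_piMr//; case: (_ \in _); by rewrite ?normr1 ?normr0.
Qed.

Let bounded_L2 (g : V -> R) (B : R) : measurable_fun setT g -> (forall x, `|g x| <= B) ->
  (forall x, ~ cube k x -> g x = 0) -> L2 setT g.
Proof.
move=> mg gB g0; apply/(L2P _ measurableT); split => //.
apply: (@bounded_support_integrable _ _ _ k (B ^+ 2)).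
- exact: measurable_funX.
- by move=> x; rewrite normrX lerXn2r ?nnegrE// (le_trans _ (gB x)).
- by move=> x /g0 ->; rewrite expr0n.
Qed.

Lemma pw_grad_L2 c' i : L2 setT (pw_grad c' i).
Proof.
apply: (@bounded_L2 _ (cell_slope c' i)).
- exact: pw_grad_measurable.
- exact: pw_grad_bound.
- by move=> x kx; apply: pw_grad_out => /(em_sub em)/(em_cube em).
Qed.

Lemma nodal_extension_L2 A : measurable A -> L2 A f.
Proof.
move=> mA; apply: (@L2S _ _ _ setT) => //.
apply: bounded_L2; [exact: nodal_extension_measurable|exact: nodal_extension_bound|].
exact: nodal_extension_out.
Qed.

Lemma nodal_extension_weak_pd i : is_weak_pd D i f (pw_grad c i).
Proof.
move=> phi tphi.
rewrite !test_function_Rintegral//; last exact: test_function_pd.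
apply: (lipschitz_integration_by_parts _ _ _ _ _ tphi).
- exact: nodal_extension_measurable.
- exact: nodal_extension_bound.
- exact: nodal_extension_lip_dir.
- exact: pw_grad_measurable.
- exact: nodal_extension_diff_quot.
Qed.

Lemma nodal_extension_H1 : H1 D f.
Proof.
split; first exact: nodal_extension_L2.
move=> i; exists (pw_grad c i); last exact: nodal_extension_weak_pd.
by apply: L2S (pw_grad_L2 c i).
Qed.

Lemma nodal_extension_wpd i : {ae mu, forall x, D x -> wpd D i f x = pw_grad c i x}.
Proof.
apply: wpd_ae => //; [exact: nodal_extension_H1| |exact: nodal_extension_weak_pd].
by apply: L2S (pw_grad_L2 c i).
Qed.

Lemma nodal_extension_poincare i : L2norm D f <= 2 * k%:R * L2norm D (wpd D i f).
Proof.
have E g : (forall x, ~ D x -> g x = 0) -> L2norm setT g = L2norm D g.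
  move=> g0; apply/eqP; rewrite -(@eqrXn2 _ 2)// ?L2norm_ge0// !L2norm_sqr.
  apply/eqP; apply: Rintegral_out => // x _ nDx; by rewrite g0// mul0r.
have Lg : L2 D (pw_grad c i) by apply: L2S (pw_grad_L2 c i).
have Lw := wpd_L2 i nodal_extension_H1.
have -> : L2norm D (wpd D i f) = L2norm D (pw_grad c i).
  have ae1 := nodal_extension_wpd i.
  apply/eqP; rewrite -(@eqrXn2 _ 2)// ?L2norm_ge0// !L2norm_sqr.
  by rewrite (ae_eq_ipl mD Lw Lg Lw ae1) ipC (ae_eq_ipl mD Lw Lg Lg ae1).
have [f0 _] := fc.
rewrite -(E f)// -(E (pw_grad c i)); last by move=> x; exact: pw_grad_out.
apply: (@directional_poincare _ _ _ _ _ _ _ (cell_slope c i)).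
- exact: nodal_extension_measurable.
- exact: nodal_extension_bound.
- exact: nodal_extension_out.
- exact: nodal_extension_lip_dir.
- exact: pw_grad_L2.
- exact: nodal_extension_diff_quot.
Qed.

Lemma nodal_extension_fe_space : fe_space Om M f.
Proof.
have [f0 fN] := fc; split.
- by apply: continuous_subspaceT; exact: nodal_extension_continuous.
- move=> K KM; exists (cell_grad K c), (cell_const K c) => x xK.
  by rewrite fN ?(cell_affineE tri _ KM xK)//; exact: simplex_mesh xK.
- by move=> x _; exact: f0.
Qed.

End extension.

(** On each cell an affine function is the barycentric mean of its vertex values. Off
    the mesh domain v is cut off because it is arbitrary outside the closure of Om. *)
Lemma fe_space_nodal_extension v : fe_space Om M v ->
  nodal_extension (v \_ D) (fun i => v (vtx M i)).
Proof.
move=> [_ aff v0]; split => x.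
  by move=> nDx; rewrite patchE ifN//; apply/negP => /set_mem.
move=> Nx; have -> : (v \_ D) x = v x.
  rewrite patchE; case: ifPn => // /negP nDx; rewrite v0//.
    exact: (closed_mesh_closure_domain tri (em_sub em)).
  by move=> Dx; apply: nDx; exact: mem_set.
have [K KM xK] := Nx; have [w [b wb]] := aff K KM.
have [cells_ok _ _] := tri; have [cK aK] := cells_ok _ KM.
rewrite (bary_sumE tri _ KM xK) wb// -{1}(lam_repr cK aK x) dot_sumr.
rewrite -[X in _ + X]mul1r -(lam_sum cK aK x) mulr_suml -big_split/=.
apply: eq_bigr => i iK; rewrite -mulrDr wb//; exact: simplex_vtx.
Qed.

Lemma fe_space_vtx_out v i : fe_space Om M v -> ~ D (vtx M i) -> v (vtx M i) = 0.
Proof.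
move=> [_ _ v0] nD; apply: v0 => //.
by apply: (closed_mesh_closure_domain tri (em_sub em)); exact: vtx_closed_mesh.
Qed.

Lemma fe_space_lin v w t : fe_space Om M v -> fe_space Om M w ->
  fe_space Om M (fun x => v x + t * w x).
Proof.
move=> [cv av v0] [cw aw w0]; split.
- move=> x; apply: (@continuousD _ _ (subspace (closure Om)) v (fun x => t * w x)); first exact: cv.
  by apply: (@continuousM _ (subspace (closure Om)) (cst t) w); [exact: cst_continuous|exact: cw].
- move=> K KM; have [wv [bv Ev]] := av K KM; have [ww [bw Ew]] := aw K KM.
  exists (wv + t *: ww), (bv + t * bw) => x xK.
  by rewrite Ev// Ew// (dotC (_ + _)) dotD dotZ !(dotC x); ring.
- by move=> x Ox nDx; rewrite v0// w0// mulr0 addr0.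
Qed.

End finite_element_functions.

(** * The discrete state equation *)

Lemma L1normE (R : realType) (n : nat) (A : set 'rV[R]_n) (f : 'rV[R]_n -> R) :
  L1norm A f = \int[lebesgueRn R n]_(x in A) `|f x|.
Proof.
rewrite /L1norm Lnorm1 Rintegral_mkcond /Rintegral; congr fine.
apply: eq_integral => x _ /=; rewrite !patchE; case: ifP => //= _.
by rewrite normr0.
Qed.

(** Columns of the cokernel of G are null vectors of the form, hence orthogonal to r,
    and orthogonality to the cokernel characterizes the row space. *)
Lemma gram_system_solvable (R : realType) (m : nat) (G : 'M[R]_m) (r : 'rV[R]_m) :
  G^T = G ->
  (forall u : 'rV[R]_m, u *m G *m u^T = 0 -> r *m u^T = 0) ->
  exists u : 'rV[R]_m, u *m G = r.
Proof.
move=> sG H; suff /submxP[u ->] : (r <= G)%MS by exists u.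
rewrite submxE; apply/eqP/matrixP => i j; rewrite ord1 mxE [RHS]mxE.
pose u := (col j (cokermx G))^T.
have Gu : G *m u^T = 0.
  by rewrite trmxK colE mulmxA mulmx_coker mul0mx.
have /H/matrixP/(_ 0 0) : u *m G *m u^T = 0 by rewrite -mulmxA Gu mulmx0.
rewrite mxE [X in _ = X -> _]mxE => h; rewrite -[RHS]h; apply: eq_bigr => l _.
by rewrite /u trmxK !mxE.
Qed.

Section discrete_problem.
Opaque ip L2norm wpd h1sq.
Context {R : realType} {n : nat}.
Local Notation V := 'rV[R]_n.
Local Notation mu := (lebesgueRn R n).
Variables (Om : set V) (M : mesh R n) (k : nat).
Hypothesis em : embedded_mesh Om M k.
Local Notation I := 'I_(nvtx M).
Local Notation N := (closed_mesh_domain M).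
Local Notation D := (mesh_domain M).
Implicit Types (x : V) (i j : I) (c d : I -> R) (f g v w : V -> R).

Let tri := em_tri em.
Let oD : open D := @open_mesh_domain R n M.
Let mD : measurable D := open_measurable_row oD.

Lemma mesh_domain_lty : (mu D < +oo)%E.
Proof.
have h : D `<=` (cube k : set V) by move=> x /(em_sub em)/(em_cube em).
apply: (@le_lt_trans _ _ (mu (cube k))); last exact: lebesgueRn_obox_lty.
by apply: le_measure; rewrite ?inE//; exact: measurable_obox.
Qed.

Definition mask i : R := (`[< D (vtx M i) >])%:R.

Lemma mask_out i : ~ D (vtx M i) -> mask i = 0.
Proof. by rewrite /mask => /asboolPn/negPf ->. Qed.

Lemma mask_in i : D (vtx M i) -> mask i = 1.
Proof. by rewrite /mask => /asboolP ->. Qed.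

Lemma interp_nodal c : nodal_extension (interp (fun i => c i * mask i)) (fun i => c i * mask i).
Proof. by apply: (interpP em) => i /mask_out ->; rewrite mulr0. Qed.

(** Zero for vertices without a degree of freedom, which keeps the index type total. *)
Definition basis_fun i : V -> R := interp (fun j => (i == j)%:R * mask j).

Lemma basis_fun_nodal i : nodal_extension (basis_fun i) (fun j => (i == j)%:R * mask j).
Proof. exact: (interp_nodal (fun j => (i == j)%:R)). Qed.

Lemma basis_fun_fe i : fe_space Om M (basis_fun i).
Proof. exact: (nodal_extension_fe_space em (basis_fun_nodal i)). Qed.

Lemma interpE c x : D x -> interp c x = \sum_i bary i x * c i.
Proof. by move=> Dx; rewrite /interp patchE mem_set. Qed.

Lemma basis_funE i x : D x -> basis_fun i x = bary i x * mask i.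
Proof.
move=> Dx; rewrite /basis_fun interpE// (bigD1 i)//= eqxx mul1r big1 ?addr0// => j ji.
by rewrite eq_sym (negPf ji) mul0r mulr0.
Qed.

Lemma fe_expansion v x : fe_space Om M v -> D x ->
  v x = \sum_i v (vtx M i) * basis_fun i x.
Proof.
move=> fv Dx; have [_ /(_ x)] := fe_space_nodal_extension em fv.
rewrite patchE mem_set// => ->; last exact: mesh_domain_closed_mesh.
apply: eq_bigr => i _; rewrite basis_funE//.
have [Dv|nDv] := pselect (D (vtx M i)); first by rewrite mask_in// mulr1 mulrC.
by rewrite (fe_space_vtx_out em fv)// mulr0 mul0r.
Qed.

Lemma fe_H1 v : fe_space Om M v -> H1 D v.
Proof.
move=> fv; apply: H1_eq_on (nodal_extension_H1 em (fe_space_nodal_extension em fv)).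
by move=> x Dx; rewrite patchE mem_set.
Qed.

Lemma fe_L2 v : fe_space Om M v -> L2 D v.
Proof. by move=> /fe_H1/H1_L2. Qed.

Lemma fe_out v x : fe_space Om M v -> Om x -> ~ D x -> v x = 0.
Proof. by move=> [_ _ v0] Ox nDx; apply: v0 => //; exact: subset_closure. Qed.

Lemma fe_L2_Om v : fe_space Om M v -> L2 Om v.
Proof.
move=> fv; have mOm := open_measurable_row (em_open em).
apply: L2_eq_on (nodal_extension_L2 em (fe_space_nodal_extension em fv) mOm).
move=> x Ox; rewrite patchE; case: ifPn => // /negP nDx; apply/esym/(fe_out fv) => //.
by move=> Dx; apply: nDx; exact: mem_set.
Qed.

Lemma fe_poincare v (i : 'I_n) : fe_space Om M v -> L2norm D v <= 2 * k%:R * L2norm D (wpd D i v).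
Proof.
move=> fv; have := nodal_extension_poincare em (fe_space_nodal_extension em fv) i.
have E x : D x -> (v \_ D) x = v x by move=> Dx; rewrite patchE mem_set.
by rewrite (L2norm_eq_on E) (wpd_eq_on i E).
Qed.

Lemma fe_combination_fe (s : seq I) c : fe_space Om M (fun x => \sum_(i <- s) c i * basis_fun i x).
Proof.
elim: s => [|i s IH].
  rewrite (_ : (fun x => _) = interp (fun j => 0 * mask j)).
    exact: (nodal_extension_fe_space em (interp_nodal (fun=> 0))).
  apply/funext => x; rewrite big_nil /interp patchE; case: ifP => // _.
  by rewrite big1// => j _; rewrite mul0r mulr0.
rewrite (_ : (fun x => _) = (fun x => (\sum_(j <- s) c j * basis_fun j x) + c i * basis_fun i x)).
  by apply: fe_space_lin => //; exact: basis_fun_fe.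
by apply/funext => x; rewrite big_cons addrC.
Qed.

Definition fe_combination c : V -> R := fun x => \sum_i c i * basis_fun i x.

Variables (aij : 'I_n -> 'I_n -> V -> R) (c0 : V -> R) (Mc theta : R).
Hypothesis ellD : elliptic_on aij c0 Mc theta D.
Hypothesis theta0 : 0 < theta.
Local Notation Bf := (bilinear_form aij c0 D).
Local Notation P := (poincare_cst theta k).

Lemma fe_energy v : fe_space Om M v -> h1sq D v <= P * Bf v v.
Proof.
move=> fv; have [m nm] : exists m, n = m.+1 by case: (n) (em_dim em) => // m _; exists m.
have i0 : 'I_n by rewrite nm; exact: ord0.
apply: (energy_bound oD ellD (i := i0)) => //; first exact: fe_H1.
exact: fe_poincare.
Qed.

Lemma bilinear_form_fe_combination y c : fe_space Om M y ->
  Bf y (fe_combination c) = \sum_i c i * Bf y (basis_fun i).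
Proof.
move=> fy; have Hy := fe_H1 fy; rewrite /fe_combination.
elim: (index_enum _) => [|i s IH].
  have H0 := fe_H1 (fe_combination_fe [::] c).
  have := bilinear_form_linr oD ellD 1 Hy H0 H0.
  rewrite big_nil mul1r (_ : (fun x => _ + _) = (fun x => \sum_(i <- [::]) c i * basis_fun i x)).
    move/eqP; rewrite -subr_eq0 opprD addNKr oppr_eq0 => /eqP.
    by under [X in Bf _ X]eq_fun do rewrite big_nil.
  by apply/funext => x; rewrite !big_nil mul1r addr0.
have Hs := fe_H1 (fe_combination_fe s c); have Hi := fe_H1 (basis_fun_fe i).
rewrite big_cons -IH addrC -(bilinear_form_linr oD ellD (c i) Hy Hs Hi).
by congr (Bf _ _); apply/funext => x; rewrite big_cons addrC.
Qed.

Lemma ip_fe_combination f c : L2 D f ->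
  ip D f (fe_combination c) = \sum_i c i * ip D f (basis_fun i).
Proof.
move=> Lf; rewrite -ip_fold /fe_combination.
under eq_Rintegral do rewrite mulr_sumr.
rewrite Rintegral_sum// => [|i].
  apply: eq_bigr => i _; rewrite -ip_fold -RintegralZl//.
    by apply: eq_Rintegral => x _; ring.
  by apply: L2_integrable_mul => //; exact: fe_L2 (basis_fun_fe i).
apply: L2_integrable_mul => //.
by apply: L2Z => //; exact: fe_L2 (basis_fun_fe i).
Qed.

Lemma fe_combinationE v x : fe_space Om M v -> D x ->
  v x = fe_combination (fun i => v (vtx M i)) x.
Proof. exact: fe_expansion. Qed.

(** In the basis of nodal functions the equation is a Gram system; a null vector of
    the energy represents a function that vanishes almost everywhere by the Poincare
    inequality, so it is orthogonal to the data. *)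
Lemma discrete_solution_exists f : L2 D f -> exists y, discrete_solution aij c0 Om M f y.
Proof.
move=> Lf.
pose G : 'M[R]_(nvtx M) := \matrix_(i, j) Bf (basis_fun i) (basis_fun j).
pose r : 'rV[R]_(nvtx M) := \row_j ip D f (basis_fun j).
have Hb i := fe_H1 (basis_fun_fe i).
have fc c : fe_space Om M (fe_combination c) by exact: fe_combination_fe.
have BL (u : 'rV[R]_(nvtx M)) j : Bf (fe_combination (fun i => u ord0 i)) (basis_fun j) = (u *m G) ord0 j.
  rewrite (bilinear_form_sym oD ellD (fe_H1 (fc _)) (Hb j)).
  rewrite bilinear_form_fe_combination; last exact: basis_fun_fe.
  rewrite mxE; apply: eq_bigr => i _; rewrite mxE.
  by rewrite (bilinear_form_sym oD ellD (Hb j) (Hb i)).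
have [||u Hu] := @gram_system_solvable R _ G r.
- by apply/matrixP => i j; rewrite !mxE; exact: (bilinear_form_sym oD ellD (Hb _) (Hb _)).
- move=> u Hu; set w := fe_combination (fun i => u ord0 i).
  have Bw : Bf w w = 0.
    rewrite bilinear_form_fe_combination; last exact: fc.
    move/matrixP : Hu => /(_ 0 0); rewrite mxE [X in _ = X -> _]mxE => h; rewrite -[RHS]h.
    by apply: eq_bigr => j _; rewrite BL [u^T _ _]mxE mulrC.
  have w0 : ip D w w = 0.
    have := fe_energy (fc (fun i => u ord0 i)); rewrite -/w Bw mulr0 => h.
    apply/eqP; rewrite eq_le ip_ge0 andbT; apply: le_trans h; exact: ip_le_h1sq.
  have Lw : L2 D w := fe_L2 (fc _).
  have fw : ip D f w = 0.
    have := ip_CS mD Lf Lw; rewrite w0 mulr0 => h.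
    by apply/eqP; rewrite -sqrf_eq0 eq_le h sqr_ge0.
  apply/matrixP => a b; rewrite !ord1 [RHS]mxE -fw /w ip_fe_combination// mxE.
  by apply: eq_bigr => j _; rewrite !mxE mulrC.
exists (fe_combination (fun i => u ord0 i)); split; first exact: fc.
move=> v fv; rewrite ip_fold.
have Ev x (Dx : D x) := fe_combinationE fv Dx.
rewrite (bilinear_form_eq_on aij c0 (fun x _ => erefl) Ev).
rewrite (ip_eq_on (fun x _ => erefl) Ev).
rewrite bilinear_form_fe_combination; last exact: fc.
rewrite ip_fe_combination//; apply: eq_bigr => j _; rewrite BL Hu.
by rewrite mxE.
Qed.

Lemma discrete_solution_lin f g y w t : L2 D f -> L2 D g ->
  discrete_solution aij c0 Om M f y -> discrete_solution aij c0 Om M g w ->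
  discrete_solution aij c0 Om M (fun x => f x + t * g x) (fun x => y x + t * w x).
Proof.
move=> Lf Lg [fy Ey] [fw Ew]; split=> [|v fv]; first exact: fe_space_lin.
apply: (bilinear_form_solution_lin oD ellD) => //; try exact: fe_H1.
  exact: Ey.
exact: Ew.
Qed.

Lemma discrete_solution_bound f y : L2 D f -> discrete_solution aij c0 Om M f y ->
  L2norm D y <= P * L2norm D f /\ h1sq D y <= (P * L2norm D f) ^+ 2.
Proof.
move=> Lf [fy Ey].
apply: (a_priori_bound oD (poincare_cst_ge0 k theta0) Lf (fe_L2 fy)).
by have := fe_energy fy; rewrite (Ey _ fy).
Qed.

(** Symmetry of the bilinear form; with the discrete adjoint state y it trades the
    residual f, paired with a state w, for the control data g behind w. *)
Lemma discrete_solution_duality f g y w : discrete_solution aij c0 Om M f y ->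
  discrete_solution aij c0 Om M g w -> ip D f w = ip D g y.
Proof.
move=> [fy Ey] [fw Ew]; have := Ey _ fw; have := Ew _ fy; rewrite !ip_fold => <- <-.
by rewrite (bilinear_form_sym oD ellD (fe_H1 fw) (fe_H1 fy)).
Qed.

End discrete_problem.

(** * Nodal quadrature of the control cost *)

Section scalar_minimization.
Context {R : realType}.
Implicit Types (p q u v m a b alpha beta : R).

Definition control_cost alpha beta p v : R := p * v + alpha / 2 * v ^+ 2 + beta * `|v|.

(** The minimizer is the soft threshold of -p / alpha cut off at the bounds. The
    quadratic term in the conclusion is strong convexity, which later yields uniqueness
    at p = 0 and the Lipschitz dependence on p. *)
Lemma control_cost_minimizer alpha beta a b p : 0 < alpha -> 0 < beta ->
  a < 0 -> 0 < b -> exists2 m, a <= m <= b & forall v, a <= v <= b ->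
    control_cost alpha beta p m + alpha / 2 * (v - m) ^+ 2 <= control_cost alpha beta p v.
Proof.
move=> al0 be0 a0 b0.
(* xi is a subgradient of the absolute value at m *)
suff [m [xi [mab xi1 xim opt]]] : exists m xi, [/\ a <= m <= b, -1 <= xi <= 1,
    xi * m = `|m| & forall v, a <= v <= b -> 0 <= (p + alpha * m + beta * xi) * (v - m)].
  exists m => // v vab; have := opt v vab.
  have : xi * v <= `|v|.
    apply: (le_trans (ler_norm _)); rewrite normrM ler_piMl// ler_norml.
    exact: xi1.
  rewrite /control_cost -xim; move: (`|v|) => nv h1 h2.
  have := ler_wpM2l (ltW be0) h1; lra.
have alK x : alpha * (x / alpha) = x by rewrite mulrC divfK// gt_eqF.
have [pb|pb] := lerP beta p.
  pose s := - (p - beta) / alpha.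
  have as_ : alpha * s = - (p - beta) by rewrite alK.
  have s0 : s <= 0 by rewrite /s mulNr oppr_le0 divr_ge0 ?subr_ge0// ltW.
  have [sa|sa] := lerP a s.
    exists s, (-1); split.
    - by rewrite sa (le_trans s0)// ltW.
    - by apply/andP; split => //; lra.
    - by rewrite ler0_norm// mulN1r.
    by move=> v _; rewrite as_ (_ : _ + _ + _ = 0) ?mul0r//; ring.
  exists a, (-1); split.
  - by rewrite lexx ltW// (lt_trans a0).
  - by apply/andP; split => //; lra.
  - by rewrite ltr0_norm// mulN1r.
  move=> v /andP[av _]; apply: mulr_ge0; last by rewrite subr_ge0.
  by have := ler_wpM2l (ltW al0) (ltW sa); rewrite as_; lra.
have [pb'|pb'] := lerP p (- beta).
  pose s := - (p + beta) / alpha.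
  have as_ : alpha * s = - (p + beta) by rewrite alK.
  have s0 : 0 <= s by rewrite /s divr_ge0 ?(ltW al0)//; lra.
  have [sb|sb] := lerP s b.
    exists s, 1; split.
    - by rewrite sb andbT (le_trans (ltW a0)).
    - by apply/andP; split => //; lra.
    - by rewrite ger0_norm// mul1r.
    by move=> v _; rewrite as_ (_ : _ + _ + _ = 0) ?mul0r//; ring.
  exists b, 1; split.
  - by rewrite lexx andbT ltW// (lt_trans a0).
  - by apply/andP; split => //; lra.
  - by rewrite gtr0_norm// mul1r.
  move=> v /andP[_ vb]; rewrite -mulrNN; apply: mulr_ge0; last by rewrite oppr_ge0 subr_le0.
  by have := ler_wpM2l (ltW al0) (ltW sb); rewrite as_; lra.
exists 0, (- p / beta); split.
- by rewrite !ltW.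
- rewrite ler_pdivlMr// ler_pdivrMr// mulN1r mul1r; apply/andP; split; lra.
- by rewrite mulr0 normr0.
move=> v _; rewrite (_ : p + _ + _ = 0) ?mul0r// mulr0 addr0 mulrC divfK ?gt_eqF//; ring.
Qed.

(** Comparing with v = 0 leaves a nonnegative sum with nonpositive value. Vertices on
    the boundary have adjoint value 0, so this makes the competitor vanish there. *)
Lemma control_cost_minimizer0 alpha beta a b m : 0 < alpha -> 0 < beta ->
  a < 0 -> 0 < b ->
  (forall v, a <= v <= b ->
    control_cost alpha beta 0 m + alpha / 2 * (v - m) ^+ 2 <= control_cost alpha beta 0 v) ->
  m = 0.
Proof.
move=> al0 be0 a0 b0 /(_ 0); rewrite (ltW a0) (ltW b0) => /(_ isT).
rewrite /control_cost !mul0r normr0 expr0n/= !mulr0 !add0r => h.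
have h1 : 0 <= beta * `|m| by rewrite mulr_ge0// ltW.
have : m ^+ 2 <= 0.
  rewrite sqrrN in h.
  have : alpha * m ^+ 2 <= 0 by move: h h1; move: (m ^+ 2) (beta * _) => s r h h1; lra.
  by rewrite pmulr_rle0.
by move=> h2; apply/eqP; rewrite -sqrf_eq0 eq_le h2 sqr_ge0.
Qed.

End scalar_minimization.

Section weighted_means.
Context {R : realType} {I : finType}.
Variables (t : I -> R).
Hypothesis t0 : forall i, 0 <= t i.
Hypothesis t1 : \sum_i t i = 1.
Implicit Types (q v : I -> R).

Lemma weighted_mean_sqr v : (\sum_i t i * v i) ^+ 2 <= \sum_i t i * v i ^+ 2.
Proof.
set m := \sum_i _; rewrite -subr_ge0.
rewrite (_ : _ - _ = \sum_i t i * (v i - m) ^+ 2).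
  by apply: sumr_ge0 => i _; rewrite mulr_ge0// sqr_ge0.
have -> : \sum_i t i * (v i - m) ^+ 2 =
    \sum_i (t i * v i ^+ 2 - 2 * m * (t i * v i) + m ^+ 2 * t i).
  by apply: eq_bigr => i _; ring.
rewrite big_split sumrB/= -!mulr_sumr t1 -/m; ring.
Qed.

Lemma weighted_mean_norm v : `|\sum_i t i * v i| <= \sum_i t i * `|v i|.
Proof.
by apply: (le_trans (ler_norm_sum _ _ _)); apply: ler_sum => i _; rewrite normrM ger0_norm.
Qed.

Lemma weighted_covariance q v :
  2 * ((\sum_i t i * q i) * (\sum_i t i * v i) - \sum_i t i * (q i * v i)) =
  \sum_i \sum_j t i * t j * ((q i - q j) * (v j - v i)).
Proof.
have E1 : (\sum_i t i * q i) * (\sum_i t i * v i) = \sum_i \sum_j t i * t j * (q i * v j).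
  rewrite mulr_suml; apply: eq_bigr => i _; rewrite mulr_sumr.
  by apply: eq_bigr => j _; ring.
have E2 : \sum_i t i * (q i * v i) = \sum_i \sum_j t i * t j * (q i * v i).
  apply: eq_bigr => i _; rewrite -[LHS]mul1r -t1 mulr_suml.
  by apply: eq_bigr => j _; ring.
have E3 : \sum_i t i * (q i * v i) = \sum_i \sum_j t i * t j * (q j * v j).
  by rewrite E2 exchange_big; apply: eq_bigr => i _; apply: eq_bigr => j _; ring.
have E4 : (\sum_i t i * q i) * (\sum_i t i * v i) = \sum_i \sum_j t i * t j * (q j * v i).
  by rewrite E1 exchange_big; apply: eq_bigr => i _; apply: eq_bigr => j _; ring.
rewrite mulrDl mul1r {1}E1 {1}E2 E4 E3 -!sumrB -big_split/=; apply: eq_bigr => i _.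
by rewrite -!sumrB -big_split/=; apply: eq_bigr => j _; ring.
Qed.

(** Minimizers depend on the adjoint value in a monotone, 1/alpha-Lipschitz way, so
    the covariance of adjoint values and controls, which is the error of nodal
    quadrature for their product, is at most the squared oscillation over 2 alpha. *)
Lemma lumped_control_cost (alpha beta a b e u : R) q v : 0 < alpha ->
  (forall i, a <= v i <= b) ->
  (forall i w, a <= w <= b -> control_cost alpha beta (q i) (v i) +
     alpha / 2 * (w - v i) ^+ 2 <= control_cost alpha beta (q i) w) ->
  (forall i j, 0 < t i -> 0 < t j -> (q i - q j) ^+ 2 <= e) ->
  a <= u <= b ->
  (\sum_i t i * q i) * (\sum_i t i * v i) + alpha / 4 * (\sum_i t i * v i) ^+ 2 +
    \sum_i t i * (alpha / 4 * v i ^+ 2 + beta * `|v i|) <=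
  control_cost alpha beta (\sum_i t i * q i) u + (2 * alpha)^-1 * e.
Proof.
move=> al0 vab opt osc uab.
(* adding the optimality of v i and v j at each other's adjoint value *)
have mono i j : alpha * (q i - q j) * (v j - v i) <= (q i - q j) ^+ 2.
  have := opt i _ (vab j); have := opt j _ (vab i); rewrite /control_cost.
  move: (q i) (q j) (v i) (v j) (`|v i|) (`|v j|) => qi qj vi vj ni nj h1 h2.
  have h3 : alpha * (vj - vi) ^+ 2 <= (qi - qj) * (vj - vi) by lra.
  have := ler_wpM2l (ltW al0) h3; have := sqr_ge0 ((qi - qj) - alpha * (vj - vi)).
  by lra.
have cov : (\sum_i t i * q i) * (\sum_i t i * v i) <=
    \sum_i t i * (q i * v i) + (2 * alpha)^-1 * e.
  have h : \sum_i \sum_j t i * t j * ((q i - q j) * (v j - v i)) <= alpha^-1 * e.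
    have -> : alpha^-1 * e = \sum_i \sum_j t i * t j * (alpha^-1 * e).
      rewrite -[LHS]mul1r -[in LHS]t1 mulr_suml; apply: eq_bigr => i _.
      rewrite -[LHS]mulr1 -[in LHS]t1 mulr_sumr; apply: eq_bigr => j _; ring.
    apply: ler_sum => i _; apply: ler_sum => j _.
    have [ti|ti] := eqVneq (t i) 0; first by rewrite ti !mul0r.
    have [tj|tj] := eqVneq (t j) 0; first by rewrite tj mulr0 !mul0r.
    have tip : 0 < t i by rewrite lt_neqAle eq_sym ti t0.
    have tjp : 0 < t j by rewrite lt_neqAle eq_sym tj t0.
    rewrite ler_wpM2l ?mulr_ge0// [leRHS]mulrC ler_pdivlMr//.
    apply: le_trans (osc i j tip tjp); apply: le_trans (mono i j).
    by rewrite mulrC mulrA.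
  have := weighted_covariance q v.
  rewrite invfM -mulrA; move: h; move: (\sum_i \sum_j _) (alpha^-1 * e) (_ * (\sum_i t i * v i)) (\sum_i t i * (q i * v i)).
  by move=> S E A B h1 h2; lra.
have sq := weighted_mean_sqr v.
have key : \sum_i t i * control_cost alpha beta (q i) (v i) <=
    control_cost alpha beta (\sum_i t i * q i) u.
  have -> : control_cost alpha beta (\sum_i t i * q i) u =
      \sum_i t i * control_cost alpha beta (q i) u.
    rewrite {2}/control_cost.
    have -> : \sum_i t i * (q i * u + alpha / 2 * u ^+ 2 + beta * `|u|) =
       \sum_i (u * (t i * q i) + (alpha / 2 * u ^+ 2 + beta * `|u|) * t i).
      by apply: eq_bigr => i _; ring.
    rewrite big_split/= -!mulr_sumr t1 /control_cost; ring.
  apply: ler_sum => i _; rewrite ler_wpM2l//; apply: le_trans (opt i u uab).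
  by rewrite lerDl mulr_ge0 ?sqr_ge0// divr_ge0// ltW.
have E : \sum_i t i * control_cost alpha beta (q i) (v i) =
   \sum_i t i * (q i * v i) + alpha / 4 * \sum_i t i * v i ^+ 2 +
   \sum_i t i * (alpha / 4 * v i ^+ 2 + beta * `|v i|).
  rewrite mulr_sumr -!big_split/=; apply: eq_bigr => i _; rewrite /control_cost.
  by field.
rewrite E in key; have a4 : 0 <= alpha / 4 by rewrite divr_ge0// ltW.
have := ler_wpM2l a4 sq; move: key cov.
move: (\sum_i t i * (q i * v i)) (alpha / 4 * \sum_i t i * v i ^+ 2) (control_cost _ _ _ _).
move: (\sum_i t i * (alpha / 4 * v i ^+ 2 + beta * `|v i|)) (_ * (\sum_i t i * v i)) (alpha / 4 * _ ^+ 2) (_ * e).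
by move=> r1 r2 r3 r4 r5 r6 r7; lra.
Qed.

End weighted_means.

Lemma dot_cauchy_schwarz (R : realType) (n : nat) (x y : 'rV[R]_n) :
  dot x y ^+ 2 <= dot x x * dot y y.
Proof.
have d0 (z : 'rV[R]_n) : 0 <= dot z z by apply: sumr_ge0 => i _; rewrite -expr2 sqr_ge0.
apply: nonneg_quadratic_discriminant; [exact: d0|exact: d0|] => t.
have := d0 (x + t *: y); rewrite dotD dotZ !(dotC (x + _)) !dotD !dotZ (dotC y x).
by move: (dot x x) (dot x y) (dot y y) => p q r; lra.
Qed.

Section lumping.
Opaque ip L2norm wpd h1sq.
Context {R : realType} {n : nat}.
Local Notation V := 'rV[R]_n.
Local Notation mu := (lebesgueRn R n).
Variables (Om : set V) (M : mesh R n) (k : nat).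
Hypothesis em : embedded_mesh Om M k.
Local Notation I := 'I_(nvtx M).
Local Notation N := (closed_mesh_domain M).
Local Notation D := (mesh_domain M).
Implicit Types (x : V) (i j : I) (c d : I -> R) (f g v w z : V -> R).

Let tri := em_tri em.
Let oD : open D := @open_mesh_domain R n M.
Let mD : measurable D := open_measurable_row oD.
Let Dfin := mesh_domain_lty em.

(** Nodal quadrature on the mesh domain, written with barycentric coordinates
    rather than integrals of hat functions; [lumpedE] relates both. *)
Definition lumped c : R := \int[mu]_(x in D) (\sum_i bary i x * c i).

Definition interior_values c := forall i, ~ D (vtx M i) -> c i = 0.

Lemma lumped_integrable c : interior_values c ->
  mu.-integrable D (EFin \o (fun x => \sum_i bary i x * c i)).
Proof.
move=> c0; have := interpP em c0 => ic.
have := L2_integrable mD Dfin (nodal_extension_L2 em ic mD).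
apply: eq_integrable => // x /set_mem Dx /=; congr (_%:E).
by rewrite interpE.
Qed.

Lemma lumped_lin c d s t : interior_values c -> interior_values d ->
  lumped (fun i => s * c i + t * d i) = s * lumped c + t * lumped d.
Proof.
move=> c0 d0; rewrite /lumped -!RintegralZl//; try exact: lumped_integrable.
have ic := integrableZl mD s (lumped_integrable c0).
have id := integrableZl mD t (lumped_integrable d0).
rewrite -RintegralD//.
  apply: eq_Rintegral => x _; rewrite !mulr_sumr -big_split/=.
  by apply: eq_bigr => i _; ring.
Qed.

Lemma lumped_le c d : interior_values c -> interior_values d ->
  (forall i, c i <= d i) -> lumped c <= lumped d.
Proof.
move=> c0 d0 cd; apply: ae_Rintegral_le; [exact: mD|exact: lumped_integrable|exact: lumped_integrable|].
by apply: aeW => x _; apply: ler_sum => i _; rewrite ler_wpM2l ?bary_ge0.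
Qed.

Lemma lumped_ge0 c : (forall i, 0 <= c i) -> 0 <= lumped c.
Proof.
by move=> c0; apply: Rintegral_ge0 => x _; apply: sumr_ge0 => i _; rewrite mulr_ge0 ?bary_ge0.
Qed.

(** A hat function exists, the interpolant of a Kronecker delta, hence the chosen
    one has its defining property and is determined by its vertex values. *)
Lemma hatE i x : D (vtx M i) -> N x -> hat Om i x = bary i x.
Proof.
move=> Dv Nx.
have [fh hh] : fe_space Om M (hat Om i) /\ forall j, hat Om i (vtx M j) = (i == j)%:R.
  have fb := basis_fun_fe em i; have nb := basis_fun_nodal em i.
  apply: (@xgetPex _ (cst 0) [set phi | fe_space Om M phi /\
    forall j, phi (vtx M j) = (i == j)%:R]).
  exists (basis_fun i); split=> // j; rewrite (nodal_extension_vtx em _ nb).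
  by have [<-|ij] := eqVneq i j; rewrite ?mul0r// mask_in// mulr1.
have [h0 hN] := fe_space_nodal_extension em fh.
have -> : hat Om i x = (hat Om i \_ D) x.
  rewrite patchE; case: ifPn => // /negP nDx; have [_ _] := fh; apply.
    exact: (closed_mesh_closure_domain tri (em_sub em)).
  by move=> Dx; apply: nDx; exact: mem_set.
rewrite hN// (bigD1 i)//= hh eqxx mulr1 big1 ?addr0// => j ji.
by rewrite hh eq_sym (negPf ji) mulr0.
Qed.

Lemma lumpedE c : interior_values c ->
  \sum_(i | `[< D (vtx M i) >]) c i * \int[mu]_(x in D) hat Om i x = lumped c.
Proof.
move=> c0; rewrite /lumped.
have Lb i := L2_integrable mD Dfin (fe_L2 em (basis_fun_fe em i)).
rewrite (@eq_Rintegral _ _ _ _ D (fun x => \sum_i c i * basis_fun i x)) => [|x /set_mem Dx]; last first.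
  apply: eq_bigr => i _; rewrite basis_funE//.
  have [Dv|nDv] := pselect (D (vtx M i)); first by rewrite mask_in// mulr1 mulrC.
  by rewrite c0// mulr0 mul0r.
rewrite Rintegral_sum// => [|i]; last first.
  by have := integrableZl mD (c i) (Lb i); exact: eq_integrable.
rewrite big_mkcond/=; apply: eq_bigr => i _; rewrite RintegralZl//.
case: ifPn => [/asboolP Dv|/asboolPn nDv]; last by rewrite c0// mul0r.
congr (_ * _); apply: eq_Rintegral => x /set_mem Dx.
by rewrite hatE//; [rewrite basis_funE// mask_in// mulr1|exact: mesh_domain_closed_mesh].
Qed.

Lemma L2h_norm_sqr z : fe_space Om M z ->
  L2h_norm Om M z ^+ 2 = lumped (fun i => z (vtx M i) ^+ 2).
Proof.
move=> fz; rewrite /L2h_norm lumpedE => [|i nD]; last by rewrite (fe_space_vtx_out em fz)// expr0n.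
by rewrite sqr_sqrtr//; apply: lumped_ge0 => i; exact: sqr_ge0.
Qed.

Lemma L1h_normE z : fe_space Om M z ->
  L1h_norm Om M z = lumped (fun i => `|z (vtx M i)|).
Proof.
move=> fz; rewrite /L1h_norm lumpedE// => i nD.
by rewrite (fe_space_vtx_out em fz)// normr0.
Qed.

Lemma fe_bary v x : fe_space Om M v -> D x -> v x = \sum_i bary i x * v (vtx M i).
Proof.
move=> fv Dx; have [_ /(_ x)] := fe_space_nodal_extension em fv.
by rewrite patchE mem_set// => ->//; exact: mesh_domain_closed_mesh.
Qed.

Lemma L2norm_le_lumped z : fe_space Om M z ->
  ip D z z <= lumped (fun i => z (vtx M i) ^+ 2).
Proof.
move=> fz; rewrite -ip_fold; apply: ae_Rintegral_le => //.
- exact: L2_integrable_mul (fe_L2 em fz) (fe_L2 em fz).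
- by apply: lumped_integrable => i nD; rewrite (fe_space_vtx_out em fz)// expr0n.
apply: aeW => x Dx; rewrite -expr2 (fe_bary fz Dx); apply: weighted_mean_sqr.
  by move=> i; exact: bary_ge0.
by apply: bary_sum => //; exact: mesh_domain_closed_mesh.
Qed.

Lemma fe_norm_integrable z : fe_space Om M z -> mu.-integrable D (EFin \o (fun x => `|z x|)).
Proof.
move=> fz; have := integrable_abse (L2_integrable mD Dfin (fe_L2 em fz)).
exact: eq_integrable.
Qed.

Lemma L1norm_le_lumped z : fe_space Om M z ->
  \int[mu]_(x in D) `|z x| <= lumped (fun i => `|z (vtx M i)|).
Proof.
move=> fz; apply: ae_Rintegral_le => //.
- exact: fe_norm_integrable.
- by apply: lumped_integrable => i nD; rewrite (fe_space_vtx_out em fz)// normr0.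
apply: aeW => x Dx; rewrite (fe_bary fz Dx); apply: weighted_mean_norm => i.
exact: bary_ge0.
Qed.

Lemma cell_diameter K i j : K \in cells M -> i \in K -> j \in K ->
  dot (vtx M i - vtx M j) (vtx M i - vtx M j) <= mesh_size M ^+ 2.
Proof.
move=> KM iK jK; set d := _ - _.
have dd0 : 0 <= dot d d by apply: sumr_ge0 => l _; rewrite -expr2 sqr_ge0.
rewrite -(sqr_sqrtr dd0) lerXn2r ?nnegrE ?sqrtr_ge0//.
  by apply: bigmax_ge_id.
apply: (@le_trans _ _ (diam (simplex K))); last exact: le_bigmax_cond.
apply: ub_le_sup; last first.
  by exists (vtx M i, vtx M j) => //; split; exact: simplex_vtx.
pose B (l : 'I_n) := \sum_(r in K) `|vtx M r ord0 l|.
have bnd x (l : 'I_n) : simplex K x -> `|x ord0 l| <= B l.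
  move=> [t [t0 t1] <-]; rewrite summxE; apply: (le_trans (ler_norm_sum _ _ _)).
  apply: ler_sum => r rK; rewrite mxE normrM ger0_norm// ler_piMl//.
  by rewrite -t1 (bigD1 r)//= lerDl sumr_ge0.
exists (Num.sqrt (\sum_l (2 * B l) ^+ 2)) => _ [[x y] [/= xK yK] <-].
rewrite /enorm; apply: ler_wsqrtr; apply: ler_sum => l _.
rewrite -expr2 -[leLHS]real_normK ?num_real// lerXn2r ?nnegrE//.
  by rewrite mulr_ge0// sumr_ge0.
rewrite !mxE (le_trans (ler_normB _ _))// mulrDl mul1r; apply: lerD; exact: bnd.
Qed.

(** Inside a cell the vertex values of q differ by at most h |grad q|, which is the
    oscillation that the pointwise comparison leaves as an error. *)
Lemma lumped_control_comparison (alpha beta a b : R) (q vh u : V -> R) :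
  0 < alpha -> 0 < beta ->
  fe_space Om M q -> fe_space Om M vh -> L2 D u ->
  {ae mu, forall x, D x -> a <= u x <= b} ->
  (forall i, a <= vh (vtx M i) <= b) ->
  (forall i (w : R), a <= w <= b -> control_cost alpha beta (q (vtx M i)) (vh (vtx M i)) +
     alpha / 2 * (w - vh (vtx M i)) ^+ 2 <= control_cost alpha beta (q (vtx M i)) w) ->
  ip D q vh + alpha / 4 * ip D vh vh + alpha / 4 * lumped (fun i => vh (vtx M i) ^+ 2) +
    beta * lumped (fun i => `|vh (vtx M i)|) <=
  ip D q u + alpha / 2 * ip D u u + beta * (\int[mu]_(x in D) `|u x|) +
    (2 * alpha)^-1 * mesh_size M ^+ 2 * \sum_(l < n) ip D (wpd D l q) (wpd D l q).
Proof.
move=> al0 be0 fq fv Lu uab vab opt.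
have Lq := fe_L2 em fq; have Lv := fe_L2 em fv.
have nq := fe_space_nodal_extension em fq.
have v0 : interior_values (fun i => vh (vtx M i) ^+ 2).
  by move=> i nD; rewrite (fe_space_vtx_out em fv)// expr0n.
have v1 : interior_values (fun i => `|vh (vtx M i)|).
  by move=> i nD; rewrite (fe_space_vtx_out em fv)// normr0.
have v2 : interior_values (fun i => alpha / 4 * vh (vtx M i) ^+ 2 + beta * `|vh (vtx M i)|).
  by move=> i nD; rewrite v0// v1// !mulr0 addr0.
rewrite -addrA -lumped_lin//.
have iqv := L2_integrable_mul mD Lq Lv; have ivv := L2_integrable_mul mD Lv Lv.
have iqu := L2_integrable_mul mD Lq Lu; have iuu := L2_integrable_mul mD Lu Lu.
have iu : mu.-integrable D (EFin \o (fun x => `|u x|)).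
  by have := integrable_abse (L2_integrable mD Dfin Lu); exact: eq_integrable.
have il := lumped_integrable v2.
have Hq := fe_H1 em fq.
have iw (l : 'I_n) := L2_integrable_mul mD (wpd_L2 l Hq) (wpd_L2 l Hq).
have isum := integrable_Rsum (index_enum 'I_n) mD iw.
have iD (f1 f2 : V -> R) : mu.-integrable D (EFin \o f1) -> mu.-integrable D (EFin \o f2) ->
    mu.-integrable D (EFin \o (fun x => f1 x + f2 x)).
  by move=> i1 i2; have := integrableD mD i1 i2; exact: eq_integrable.
have iZ (s : R) (f1 : V -> R) : mu.-integrable D (EFin \o f1) ->
    mu.-integrable D (EFin \o (fun x => s * f1 x)).
  by move=> i1; have := integrableZl mD s i1; exact: eq_integrable.
set L := (X in X <= _); set S := (X in _ <= X).
have -> : L = \int[mu]_(x in D) (q x * vh x + alpha / 4 * (vh x * vh x) +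
    \sum_i bary i x * (alpha / 4 * vh (vtx M i) ^+ 2 + beta * `|vh (vtx M i)|)).
  by rewrite RintegralD ?RintegralD ?RintegralZl//; [exact: iZ|apply: (iD) => //; exact: iZ].
have -> : S = \int[mu]_(x in D) (q x * u x + alpha / 2 * (u x * u x) + beta * `|u x| +
    (2 * alpha)^-1 * mesh_size M ^+ 2 * \sum_(l < n) wpd D l q x * wpd D l q x).
  rewrite RintegralD//; last 2 first.
  - by apply: (iD); [apply: (iD) => //; exact: iZ|exact: iZ].
  - exact: iZ.
  rewrite RintegralD//; last 2 first.
  - by apply: (iD) => //; exact: iZ.
  - exact: iZ.
  rewrite RintegralD//; last exact: iZ.
  by rewrite !RintegralZl// Rintegral_sum.
apply: ae_Rintegral_le => //.
- by apply: (iD) => //; apply: (iD) => //; exact: iZ.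
- by apply: (iD); [apply: (iD); [apply: (iD) => //; exact: iZ|exact: iZ]|exact: iZ].
have wq (l : 'I_n) : {ae mu, forall x, D x -> wpd D l q x = pw_grad (fun i => q (vtx M i)) l x}.
  have E x : D x -> (q \_ D) x = q x by move=> Dx; rewrite patchE mem_set.
  by rewrite -(wpd_eq_on l E); exact: (nodal_extension_wpd em nq).
have wq' : {ae mu, forall x, forall l : 'I_n, D x -> wpd D l q x = pw_grad (fun i => q (vtx M i)) l x}.
  exact: filter_forall.
have op := ae_open_cell em.
apply: filterS3 uab wq' op => x ux wx ox Dx.
have Nx := mesh_domain_closed_mesh Dx; have [K KM xK] := ox Nx.
have [cells_ok _ _] := tri; have [cK aK] := cells_ok _ KM.
have xsK : simplex K x by exact: (open_cell_simplex cK aK).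
set qv := fun i => q (vtx M i).
have wE : \sum_(l < n) wpd D l q x * wpd D l q x = dot (cell_grad K qv) (cell_grad K qv).
  by apply: eq_bigr => l _; rewrite wx// (pw_gradE em _ _ KM xK).
rewrite wE -!expr2 (fe_bary fq Dx) (fe_bary fv Dx) -[(2 * alpha)^-1 * _ * _]mulrA.
apply: (@lumped_control_cost R _ (fun i => bary i x) _ _ alpha beta a b) => //.
- by move=> i; exact: bary_ge0.
- exact: bary_sum.
- move=> i j; rewrite !(baryE tri _ KM xsK).
  case: ifPn => iK; last by rewrite ltxx.
  case: ifPn => jK; last by rewrite ltxx.
  move=> _ _.
  have qE r : r \in K -> q (vtx M r) = dot (cell_grad K qv) (vtx M r) + cell_const K qv.
    move=> rK; rewrite -(cell_affineE tri _ KM (simplex_vtx rK)).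
    have [_ <-] := nq; last exact: vtx_closed_mesh.
    by rewrite (nodal_extension_vtx em _ nq).
  rewrite !qE// (_ : _ - _ = dot (cell_grad K qv) (vtx M i - vtx M j)); last by rewrite dotD dotN; ring.
  apply: (le_trans (dot_cauchy_schwarz _ _)); rewrite [leRHS]mulrC ler_wpM2l//.
    by apply: sumr_ge0 => l _; rewrite -expr2 sqr_ge0.
  exact: (cell_diameter KM iK jK).
- exact: ux.
Qed.

End lumping.

(** * Variational inequalities *)

Lemma convex_set_segment (R : realType) (n : nat) (A : set 'rV[R]_n) :
  convex_set (A : set (convex_lmodType 'rV[R]_n)) ->
  forall (x y : 'rV[R]_n) (t : R), A x -> A y -> 0 <= t <= 1 -> A (t *: x + (1 - t) *: y).
Proof.
move=> cA x y t Ax Ay /andP[t0 t1].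
have := cA x y (Itv01 t0 t1); rewrite !inE => /(_ Ax Ay); exact.
Qed.

(** Dividing by t and letting t tend to 0. *)
Lemma first_order_condition (R : realType) (A C : R) :
  (forall t, 0 < t -> t <= 1 -> 0 <= t * A + t ^+ 2 * C) -> 0 <= A.
Proof.
move=> H; rewrite leNgt; apply/negP => A0.
pose t := Num.min 1 (- A / (2 * (`|C| + 1))).
have c1 : 0 < 2 * (`|C| + 1) by rewrite mulr_gt0// ltr_wpDl.
have t0 : 0 < t by rewrite lt_min ltr01 divr_gt0// oppr_gt0.
have t1 : t <= 1 by rewrite ge_min lexx.
have tA : t * (2 * (`|C| + 1)) <= - A by rewrite -ler_pdivlMr// ge_min lexx orbT.
have := H t t0 t1; rewrite expr2 -mulrA -mulrDr pmulr_rge0// => h.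
have h1 : t * C <= t * `|C| by rewrite ler_wpM2l ?ler_norm// ltW.
by move: h h1 tA t0 A0; move: (t * C) (`|C|) => tc nc; nra.
Qed.

Section variational_inequalities.
Opaque ip L2norm wpd h1sq.
Context {R : realType} {n : nat}.
Local Notation V := 'rV[R]_n.
Local Notation mu := (lebesgueRn R n).
Variables (Om : set V) (oOm : open Om) (aij : 'I_n -> 'I_n -> V -> R) (c0 : V -> R).
Variables (yc yd : V -> R) (yc_L2 : L2 Om yc) (yd_L2 : L2 Om yd).
Variables (a b alpha beta : R) (alpha0 : 0 < alpha) (beta0 : 0 < beta).
Implicit Types (u v w y z : V -> R).

Let mOm : measurable Om := open_measurable_row oOm.

Lemma Uad_lin u w t : 0 <= t -> t <= 1 -> Uad Om a b u -> Uad Om a b w ->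
  Uad Om a b (fun x => u x + t * (w x - u x)).
Proof.
move=> t0 t1 [Lu ub] [Lw wb]; split.
  by apply: L2D => //; apply: L2Z => //; exact: L2B.
apply: filterS2 ub wb => x ux wx Ox; have := ux Ox; have := wx Ox.
move: (u x) (w x) => p q /andP[h1 h2] /andP[h3 h4]; apply/andP; split; nra.
Qed.

Let ip_segment A u w t : measurable A -> L2 A u -> L2 A w ->
  ip A (fun x => u x + t * (w x - u x)) (fun x => u x + t * (w x - u x)) = ip A u u + t * (ip A w w - ip A u u -
    ip A (fun x => w x - u x) (fun x => w x - u x)) +
    t ^+ 2 * ip A (fun x => w x - u x) (fun x => w x - u x).
Proof.
move=> mA Lu Lw; have Ld := L2B mA Lw Lu.
have E s := ip_lin2 mA s Lu Ld.
have := E 1; rewrite (_ : (fun x => u x + 1 * (w x - u x)) = w); last first.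
  by apply/funext => x; ring.
rewrite E; move: (ip A w w) (ip A u u) (ip A u _) (ip A (fun=> _) _) => p q r s.
by move=> ->; ring.
Qed.

Let norm_segment A u w t : measurable A -> 0 <= t -> t <= 1 ->
  mu.-integrable A (EFin \o u) -> mu.-integrable A (EFin \o w) ->
  \int[mu]_(x in A) `|u x + t * (w x - u x)| <=
  (\int[mu]_(x in A) `|u x|) + t * ((\int[mu]_(x in A) `|w x|) - \int[mu]_(x in A) `|u x|).
Proof.
move=> mA t0 t1 iu iw.
have nu : mu.-integrable A (EFin \o (fun x => `|u x|)).
  by have := integrable_abse iu; exact: eq_integrable.
have nw : mu.-integrable A (EFin \o (fun x => `|w x|)).
  by have := integrable_abse iw; exact: eq_integrable.
have ntu : mu.-integrable A (EFin \o (fun x => (1 - t) * `|u x|)).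
  by have := integrableZl mA (1 - t) nu; exact: eq_integrable.
have ntw : mu.-integrable A (EFin \o (fun x => t * `|w x|)).
  by have := integrableZl mA t nw; exact: eq_integrable.
have -> : (\int[mu]_(x in A) `|u x|) + t * ((\int[mu]_(x in A) `|w x|) - \int[mu]_(x in A) `|u x|) =
    \int[mu]_(x in A) ((1 - t) * `|u x| + t * `|w x|).
  by rewrite RintegralD// !RintegralZl//; ring.
apply: ae_Rintegral_le => //.
- have d : mu.-integrable A (EFin \o (fun x => t * (w x - u x))).
    have := integrableZl mA t (integrableB mA iw iu); exact: eq_integrable.
  have := integrable_abse (integrableD mA iu d); exact: eq_integrable.
- by have := integrableD mA ntu ntw; exact: eq_integrable.
apply: aeW => x _; rewrite (_ : u x + _ = (1 - t) * u x + t * w x); last by ring.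
have t1' : 0 <= 1 - t by rewrite subr_ge0.
by rewrite (le_trans (ler_normD _ _))// !normrM (ger0_norm t0) (ger0_norm t1').
Qed.

Section continuous_problem.
Variables (M theta : R) (k : nat).
Hypothesis ellOm : elliptic_on aij c0 M theta Om.
Hypothesis Omk : Om `<=` cube k.

Let Omfin : (mu Om < +oo)%E.
Proof.
apply: (@le_lt_trans _ _ (mu (cube k))); last exact: lebesgueRn_obox_lty.
by apply: le_measure; rewrite ?inE//; exact: measurable_obox.
Qed.

Let weak_solution_segment f g y w t : L2 Om f -> L2 Om g ->
  weak_solution aij c0 Om f y -> weak_solution aij c0 Om g w ->
  weak_solution aij c0 Om (fun x => f x + t * (g x - f x)) (fun x => y x + t * (w x - y x)).
Proof.
move=> Lf Lg Sf Sg.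
have S := weak_solution_lin oOm ellOm (-1) Lg Lf Sg Sf.
have Ld : L2 Om (fun x => g x + -1 * f x) by apply: L2D => //; exact: L2Z.
have := weak_solution_lin oOm ellOm t Lf Ld Sf S.
rewrite (_ : (fun x => f x + t * (g x + -1 * f x)) = (fun x => f x + t * (g x - f x))); last first.
  by apply/funext => x; ring.
by rewrite (_ : (fun x => y x + t * (w x + -1 * y x)) = (fun x => y x + t * (w x - y x)))//;
  apply/funext => x; ring.
Qed.

Lemma cost_diagonal y u : L2 Om u ->
  cost Om yd alpha beta y u u = 2^-1 * ip Om (fun x => y x - yd x) (fun x => y x - yd x) +
    alpha / 2 * ip Om u u + beta * \int[mu]_(x in Om) `|u x|.
Proof.
by move=> Lu; rewrite /cost !L2norm_sqr L1normE; move: (ip _ _ _) (ip Om u u) (\int[_]_(_ in _) _) => p q r; field.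
Qed.

(** Convexity of the L1 norm and the exact expansion of the quadratic terms along
    the segment from u to w; the term with w - u is what strong convexity gains. *)
Lemma optimal_variational_inequality y u z w yw :
  optimal aij c0 Om yc yd a b alpha beta y u z -> Uad Om a b w ->
  weak_solution aij c0 Om (w \+ yc) yw ->
  0 <= ip Om (fun x => y x - yd x) (fun x => yw x - y x) +
    alpha / 2 * (ip Om w w - ip Om u u - ip Om (fun x => w x - u x) (fun x => w x - u x)) +
    beta * ((\int[mu]_(x in Om) `|w x|) - \int[mu]_(x in Om) `|u x|).
Proof.
move=> [[Lu Lz Sy uz [_ zb]] opt] Uw Sw; have [Lw _] := Uw.
have Uu : Uad Om a b u.
  by split=> //; apply: filterS2 uz zb => x E H Ox; rewrite E// H.
have Ezz : ip Om z z = ip Om u u.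
  have zu : {ae mu, forall x, Om x -> z x = u x} by apply: filterS uz => x E /E.
  by rewrite (ae_eq_ipl mOm Lz Lu Lz zu) ipC (ae_eq_ipl mOm Lz Lu Lu zu).
have iu := L2_integrable mOm Omfin Lu; have iw := L2_integrable mOm Omfin Lw.
have iz := L2_integrable mOm Omfin Lz.
have nE (f : V -> R) : mu.-integrable Om (EFin \o f) -> mu.-integrable Om (EFin \o (fun x => `|f x|)).
  by move=> i; have := integrable_abse i; exact: eq_integrable.
have Ez1 : \int[mu]_(x in Om) `|z x| = \int[mu]_(x in Om) `|u x|.
  apply/eqP; rewrite eq_le; apply/andP; split; apply: ae_Rintegral_le => //; try exact: nE.
    by apply: filterS uz => x E /E ->.
  by apply: filterS uz => x E /E ->.
have Ec : cost Om yd alpha beta y u z = cost Om yd alpha beta y u u.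
  by rewrite /cost !L2norm_sqr !L1normE Ezz Ez1.
have Ly := weak_solution_L2 Sy; have Lyw := weak_solution_L2 Sw.
apply: (@first_order_condition _ _ (2^-1 * ip Om (fun x => yw x - y x) (fun x => yw x - y x) +
   alpha / 2 * ip Om (fun x => w x - u x) (fun x => w x - u x))) => t t0 t1.
pose ut := fun x => u x + t * (w x - u x).
pose yt := fun x => y x + t * (yw x - y x).
have Ut := Uad_lin (ltW t0) t1 Uu Uw; have [Lut _] := Ut.
have feas : feasible aij c0 Om yc a b yt ut ut.
  split=> //; last by apply: aeW.
  have := weak_solution_segment t (L2D mOm Lu yc_L2) (L2D mOm Lw yc_L2) Sy Sw.
  by rewrite (_ : (fun x => _ + t * _) = ut \+ yc)//; apply/funext => x; rewrite /ut/=; ring.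
have := opt yt ut ut feas; rewrite Ec !cost_diagonal//.
rewrite [ip Om ut ut](ip_segment t mOm Lu Lw).
have Ld := L2B mOm Ly yd_L2; have Le := L2B mOm Lyw Ly.
have -> : (fun x => yt x - yd x) = (fun x => (y x - yd x) + t * (yw x - y x)).
  by apply/funext => x; rewrite /yt; ring.
rewrite (ip_lin2 mOm t Ld Le).
have := ler_wpM2l (ltW beta0) (norm_segment mOm (ltW t0) t1 iu iw); rewrite -/ut.
gen_norms; move: (\int[_]_(_ in _) _) (\int[_]_(_ in _) _) (\int[_]_(_ in _) _).
by move=> *; lra.
Qed.

End continuous_problem.

Section discrete_problem.
Variables (T : mesh R n) (k : nat).
Hypothesis em : embedded_mesh Om T k.
Variables (Mc theta : R).
Local Notation D := (mesh_domain T).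
Hypothesis ellD : elliptic_on aij c0 Mc theta D.

Let oD : open D := @open_mesh_domain R n T.
Let mD : measurable D := open_measurable_row oD.

Lemma L2_mesh_domain (f : V -> R) : L2 Om f -> L2 D f.
Proof. exact: L2S mD mOm (em_sub em). Qed.

Let discrete_solution_segment f g y w t : L2 D f -> L2 D g ->
  discrete_solution aij c0 Om T f y -> discrete_solution aij c0 Om T g w ->
  discrete_solution aij c0 Om T (fun x => f x + t * (g x - f x)) (fun x => y x + t * (w x - y x)).
Proof.
move=> Lf Lg Sf Sg.
have S := discrete_solution_lin em ellD (-1) Lg Lf Sg Sf.
have Ld : L2 D (fun x => g x + -1 * f x) by apply: L2D => //; exact: L2Z.
have := discrete_solution_lin em ellD t Lf Ld Sf S.
rewrite (_ : (fun x => f x + t * (g x + -1 * f x)) = (fun x => f x + t * (g x - f x))); last first.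
  by apply/funext => x; ring.
by rewrite (_ : (fun x => y x + t * (w x + -1 * y x)) = (fun x => y x + t * (w x - y x)))//;
  apply/funext => x; ring.
Qed.

(** Convexity along the segment from u to w; the lumped terms are compared vertex by
    vertex. *)
Lemma discrete_variational_inequality y u z w yw :
  discrete_optimal aij c0 Om yc yd a b alpha beta T y u z ->
  fe_space Om T w -> Uad Om a b w ->
  discrete_solution aij c0 Om T (w \+ yc) yw ->
  0 <= ip D (fun x => y x - yd x) (fun x => yw x - y x) +
    alpha / 4 * (ip D w w - ip D u u) +
    alpha / 4 * (lumped (fun i => w (vtx T i) ^+ 2) - lumped (fun i => u (vtx T i) ^+ 2)) +
    beta * (lumped (fun i => `|w (vtx T i)|) - lumped (fun i => `|u (vtx T i)|)).
Proof.
move=> [[fu fz Sy uz [Lz zb]] opt] fw Uw Sw; have [Lw _] := Uw.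
have uzE x : closure Om x -> u x = z x by move=> Ox; apply: uz; exact: mem_set.
have vtxO i : closure Om (vtx T i).
  exact: (closed_mesh_closure_domain (em_tri em) (em_sub em) (vtx_closed_mesh (em_tri em) i)).
have Luo := fe_L2_Om em fu.
have Uu : Uad Om a b u.
  split=> //; apply: filterS zb => x H Ox; rewrite uzE ?H//; exact: subset_closure.
have Ec : discrete_cost Om yd alpha beta T y u z = discrete_cost Om yd alpha beta T y u u.
  rewrite /discrete_cost (L2h_norm_sqr em fz) (L2h_norm_sqr em fu).
  rewrite (L1h_normE em fz) (L1h_normE em fu).
  rewrite (_ : (fun i => z (vtx T i) ^+ 2) = (fun i => u (vtx T i) ^+ 2)).
    by rewrite (_ : (fun i => `|z (vtx T i)|) = (fun i => `|u (vtx T i)|))//;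
      apply/funext => i; rewrite uzE.
  by apply/funext => i; rewrite uzE.
have [fy _] := Sy; have [fyw _] := Sw.
have Ly := fe_L2 em fy; have Lyw := fe_L2 em fyw.
have Lu := fe_L2 em fu; have Lwd := fe_L2 em fw.
have Lyd := L2_mesh_domain yd_L2; have Lyc := L2_mesh_domain yc_L2.
apply: (@first_order_condition _ _ (2^-1 * ip D (fun x => yw x - y x) (fun x => yw x - y x))) => t t0 t1.
pose ut := fun x => u x + t * (w x - u x).
pose yt := fun x => y x + t * (yw x - y x).
have fut : fe_space Om T ut.
  rewrite (_ : ut = (fun x => u x + t * (w x + -1 * u x))).
    by apply: fe_space_lin => //; exact: fe_space_lin.
  by apply/funext => x; rewrite /ut; ring.
have Ut := Uad_lin (ltW t0) t1 Uu Uw.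
have feas : discrete_feasible aij c0 Om yc a b T yt ut ut.
  split=> //.
  have := discrete_solution_segment t (L2D mD Lu Lyc) (L2D mD Lwd Lyc) Sy Sw.
  by rewrite (_ : (fun x => _ + t * _) = ut \+ yc)//; apply/funext => x; rewrite /ut/=; ring.
have := opt yt ut ut feas; rewrite Ec /discrete_cost.
rewrite (L2h_norm_sqr em fut) (L2h_norm_sqr em fu) (L1h_normE em fut) (L1h_normE em fu).
rewrite !L2norm_sqr -[y \- yd]/(fun x => y x - yd x) [ip D ut ut](ip_segment t mD Lu Lwd).
have Ld := L2B mD Ly Lyd; have Le := L2B mD Lyw Ly.
have -> : yt \- yd = (fun x => (y x - yd x) + t * (yw x - y x)).
  by apply/funext => x; rewrite /yt/=; ring.
rewrite (ip_lin2 mD t Ld Le).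
have v0 v : fe_space Om T v -> interior_values (fun i => v (vtx T i) ^+ 2).
  by move=> fv i nD; rewrite (fe_space_vtx_out em fv)// expr0n.
have v1 v : fe_space Om T v -> interior_values (fun i => `|v (vtx T i)|).
  by move=> fv i nD; rewrite (fe_space_vtx_out em fv)// normr0.
have l2 : lumped (fun i => ut (vtx T i) ^+ 2) <= (1 - t) * lumped (fun i => u (vtx T i) ^+ 2) +
    t * lumped (fun i => w (vtx T i) ^+ 2).
  rewrite -(lumped_lin em)//; [|exact: v0|exact: v0].
  apply: (lumped_le em); [exact: v0| |].
    by move=> i nD; rewrite (v0 u fu i nD) (v0 w fw i nD) !mulr0 addr0.
  move=> i; rewrite /ut; move: (u _) (w _) => p q.
  have : 0 <= t * (1 - t) * (q - p) ^+ 2.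
    by rewrite mulr_ge0 ?sqr_ge0// mulr_ge0 ?(ltW t0)// subr_ge0.
  by lra.
have l1 : lumped (fun i => `|ut (vtx T i)|) <= (1 - t) * lumped (fun i => `|u (vtx T i)|) +
    t * lumped (fun i => `|w (vtx T i)|).
  rewrite -(lumped_lin em)//; [|exact: v1|exact: v1].
  apply: (lumped_le em); [exact: v1| |].
    by move=> i nD; rewrite (v1 u fu i nD) (v1 w fw i nD) !mulr0 addr0.
  move=> i; rewrite /ut (_ : u _ + _ = (1 - t) * u (vtx T i) + t * w (vtx T i)); last by ring.
  have t1' : 0 <= 1 - t by rewrite subr_ge0.
  by rewrite (le_trans (ler_normD _ _))// !normrM (gtr0_norm t0) (ger0_norm t1').
have := ler_wpM2l (ltW beta0) l1.
have a4 : 0 <= alpha / 4 by rewrite divr_ge0// ltW.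
have := ler_wpM2l a4 l2.
have dd0 : 0 <= alpha / 4 * (t * (1 - t) * ip D (fun x => w x - u x) (fun x => w x - u x)).
  by rewrite mulr_ge0// mulr_ge0 ?ip_ge0// mulr_ge0 ?(ltW t0)// subr_ge0.
move: dd0; rewrite /=; gen_norms; move: (lumped _) (lumped _) (lumped _) (lumped _) (lumped _) (lumped _).
by move=> *; lra.
Qed.

End discrete_problem.
End variational_inequalities.

(** * The error estimate *)

Lemma sqr_le_width (R : realFieldType) (a b r : R) : a < 0 -> 0 < b ->
  a <= r <= b -> r * r <= (b - a) ^+ 2.
Proof.
move=> a0 b0 /andP[ar rb].
have : 0 <= (b - a - r) * (b - a + r) by apply: mulr_ge0; lra.
by lra.
Qed.

Section error_estimate.
Opaque ip L2norm wpd h1sq.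
Context {R : realType} {n : nat}.
Local Notation V := 'rV[R]_n.
Local Notation mu := (lebesgueRn R n).
Variables (Om : set V) (T : mesh R n) (k : nat).
Hypothesis em : embedded_mesh Om T k.
Variables (aij : 'I_n -> 'I_n -> V -> R) (c0 : V -> R) (M theta : R).
Hypothesis M0 : 0 <= M.
Hypothesis theta0 : 0 < theta.
Local Notation D := (mesh_domain T).
Hypothesis ellOm : elliptic_on aij c0 M theta Om.
Hypothesis ellD : elliptic_on aij c0 M theta D.
Variables (yc yd : V -> R) (yc_L2 : L2 Om yc) (yd_L2 : L2 Om yd).
Variables (a b beta c1 : R).
Hypotheses (a0 : a < 0) (b0 : 0 < b) (beta0 : 0 < beta) (c10 : 0 < c1).
Hypothesis fe_error : fe_error_estimate aij c0 c1 Om T.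
Implicit Types (u v w y z : V -> R).

Let oOm := em_open em.
Let mOm : measurable Om := open_measurable_row oOm.
Let oD : open D := @open_mesh_domain R n T.
Let mD : measurable D := open_measurable_row oD.
Let DOm := em_sub em.
Local Notation P := (poincare_cst theta k).
Local Notation h := (mesh_size T).

Let Omfin : (mu Om < +oo)%E.
Proof.
apply: (@le_lt_trans _ _ (mu (cube k))); last exact: lebesgueRn_obox_lty.
by apply: le_measure; rewrite ?inE//; [exact: measurable_obox|exact: em_cube em].
Qed.

Let L2D' (f : V -> R) : L2 Om f -> L2 D f.
Proof. exact: L2S mD mOm DOm. Qed.

Lemma mesh_size_ge0 : 0 <= h.
Proof. exact: bigmax_ge_id. Qed.

Definition control_bound : R := Num.sqrt ((b - a) ^+ 2 * fine (mu Om)).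

Lemma Uad_bound u : Uad Om a b u -> L2norm Om u <= control_bound.
Proof.
move=> [Lu ub]; rewrite -[L2norm Om u]ger0_norm ?L2norm_ge0// -sqrtr_sqr L2norm_sqr.
apply: ler_wsqrtr; rewrite -ip_fold -Rintegral_cst//.
apply: ae_Rintegral_le => //.
- exact: L2_integrable_mul.
- apply: L2_integrable => //.
  by apply: (@L2_bounded _ _ _ mOm _ `|(b - a) ^+ 2|); rewrite ?measurable_cst//.
apply: filterS ub => x H Ox; have := H Ox; exact: sqr_le_width.
Qed.

Let fe_ip_Om (f v : V -> R) : fe_space Om T v -> ip Om f v = ip D f v.
Proof.
move=> fv; rewrite -!ip_fold; apply: Rintegral_out => // x Ox nDx.
by rewrite (fe_out fv Ox nDx) mulr0.
Qed.

Let fe_norm_Om v : fe_space Om T v ->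
  \int[mu]_(x in Om) `|v x| = \int[mu]_(x in D) `|v x|.
Proof.
move=> fv; apply: Rintegral_out => // x Ox nDx.
by rewrite (fe_out fv Ox nDx) normr0.
Qed.

Let subdomain_le (f : V -> R) : mu.-integrable Om (EFin \o f) -> (forall x, 0 <= f x) ->
  \int[mu]_(x in D) f x <= \int[mu]_(x in Om) f x.
Proof.
move=> iO f0; have iD : mu.-integrable D (EFin \o f) by exact: integrableS iO.
rewrite [leLHS]Rintegral_mkcond [leRHS]Rintegral_mkcond; apply: ae_Rintegral_le => //.
- have := (integrable_mkcond (EFin \o f) mD).1 iD; apply: eq_integrable => // x _.
  by rewrite /= !patchE; case: ifP.
- have := (integrable_mkcond (EFin \o f) mOm).1 iO; apply: eq_integrable => // x _.
  by rewrite /= !patchE; case: ifP.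
apply: aeW => x _; rewrite !patchE; case: ifPn => [/set_mem Dx|_].
  by rewrite mem_set//; exact: DOm.
by case: ifP.
Qed.

Let L2norm_subdomain (f : V -> R) : L2 Om f -> L2norm D f <= L2norm Om f.
Proof.
move=> Lf; rewrite -[leLHS]ger0_norm ?L2norm_ge0// -[leRHS]ger0_norm ?L2norm_ge0//.
rewrite -!sqrtr_sqr !L2norm_sqr; apply: ler_wsqrtr; rewrite -!ip_fold.
apply: subdomain_le; first exact: L2_integrable_mul.
by move=> x; rewrite -expr2 sqr_ge0.
Qed.

Lemma fe_error_L2 u y yh : L2 Om u -> weak_solution aij c0 Om (u \+ yc) y ->
  discrete_solution aij c0 Om T (u \+ yc) yh -> L2norm Om u <= control_bound ->
  L2norm Om (y \- yh) <= c1 * h ^+ 2 * (control_bound + L2norm Om yc).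
Proof.
move=> Lu Sy Syh ub; have := fe_error Lu yc_L2 Sy Syh.
have g0 : 0 <= h * grad_norm Om (y \- yh) by rewrite mulr_ge0 ?mesh_size_ge0 ?sqrtr_ge0.
move=> H; apply: le_trans (_ : c1 * h ^+ 2 * (L2norm Om u + L2norm Om yc) <= _).
  by apply: le_trans H; rewrite lerDl.
by rewrite ler_wpM2l ?lerD2r// mulr_ge0 ?sqr_ge0// ltW.
Qed.

(** The competitor of the discrete control interpolates the minimizers at the vertex
    values of the discrete adjoint state q, that of the continuous control is the
    discrete control. In the sum all cost terms cancel or have the right sign, and the
    adjoint terms pair q with u - uh, a difference of discrete states by duality. *)
Lemma combined_variational_inequality alpha y u z yh uh zh yhat ytil q : 0 < alpha ->
  optimal aij c0 Om yc yd a b alpha beta y u z ->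
  discrete_optimal aij c0 Om yc yd a b alpha beta T yh uh zh ->
  weak_solution aij c0 Om (uh \+ yc) yhat ->
  discrete_solution aij c0 Om T (u \+ yc) ytil ->
  discrete_solution aij c0 Om T (fun x => yh x - yd x) q ->
  alpha / 2 * ip Om (fun x => u x - uh x) (fun x => u x - uh x) <=
    ip Om (fun x => y x - yd x) (fun x => yhat x - y x) +
    ip Om (fun x => yh x - yd x) (fun x => ytil x - yh x) +
    (2 * alpha)^-1 * h ^+ 2 * h1sq D q.
Proof.
move=> al0 opt dopt Syhat Sytil Sq.
have [[Lu Lz Sy uz [_ zb]] _] := opt.
have [[fuh fzh Syh uzh [_ zhb]] _] := dopt.
have ub : {ae mu, forall x, Om x -> a <= u x <= b}.
  by apply: filterS2 uz zb => x E H Ox; rewrite E// H.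
have uhzh x : Om x -> uh x = zh x.
  by move=> Ox; apply: uzh; apply: mem_set; exact: subset_closure.
have Luh := fe_L2_Om em fuh.
have Uuh : Uad Om a b uh by split=> //; apply: filterS zhb => x H Ox; rewrite uhzh// H.
have VI := optimal_variational_inequality oOm yc_L2 yd_L2 beta0 ellOm (em_cube em) opt Uuh Syhat.
have [fq _] := Sq; have [fyh _] := Syh; have [fytil _] := Sytil.
have /boolp.choice[psi Hpsi] : forall i : 'I_(nvtx T), exists m, a <= m <= b /\
    forall v : R, a <= v <= b -> control_cost alpha beta (q (vtx T i)) m +
      alpha / 2 * (v - m) ^+ 2 <= control_cost alpha beta (q (vtx T i)) v.
  move=> i; have [m m1 m2] := control_cost_minimizer (q (vtx T i)) al0 beta0 a0 b0.
  by exists m.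
have psi0 : interior_values psi.
  move=> i nD; have [_] := Hpsi i; rewrite (fe_space_vtx_out em fq nD).
  exact: control_cost_minimizer0.
pose vh := interp psi.
have nvh : nodal_extension vh psi by exact: (interpP em).
have fvh : fe_space Om T vh by exact: (nodal_extension_fe_space em nvh).
have vhE i : vh (vtx T i) = psi i by exact: (nodal_extension_vtx em _ nvh).
have Lvh := fe_L2_Om em fvh.
have Uvh : Uad Om a b vh.
  split=> //; apply: aeW => x Ox; have [Dx|nDx] := pselect (D x); last first.
    by rewrite (fe_out fvh Ox nDx) !ltW.
  rewrite (fe_bary em fvh Dx); have s1 := bary_sum (em_tri em) (mesh_domain_closed_mesh Dx).
  apply/andP; split.
    rewrite -[leLHS]mul1r -s1 mulr_suml; apply: ler_sum => i _.
    by rewrite ler_wpM2l ?(bary_ge0 (em_tri em))// vhE; have [/andP[]] := Hpsi i.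
  rewrite -[leRHS]mul1r -s1 mulr_suml; apply: ler_sum => i _.
  by rewrite ler_wpM2l ?(bary_ge0 (em_tri em))// vhE; have [/andP[]] := Hpsi i.
have Ldyc := L2D' yc_L2; have Ldyd := L2D' yd_L2; have Ldu := L2D' Lu.
have Lduh := fe_L2 em fuh; have Ldvh := fe_L2 em fvh.
have Ldyh := fe_L2 em fyh; have Ldq := fe_L2 em fq.
have [p Sp] := discrete_solution_exists em ellD theta0 (L2D mD Ldvh Ldyc).
have DVI := discrete_variational_inequality oOm yc_L2 yd_L2 al0 beta0 em ellD dopt fvh Uvh Sp.
(* differences of discrete states are discrete states of control differences *)
have dual v w : L2 D v -> discrete_solution aij c0 Om T (v \+ yc) w ->
    ip D (fun x => yh x - yd x) (fun x => w x - yh x) = ip D q v - ip D q uh.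
  move=> Lv Sw; have Ldiff : L2 D (fun x => v x + -1 * uh x) by apply: L2D => //; exact: L2Z.
  have S := discrete_solution_lin em ellD (-1) (L2D mD Lv Ldyc) (L2D mD Lduh Ldyc) Sw Syh.
  have -> : (fun x => w x - yh x) = (fun x => w x + -1 * yh x) by apply/funext => x; ring.
  rewrite (discrete_solution_duality em ellD Sq S).
  rewrite (_ : (fun x => _ + -1 * _) = (fun x => v x - uh x)); last first.
    by apply/funext => x /=; ring.
  by rewrite ipBl// !(ipC _ q).
have := lumped_control_comparison (a := a) (b := b) em al0 beta0 fq fvh Ldu.
have ubD : {ae mu, forall x, D x -> a <= u x <= b} by apply: filterS ub => x H /DOm.
have vhab i : a <= vh (vtx T i) <= b by rewrite vhE; have [] := Hpsi i.
have vhopt i (w : R) : a <= w <= b -> control_cost alpha beta (q (vtx T i)) (vh (vtx T i)) +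
    alpha / 2 * (w - vh (vtx T i)) ^+ 2 <= control_cost alpha beta (q (vtx T i)) w.
  by move=> wab; rewrite vhE; have [_] := Hpsi i; apply.
move=> /(_ ubD vhab vhopt) comp.
have i1 : mu.-integrable Om (EFin \o (fun x => `|u x|)).
  by have := integrable_abse (L2_integrable mOm Omfin Lu); exact: eq_integrable.
have s1 := subdomain_le i1 (fun x => normr_ge0 (u x)).
have s2 : ip D u u <= ip Om u u.
  rewrite -!ip_fold; apply: subdomain_le; first exact: L2_integrable_mul.
  by move=> x; rewrite -expr2 sqr_ge0.
have lu2 := L2norm_le_lumped em fuh; have lu1 := L1norm_le_lumped em fuh.
have DVI' := DVI; rewrite (dual _ _ Ldvh Sp) in DVI'.
have fdiff : fe_space Om T (fun x => ytil x - yh x).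
  rewrite (_ : (fun x => _) = (fun x => ytil x + -1 * yh x)); first exact: fe_space_lin.
  by apply/funext => x; ring.
rewrite (fe_ip_Om (fun x => yh x - yd x) fdiff) (dual _ _ Ldu Sytil).
have Ez : ip Om (fun x => uh x - u x) (fun x => uh x - u x) =
    ip Om (fun x => u x - uh x) (fun x => u x - uh x).
  by rewrite -!ip_fold; apply: eq_Rintegral => x _; ring.
have hq : (2 * alpha)^-1 * h ^+ 2 * \sum_(l < n) ip D (wpd D l q) (wpd D l q) <=
    (2 * alpha)^-1 * h ^+ 2 * h1sq D q.
  rewrite ler_wpM2l//; last by rewrite h1sqE lerDr ip_ge0.
  by rewrite mulr_ge0 ?sqr_ge0// invr_ge0 mulr_ge0// ltW.
rewrite Ez (fe_ip_Om uh fuh) (fe_norm_Om fuh) in VI.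
have a2 : 0 <= alpha / 2 by rewrite divr_ge0// ltW.
have a4 : 0 <= alpha / 4 by rewrite divr_ge0// ltW.
have k1 := ler_wpM2l a2 s2; have k2 := ler_wpM2l (ltW beta0) s1.
have k3 := ler_wpM2l a4 lu2; have k4 := ler_wpM2l (ltW beta0) lu1.
move: VI DVI' comp k1 k2 k3 k4 hq.
move: ((2 * alpha)^-1 * h ^+ 2 * h1sq D q) => r.
move: ((2 * alpha)^-1 * h ^+ 2 * \sum_(l < n) ip D (wpd D l q) (wpd D l q)) => r'; gen_norms.
move: (lumped _) (lumped _) (lumped _) (lumped _).
move: (\int[_]_(_ in _) _) (\int[_]_(_ in _) _) (\int[_]_(_ in _) _).
by move=> *; lra.
Qed.

(** K bounds the right-hand sides of the state equations, B the residuals y - yd and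
    yh - yd. *)
Definition error_cst : R :=
  let K := control_bound + L2norm Om yc in
  let B := P * K + L2norm Om yd + c1 * K in
  2 * B * (c1 * K) + (P * B) ^+ 2.

(** With E = y - yh, the two inner products of the combined inequality are -(E, E) up
    to products of residuals with finite element errors. *)
Lemma control_error_estimate alpha y u z yh uh zh : 0 < alpha -> h <= 1 ->
  optimal aij c0 Om yc yd a b alpha beta y u z ->
  discrete_optimal aij c0 Om yc yd a b alpha beta T yh uh zh ->
  alpha / 2 * L2norm Om (u \- uh) ^+ 2 + L2norm Om (y \- yh) ^+ 2 <=
  error_cst * (h ^+ 2 + alpha^-1 * h ^+ 2).
Proof.
move=> al0 h1 opt dopt.
have [[Lu Lz Sy uz [_ zb]] _] := opt.
have [[fuh fzh Syh uzh [_ zhb]] _] := dopt.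
have Uu : Uad Om a b u.
  by split=> //; apply: filterS2 uz zb => x E H Ox; rewrite E// H.
have uhzh x : Om x -> uh x = zh x.
  by move=> Ox; apply: uzh; apply: mem_set; exact: subset_closure.
have Luh := fe_L2_Om em fuh.
have Uuh : Uad Om a b uh by split=> //; apply: filterS zhb => x H Ox; rewrite uhzh// H.
have [m nm] : exists m, n = m.+1 by case: (n) (em_dim em) => // m _; exists m.
have i0 : 'I_n by rewrite nm; exact: ord0.
have Luhyc := L2D mOm Luh yc_L2; have Luyc := L2D mOm Lu yc_L2.
have [yhat Syhat] := weak_solution_exists oOm i0 ellOm M0 theta0 (em_cube em) Luhyc.
have [ytil Sytil] := discrete_solution_exists em ellD theta0 (L2D' Luyc).
have [fyh _] := Syh; have [fytil _] := Sytil.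
have Ly := weak_solution_L2 Sy; have Lyhat := weak_solution_L2 Syhat.
have Lyh := fe_L2_Om em fyh; have Lytil := fe_L2_Om em fytil.
have Ldh : L2 Om (fun x => yh x - yd x) by exact: L2B.
have Ld : L2 Om (fun x => y x - yd x) by exact: L2B.
have [q Sq] := discrete_solution_exists em ellD theta0 (L2D' Ldh).
have main := combined_variational_inequality al0 opt dopt Syhat Sytil Sq.
have ub := Uad_bound Uu; have uhb := Uad_bound Uuh.
set K := control_bound + L2norm Om yc.
set B := P * K + L2norm Om yd + c1 * K.
have P0 : 0 <= P by exact: poincare_cst_ge0.
have K0 : 0 <= K by rewrite addr_ge0 ?sqrtr_ge0 ?L2norm_ge0.
have c1K : 0 <= c1 * K by rewrite mulr_ge0// ltW.
have h0 := mesh_size_ge0.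
have h21 : h ^+ 2 <= 1 by rewrite expr_le1.
have e1 := fe_error_L2 Luh Syhat Syh uhb; rewrite -/K in e1.
have e2 := fe_error_L2 Lu Sy Sytil ub; rewrite -/K in e2.
have e1' : L2norm Om (yhat \- yh) <= c1 * K.
  by apply: (le_trans e1); rewrite mulrAC ler_piMr.
have stab v w : L2 Om v -> L2norm Om v <= control_bound -> weak_solution aij c0 Om (v \+ yc) w ->
    L2norm Om w <= P * K.
  move=> Lv vb Sw; apply: (le_trans (weak_solution_bound oOm i0 ellOm theta0 (em_cube em) (L2D mOm Lv yc_L2) Sw)).
  rewrite ler_wpM2l//; apply: (le_trans (L2normD mOm Lv yc_L2)).
  by rewrite lerD2r.
have yb := stab _ _ Lu ub Sy; have yhatb := stab _ _ Luh uhb Syhat.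
have norm_sub (f g : V -> R) : L2 Om f -> L2 Om g ->
    L2norm Om (fun x => f x - g x) <= L2norm Om f + L2norm Om g.
  move=> Lf Lg; have Lg' := L2Z mOm (-1) Lg.
  have := L2normD mOm Lf Lg'; rewrite L2normZ// normrN1 mul1r.
  by rewrite (_ : (fun x => f x + -1 * g x) = (fun x => f x - g x))//; apply/funext => x; ring.
have dB : L2norm Om (fun x => y x - yd x) <= B.
  apply: (le_trans (norm_sub _ _ Ly yd_L2)); rewrite /B -[leLHS]addr0.
  by apply: lerD => //; rewrite lerD2r.
have yhE : yh = (fun x => yhat x - (yhat x - yh x)) by apply/funext => x; ring.
have dhB : L2norm Om (fun x => yh x - yd x) <= B.
  apply: (le_trans (norm_sub _ _ Lyh yd_L2)); rewrite /B addrAC lerD2r.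
  rewrite {1}yhE; apply: (le_trans (norm_sub _ _ Lyhat (L2B mOm Lyhat Lyh))).
  exact: lerD.
have B0 : 0 <= B by apply: le_trans dB; exact: L2norm_ge0.
have [_ hq] := discrete_solution_bound em ellD theta0 (L2D' Ldh) Sq.
have hqB : h1sq D q <= (P * B) ^+ 2.
  have PB := ler_wpM2l P0 (le_trans (L2norm_subdomain Ldh) dhB).
  by apply: (le_trans hq); rewrite lerXn2r// nnegrE mulr_ge0// L2norm_ge0.
pose d := fun x => y x - yd x; pose dh := fun x => yh x - yd x.
pose E := fun x => y x - yh x.
pose e_1 := fun x => yhat x - yh x; pose e_2 := fun x => y x - ytil x.
have LE : L2 Om E by exact: L2B.
have Le1 : L2 Om e_1 by exact: L2B.
have Le2 : L2 Om e_2 by exact: L2B.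
have t1 : ip Om d (fun x => yhat x - y x) = ip Om d e_1 - ip Om d E.
  rewrite (_ : (fun x => yhat x - y x) = (fun x => e_1 x - E x)); last first.
    by apply/funext => x; rewrite /e_1 /E; ring.
  by rewrite ipC ipBl// !(ipC _ d).
have t2 : ip Om dh (fun x => ytil x - yh x) = ip Om dh E - ip Om dh e_2.
  rewrite (_ : (fun x => ytil x - yh x) = (fun x => E x - e_2 x)); last first.
    by apply/funext => x; rewrite /e_2 /E; ring.
  by rewrite ipC ipBl// !(ipC _ dh).
have t3 : ip Om E E = ip Om d E - ip Om dh E.
  by rewrite -ipBl//; congr (ip _ _ _); apply/funext => x; rewrite /d /dh /E; ring.
have n1 : ip Om d e_1 <= B * (c1 * h ^+ 2 * K).
  apply: (le_trans (ler_norm _)); apply: (le_trans (ip_normM mOm Ld Le1)).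
  by apply: ler_pM; rewrite ?L2norm_ge0.
have n2 : - ip Om dh e_2 <= B * (c1 * h ^+ 2 * K).
  apply: (le_trans (ler_norm _)); rewrite normrN; apply: (le_trans (ip_normM mOm Ldh Le2)).
  by apply: ler_pM; rewrite ?L2norm_ge0.
have r1 : (2 * alpha)^-1 * h ^+ 2 * h1sq D q <= alpha^-1 * h ^+ 2 * (P * B) ^+ 2.
  have ai : (2 * alpha)^-1 <= alpha^-1 by rewrite lef_pV2 ?posrE ?mulr_gt0//; lra.
  apply: ler_pM => //; [|exact: h1sq_ge0|].
    by rewrite mulr_ge0 ?sqr_ge0// invr_ge0 mulr_ge0// ltW.
  by rewrite ler_wpM2r ?sqr_ge0.
rewrite !L2norm_sqr.
rewrite t1 t2 in main; rewrite -[ip Om (y \- yh) _]/(ip Om E E).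
rewrite -[ip Om (u \- uh) _]/(ip Om (fun x => u x - uh x) (fun x => u x - uh x)).
have f1 : 0 <= alpha^-1 * h ^+ 2 * (2 * B * (c1 * K)).
  by rewrite !mulr_ge0// ?invr_ge0 ?ltW.
have f2 : 0 <= h ^+ 2 * (P * B) ^+ 2 by rewrite mulr_ge0 ?sqr_ge0.
rewrite /error_cst -/K -/B.
move: main t3 n1 n2 r1 f1 f2; move: ((2 * alpha)^-1 * h ^+ 2 * h1sq D q) => r.
move: (h ^+ 2) (alpha^-1) ((P * B) ^+ 2); gen_norms.
by move=> *; lra.
Qed.

End error_estimate.

Theorem theorem7 (R : realType) (n : nat) (hn : n = 2%N \/ n = 3%N)
  (Om : set 'rV[R]_n)
  (Om_open : open Om) (Om_neq0 : Om !=set0)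
  (Om_convex : convex_set (Om : set (convex_lmodType 'rV[R]_n)))
  (Om_bounded : bounded_set Om)
  (Om_boundary : C11_boundary Om \/ polyhedral Om)
  (aij : 'I_n -> 'I_n -> 'rV[R]_n -> R) (c0 : 'rV[R]_n -> R)
  (A_coefficients : coefficients aij c0 Om)
  (yc yd : 'rV[R]_n -> R) (yc_L2 : L2 Om yc) (yd_L2 : L2 Om yd)
  (a b beta : R) (a_lt0 : a < 0) (b_gt0 : 0 < b) (beta_gt0 : 0 < beta)
  (alpha0 : R) (alpha0_gt0 : 0 < alpha0)
  (kappa tau c c1 : R) (kappa_gt0 : 0 < kappa) (tau_gt0 : 0 < tau)
  (c_gt0 : 0 < c) (c1_gt0 : 0 < c1) :
  exists h0 C : R, 0 < h0 /\
  forall (H : set R) (T : R -> mesh R n),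
    mesh_family aij c0 kappa tau c c1 Om H T ->
  forall h, H h -> h < h0 ->
  forall alpha : R, 0 < alpha -> alpha <= alpha0 ->
  forall y u z yh uh zh : 'rV[R]_n -> R,
    optimal aij c0 Om yc yd a b alpha beta y u z ->
    discrete_optimal aij c0 Om yc yd a b alpha beta (T h) yh uh zh ->
    alpha / 2 * L2norm Om (u \- uh) ^+ 2 + 2^-1 * L2norm Om (y \- yh) ^+ 2 <=
    C * (h ^+ 2 + alpha * h ^+ 2 + alpha^-1 * h ^+ 2 + h ^+ 3 +
         alpha^-1 * h ^+ 4 + alpha ^- 2 * h ^+ 4).
Proof.
have n0 : (0 < n)%N by case: hn => ->.
have mOm := open_measurable_row Om_open.
have [k Omk] := bounded_row Om_bounded.
have [M [theta [M0 theta0 ell]]] := coefficients_elliptic_on mOm A_coefficients.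
exists 1, (error_cst Om k theta yc yd a b c1); split; first by [].
move=> H T fam h Hh h1 alpha al0 _ y u z yh uh zh opt dopt.
have [[h0 hT tri] [_ [DOm poly C11] err]] := fam h Hh.
have em : embedded_mesh Om (T h) k.
  split => //; first exact: convex_set_segment.
  case: Om_boundary => [/C11[cN _ _]|/poly ->]; [right|by left].
  exact: convex_set_segment.
have ellD := ell _ (open_measurable_row (@open_mesh_domain R n (T h))) DOm.
have := control_error_estimate em M0 theta0 (ell _ mOm (@subset_refl _ Om)) ellD
  yc_L2 yd_L2 a_lt0 b_gt0 beta_gt0 c1_gt0 err al0 _ opt dopt.
rewrite hT => /(_ (ltW h1)) E.
set C := error_cst _ _ _ _ _ _ _ _ in E *.
have C0 : 0 <= C.
  rewrite /C /error_cst; have P0 := poincare_cst_ge0 k theta0.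
  have K0 : 0 <= control_bound Om a b + L2norm Om yc by rewrite addr_ge0 ?sqrtr_ge0 ?L2norm_ge0.
  have cK : 0 <= c1 * (control_bound Om a b + L2norm Om yc) by rewrite mulr_ge0// ltW.
  have B0 := addr_ge0 (addr_ge0 (mulr_ge0 P0 K0) (L2norm_ge0 Om yd)) cK.
  by rewrite addr_ge0 ?sqr_ge0// mulr_ge0// mulr_ge0.
have y0 : 0 <= L2norm Om (y \- yh) ^+ 2 by exact: sqr_ge0.
apply: (@le_trans _ _ (C * (h ^+ 2 + alpha^-1 * h ^+ 2))).
  by move: E y0; move: (L2norm _ _ ^+ 2) (L2norm _ _ ^+ 2) (C * _) => *; lra.
rewrite ler_wpM2l//.
have x1 : 0 <= alpha * h ^+ 2 by rewrite mulr_ge0 ?sqr_ge0// ltW.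
have x2 : 0 <= h ^+ 3 by rewrite exprn_ge0// ltW.
have x3 : 0 <= alpha^-1 * h ^+ 4 by rewrite mulr_ge0 ?invr_ge0 ?exprn_ge0// ltW.
have x4 : 0 <= alpha ^- 2 * h ^+ 4 by rewrite mulr_ge0 ?invr_ge0 ?exprn_ge0// ltW.
by lra.
Qed.
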